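(* Any Łojasiewicz function is distributionally integrable (over every compact interval $[a,b]$). Any distributionally regulated function is distributionally integrable (over every compact interval $[a,b]$).
   Context: Distributions are real. Notation: $\overline{\mathbb R}=\mathbb R\cup\{-\infty,\infty\}$; $\mathcal E'[a,b]$ is the space of distributions on $\mathbb R$ with support contained in $[a,b]$; $\langle \mathsf g(x+ty),\phi(y)\rangle:=|t|^{-1}\langle \mathsf g(y),\phi((y-x)/t)\rangle$ for $t\ne0$. Point values. For $\mathsf g\in\mathcal D'(\mathbb R)$, the distributional (Łojasiewicz) point value $\mathsf g(x_0)$ exists and equals $\gamma\in\mathbb R$ if $\lim_{\varepsilon\to0}\langle \mathsf g(x_0+\varepsilon y),\phi(y)\rangle=\gamma\int_{-\infty}^\infty\phi(y)\,dy$ for every $\phi\in\mathcal D(\mathbb R)$. A Łojasiewicz distribution is one having a point value at every point of $\mathbb R$. A function $G:\mathbb R\to\mathbb R$ is a Łojasiewicz function if there is a (necessarily unique) Łojasiewicz distribution $\mathsf G$ with $\mathsf G(x)=G(x)$ for all $x\in\mathbb R$. Regulated functions. A distribution $\mathsf f\in\mathcal D'(\mathbb R)$ is a regulated distribution if for every $x_0\in\mathbb R$ there are real numbers $\mathsf f(x_0^-)$, $\mathsf f(x_0^+)$ (the distributional lateral limits) such that for every $\phi\in\mathcal D(\mathbb R)$ $$\lim_{\varepsilon\to0^+}\langle\mathsf f(x_0+\varepsilon x),\phi(x)\rangle=\mathsf f(x_0^-)\int_{-\infty}^0\phi(x)\,dx+\mathsf f(x_0^+)\int_0^\infty\phi(x)\,dx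 .$$ The set $\mathfrak S$ of points where $\mathsf f(x_0^+)\ne\mathsf f(x_0^-)$ is at most countable; the associated distributionally regulated function is $f(x_0)=\mathsf f(x_0)$ for $x_0\notin\mathfrak S$ (it can be defined at $x_0\in\mathfrak S$ as $\tfrac12(\mathsf f(x_0^+)+\mathsf f(x_0^-))$). Test classes. $\mathcal T_0$: functions $\phi\in C^\infty(\mathbb R)$, $\phi\ge0$, $\int\phi=1$, such that for some $\alpha<-1$, $\phi^{(m)}(x)=O(|x|^{\alpha-m})$ as $|x|\to\infty$ for all $m\ge0$. $\mathcal T_1$: those $\phi\in\mathcal T_0$ with $x\phi'(x)\le0$ for all $x$. For $\mathsf g\in\mathcal E'(\mathbb R)$, $\phi\in\mathcal T_0$: $\mathsf g^{+}_{\phi,0}(x)=\limsup_{t\to0^+}\langle \mathsf g(x+ty),\phi(y)\rangle$ and $\mathsf g^{-}_{\phi,0}(x)=\liminf_{t\to0^+}\langle \mathsf g(x+ty),\phi(y)\rangle$. Integral. Let $f:[a,b]\to\overline{\mathbb R}$. A major distributional pair $(\mathsf u,\mathsf U)$ for $f$ consists of $\mathsf u\in\mathcal E'[a,b]$ and a Łojasiewicz distribution $\mathsf U$ with $\mathsf U'=\mathsf u$, $\mathsf U(a)=0$, such that there exist a countable set $E$ and a Lebesgue null set $Z$ with $\mathsf u^-_{\phi,0}(x)\ge f(x)$ for all $x\in[a,b]\setminus Z$, $\phi\in\mathcal T_0$, and $\mathsf u^-_{\phi,0}(x)>-\infty$ for all $x\in[a,b]\setminus E$, $\phi\in\mathcal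 T_1$. A minor distributional pair $(\mathsf v,\mathsf V)$ for $f$ consists of $\mathsf v\in\mathcal E'[a,b]$ and a Łojasiewicz distribution $\mathsf V$ with $\mathsf V'=\mathsf v$, $\mathsf V(a)=0$, such that there exist a countable set $E$ and a null set $Z$ with $\mathsf v^+_{\phi,0}(x)\le f(x)$ for all $x\in[a,b]\setminus Z$, $\phi\in\mathcal T_0$, and $\mathsf v^+_{\phi,0}(x)<\infty$ for all $x\in[a,b]\setminus E$, $\phi\in\mathcal T_1$. The function $f$ is distributionally integrable over $[a,b]$ if it has both major and minor pairs and $\sup\mathsf V(b)=\inf\mathsf U(b)$ (sup over minor pairs, inf over major pairs); the common value is $(\mathfrak{dist})\int_a^bf(x)\,dx$. Integrability and the integral do not change if $f$ is modified on a null set, so functions defined almost everywhere may be considered. *)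

(* Defs.v *)
From HB Require Import structures.
From mathcomp Require Import all_boot all_order all_algebra.
From mathcomp Require Import all_classical all_reals all_analysis.

Set Implicit Arguments.
Unset Strict Implicit.
Unset Printing Implicit Defensive.

Import Order.TTheory GRing.Theory Num.Theory.
Import numFieldNormedType.Exports.

Local Open Scope ring_scope.
Local Open Scope classical_set_scope.

Section Distributions.
Variable R : realType.
Implicit Types (phi psi : R -> R) (a b x t : R).

Definition smooth phi : Prop :=
  forall (n : nat) x, derivable (phi^`(n)) x 1.

Definition test_function phi : Prop :=
  smooth phi /\ exists M : R, forall x, M < `|x| -> phi x = 0.

(* A distribution is carried by a functional on all functions R -> R, but only
   its values on test functions are meaningful.  Continuity on D(R) is the
   usual seminorm estimate on each D([-M, M]); B stands for the largest of the
   sup norms of the derivatives of phi of order at most N. *)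
Record schwartz_distribution := SchwartzDistribution {
  dist_app :> (R -> R) -> R;
  dist_linear : forall (c : R) phi psi,
    test_function phi -> test_function psi ->
    dist_app (fun x => c * phi x + psi x) = c * dist_app phi + dist_app psi;
  dist_continuous : forall M : R, exists (N : nat) (C : R), forall phi,
    test_function phi -> (forall x, M < `|x| -> phi x = 0) ->
    forall B : R,
      (forall (k : nat) x, (k <= N)%N -> `|phi^`(k) x| <= B) ->
      `|dist_app phi| <= C * B
}.

Implicit Types (g u U v V : schwartz_distribution).

(* u = U' *)
Definition is_derivative_of u U : Prop :=
  forall phi, test_function phi -> u phi = - U (phi^`()).

(* g \in E'[a, b] *)
Definition supported_in a b g : Prop :=
  forall phi, test_function phi ->
    closure [set x | phi x != 0] `&` `[a, b] = set0 -> g phi = 0.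

Definition is_cutoff a b : set (R -> R) :=
  [set chi | test_function chi /\
    exists2 e : R, 0 < e & forall x, a - e <= x <= b + e -> chi x = 1].

(* The canonical extension of g \in E'[a, b] to smooth functions: psi is
   multiplied by a test function equal to 1 near [a, b], whose choice is
   irrelevant. *)
Definition eapp a b g psi : R :=
  g (fun y => xget (fun=> 0) (is_cutoff a b) y * psi y).

(* <g(x + t y), phi(y)> = |t|^-1 <g(y), phi((y - x) / t)>, for an arbitrary
   way T of applying g *)
Definition rescaled (T : (R -> R) -> R) x t phi : R :=
  `|t|^-1 * T (fun y => phi ((y - x) / t)).

Definition has_point_value g x (gamma : R) : Prop :=
  forall phi, test_function phi ->
    rescaled g x e phi @[e --> 0^'] -->
      gamma * \int[lebesgue_measure]_y phi y.

Definition lojasiewicz_distribution g : Prop :=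
  forall x, exists gamma : R, has_point_value g x gamma.

Definition lojasiewicz_function (G : R -> R) : Prop :=
  exists2 g, lojasiewicz_distribution g & forall x, has_point_value g x (G x).

Definition has_lateral_limits g x (lm lp : R) : Prop :=
  forall phi, test_function phi ->
    rescaled g x e phi @[e --> 0^'+] -->
      lm * (\int[lebesgue_measure]_(y in `]-oo, 0%R]) phi y) +
      lp * (\int[lebesgue_measure]_(y in `[0%R, +oo[) phi y).

Definition regulated_distribution g : Prop :=
  forall x, exists lm lp : R, has_lateral_limits g x lm lp.

Definition jump_set g : set R :=
  [set x | exists lm lp : R, has_lateral_limits g x lm lp /\ lm != lp].

(* The values of f on the (countable) jump set are left arbitrary. *)
Definition regulated_function (f : R -> R) : Prop :=
  exists2 g, regulated_distribution g &
    forall x, ~ jump_set g x -> has_point_value g x (f x).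

Definition T0 phi : Prop :=
  [/\ smooth phi,
      forall x, 0 <= phi x,
      \int[lebesgue_measure]_x phi x = 1 &
      exists2 alpha : R, alpha < -1 &
        forall m : nat, exists C A : R, forall x, A < `|x| ->
          `|phi^`(m) x| <= C * `|x| `^ (alpha - m%:R)].

Definition T1 phi : Prop := T0 phi /\ forall x, x * (phi^`())%classic x <= 0.

Definition upper_value a b g phi x : \bar R :=
  limf_esup (fun t => (rescaled (eapp a b g) x t phi)%:E) 0^'+.

Definition lower_value a b g phi x : \bar R :=
  limf_einf (fun t => (rescaled (eapp a b g) x t phi)%:E) 0^'+.

(* Only the restriction of f : R -> \bar R to [a, b] is ever used. *)
Definition major_pair a b (f : R -> \bar R) u U : Prop :=
  [/\ supported_in a b u,
      lojasiewicz_distribution U,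
      is_derivative_of u U,
      has_point_value U a 0 &
      exists E Z : set R, [/\ countable E,
        lebesgue_measure.-negligible Z,
        (forall x phi, a <= x <= b -> ~ Z x -> T0 phi ->
          (f x <= lower_value a b u phi x)%E) &
        (forall x phi, a <= x <= b -> ~ E x -> T1 phi ->
          (-oo < lower_value a b u phi x)%E)]].

Definition minor_pair a b (f : R -> \bar R) v V : Prop :=
  [/\ supported_in a b v,
      lojasiewicz_distribution V,
      is_derivative_of v V,
      has_point_value V a 0 &
      exists E Z : set R, [/\ countable E,
        lebesgue_measure.-negligible Z,
        (forall x phi, a <= x <= b -> ~ Z x -> T0 phi ->
          (upper_value a b v phi x <= f x)%E) &
        (forall x phi, a <= x <= b -> ~ E x -> T1 phi ->
          (upper_value a b v phi x < +oo)%E)]].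

Definition major_values a b (f : R -> \bar R) : set (\bar R) :=
  [set r%:E | r in [set r : R | exists u U,
    major_pair a b f u U /\ has_point_value U b r]].

Definition minor_values a b (f : R -> \bar R) : set (\bar R) :=
  [set r%:E | r in [set r : R | exists v V,
    minor_pair a b f v V /\ has_point_value V b r]].

Definition dist_integrable a b (f : R -> \bar R) : Prop :=
  [/\ exists u U, major_pair a b f u U,
      exists v V, minor_pair a b f v V &
      ereal_sup (minor_values a b f) = ereal_inf (major_values a b f)].

End Distributions.

(* Main.v *)
(* By pairing it with test functions, a Lojasiewicz distribution is a regulated one without jumps,
   so it suffices to treat a regulated g with values f off its countable jump set.  Restricting g
   to [a, b] (the cut-off limit exists because g is bounded at every point under dilations) gives a
   distribution u whose primitive U has point values everywhere, and (u, U) is at once a major and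
   a minor pair for f.

   What remains is that V(b) <= U(b) for every minor pair (v, V) and major pair (u, U).  Let
   w = u - v, W = U - V and let h be the Poisson extension of w to the upper half-plane.  At the
   boundary liminf h >= 0 almost everywhere and liminf h > -oo off a countable set.  Let F be the
   set of points near which w is not a positive measure.  F has no isolated point, as W has point
   values; so by Baire's theorem h is bounded below above some portion of F.  A minimum principle on
   the slabs above the gaps of F extends this bound to a neighbourhood of the portion; a
   multiple of the Poisson extension of a dipole placed at the endpoints of the gap dominates h at
   the corners.  There dominated convergence turns the boundary values of h into positivity of w, a
   contradiction.  Hence w >= 0 and W(b) >= W(a) = 0. *)

Require Import Defs.
From HB Require Import structures.
From mathcomp Require Import all_boot all_order all_algebra.
From mathcomp Require Import all_classical all_reals all_analysis.
From mathcomp Require Import ring lra measurable_realfun.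

Set Implicit Arguments.
Unset Strict Implicit.
Unset Printing Implicit Defensive.

Import Order.TTheory GRing.Theory Num.Theory.
Import numFieldNormedType.Exports.

Local Open Scope ring_scope.
Local Open Scope classical_set_scope.

(** The hypotheses on dilations concern one test function at a time, while the argument needs them
    uniformly on bounded sets of test functions and for kernels without compact support. Uniform
    boundedness gives the first ([tame]), a decomposition over scales the second ([tame_symbol]).
    The exponent in [tame e] is 1 for regulated distributions, whose averages stay bounded, but only
    0 for derivatives of Lojasiewicz distributions. The Poisson kernel belongs to both [T0] and [T1]
    and has a harmonic extension, so the comparison reads both conditions on a pair off this single
    kernel. With exponent 0, [h] may be of size [1/t] in cones at an endpoint of a gap, even if it
    is bounded below on the vertical line there. A dipole has size [t^-2] in such cones and vanishes
    on the boundary off its pole, so an arbitrarily small multiple of it suffices near the corner.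
    Pairings that depend on a parameter are differentiated in that parameter and compared by the
    mean value inequality, in place of Fubini and vector-valued integrals. *)

Section Derivatives.
Variable R : realType.
Implicit Types (f g k : R -> R) (x y s t c p a b d e r h A B : R).

(** * One-variable calculus: derivative rules, mean value inequalities, limits of derivatives *)

Lemma is_derive_epsP f x d : is_derive x 1 f d <->
  forall e : R, 0 < e -> exists2 r : R, 0 < r &
    forall h, `|h| < r -> `|f (x + h) - f x - h * d| <= e * `|h|.
Proof.
split=> [[df <-] e e0|H].
  have /cvgrPdist_le/(_ e e0)[r /= r0 rH] := df.
  exists r => // h hr; have [->|h0] := eqVneq h 0.
    by rewrite addr0 subrr mul0r subr0 normr0 mulr0.
  have /= := rH h; rewrite sub0r normrN => /(_ hr h0).
  rewrite distrC => {}rH.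
  have -> : f (x + h) - f x - h * 'D_1 f x =
      h * (h^-1 *: (f (h *: (1:R) + x) - f x) - 'D_1 f x).
    by rewrite mulrBr /GRing.scale/= mulrA divff// mul1r mulr1 (addrC x h).
  by rewrite normrM mulrC ler_wpM2r.
suff : h^-1 *: (f (h *: (1:R) + x) - f x) @[h --> 0^'] --> d.
  move=> Hd; apply: DeriveDef.
    by apply/cvg_ex; exists d.
  exact: cvg_lim.
apply/cvgrPdist_le => e e0; have [r r0 rH] := H e e0.
exists r => //= h /=; rewrite sub0r normrN => hr h0.
have := rH h hr; rewrite -ler_pdivrMr ?normr_gt0//.
apply: le_trans.
rewrite -normfV -normrM.
rewrite distrC; have -> // : (f (x + h) - f x - h * d) * h^-1 =
    h^-1 *: (f (h *: (1:R) + x) - f x) - d.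
by rewrite /GRing.scale/= mulr1 (addrC x h); field.
Qed.

Lemma is_derive_uniq f x d (d' : R) :
  is_derive x 1 f d -> is_derive x 1 f d' -> d = d'.
Proof. by move=> [_ <-] [_ <-]. Qed.

Lemma is_derive_near f g x d r : 0 < r ->
  (forall y, `|y - x| < r -> f y = g y) ->
  is_derive x 1 f d -> is_derive x 1 g d.
Proof.
move=> r0 fg /is_derive_epsP H; apply/is_derive_epsP => e /H[r' r'0 rH].
exists (Num.min r r'); first by rewrite lt_min r0.
move=> h; rewrite lt_min => /andP[hr hr'].
by rewrite -!fg ?subrr ?normr0//; [exact: rH|rewrite addrC addKr].
Qed.

Lemma is_derive_add f g x a b : is_derive x 1 f a -> is_derive x 1 g b ->
  is_derive x 1 (fun y => f y + g y) (a + b).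
Proof. by move=> fa gb; exact: (is_deriveD fa gb). Qed.

Lemma is_derive_sub f g x a b : is_derive x 1 f a -> is_derive x 1 g b ->
  is_derive x 1 (fun y => f y - g y) (a - b).
Proof. by move=> fa gb; exact: (is_deriveB fa gb). Qed.

Lemma is_derive_opp f x a : is_derive x 1 f a ->
  is_derive x 1 (fun y => - f y) (- a).
Proof. by move=> fa; exact: (is_deriveN fa). Qed.

Lemma is_derive_mul f g x a b : is_derive x 1 f a -> is_derive x 1 g b ->
  is_derive x 1 (fun y => f y * g y) (a * g x + f x * b).
Proof.
move=> fa gb; apply: (is_derive_eq (is_deriveM fa gb)).
by rewrite /GRing.scale/= addrC (mulrC a).
Qed.

Lemma is_derive_cstl x c : is_derive x 1 (fun=> c) 0.
Proof. exact: is_derive_cst. Qed.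

Lemma is_derive_var x : is_derive x (1:R) (fun y => y) 1.
Proof. exact: is_derive_id. Qed.

Lemma is_derive_scal c f x a : is_derive x 1 f a ->
  is_derive x 1 (fun y => c * f y) (c * a).
Proof.
by move=> fa; apply: (is_derive_eq (is_derive_mul (is_derive_cstl x c) fa));
  rewrite mul0r add0r.
Qed.

Lemma is_derive_chain f g x a b : is_derive (g x) 1 f a -> is_derive x 1 g b ->
  is_derive x 1 (fun y => f (g y)) (a * b).
Proof. exact: is_derive1_comp. Qed.

Lemma is_derive_affine c p x : is_derive x 1 (fun y => c * y + p) c.
Proof.
apply: (is_derive_eq (is_derive_add (is_derive_scal c (is_derive_var x))
  (is_derive_cstl x p))).
by rewrite mulr1 addr0.
Qed.

Lemma is_derive_recip f x a : f x != 0 -> is_derive x 1 f a ->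
  is_derive x 1 (fun y => (f y)^-1) (- a / f x ^+ 2).
Proof.
move=> fx fa; apply: (is_derive_eq (is_deriveV fx fa)).
by rewrite /GRing.scale/= mulNr [in RHS]mulNr mulrC.
Qed.

Lemma is_derive_pow f n x a : is_derive x 1 f a ->
  is_derive x 1 (fun y => f y ^+ n) (n%:R * f x ^+ n.-1 * a).
Proof.
move=> fa; have -> : (fun y => f y ^+ n) = f ^+ n.
  by apply/funext => y; rewrite fctE.
by apply: (is_derive_eq (is_deriveX n fa)); rewrite /GRing.scale/=.
Qed.

Lemma is_derive_continuous f x d : is_derive x 1 f d -> {for x, continuous f}.
Proof. by move=> [fd _]; exact/differentiable_continuous/derivable1_diffP. Qed.

(** Min and max admit increments of either sign. This inequality does the work of integration below:
    a bound on a derivative in a parameter becomes a bound on the total change. *)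
Lemma mvt_norm_le f f' a b B :
  (forall x, Num.min a b <= x <= Num.max a b -> is_derive x 1 f (f' x)) ->
  (forall x, Num.min a b <= x <= Num.max a b -> `|f' x| <= B) ->
  `|f b - f a| <= B * `|b - a|.
Proof.
wlog ab : a b / a <= b.
  move=> W; have [ab|ba] := orP (le_total a b); first exact: W.
  move=> H1 H2; rewrite distrC (distrC b).
  by apply: W => // x; rewrite minC maxC; [exact: H1|exact: H2].
rewrite min_l// max_r// => fd f'B.
have [c cab ->] : exists2 c, c \in `[a, b]%R & f b - f a = f' c * (b - a).
  apply: (@MVT_segment _ f f') => //.
    by move=> x /andP[/= ax xb]; apply: fd; rewrite !ltW.
  apply: derivable_within_continuous => x; rewrite in_itv/= => /fd[].
  by [].
by rewrite normrM ler_wpM2r// f'B//; rewrite inE/= in cab.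
Qed.

Lemma le_of_derive_ge0 f f' a b : a <= b ->
  (forall x, a <= x <= b -> is_derive x 1 f (f' x)) ->
  (forall x, a <= x <= b -> 0 <= f' x) -> f a <= f b.
Proof.
move=> ab fd f'0; rewrite -subr_ge0.
have [c cab ->] : exists2 c, c \in `[a, b]%R & f b - f a = f' c * (b - a).
  apply: (@MVT_segment _ f f') => //.
    by move=> x /andP[/= ax xb]; apply: fd; rewrite !ltW.
  apply: derivable_within_continuous => x; rewrite in_itv/= => /fd[].
  by [].
by rewrite mulr_ge0 ?subr_ge0// f'0//; rewrite inE/= in cab.
Qed.

Lemma derive_zero_cst f a b : (forall x, is_derive x 1 f 0) -> f a = f b.
Proof.
move=> f0; apply/eqP; rewrite -subr_eq0 -normr_le0.
by rewrite -(mul0r `|a - b|) (@mvt_norm_le _ (fun=> 0))// normr0.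
Qed.

Lemma is_derive_limit (F F' : nat -> R -> R) f g :
  (forall n x, is_derive x 1 (F n) (F' n x)) ->
  (forall x e, 0 < e -> exists N, forall n, (N <= n)%N -> `|F n x - f x| <= e) ->
  (forall e, 0 < e -> exists N, forall n x, (N <= n)%N -> `|F' n x - g x| <= e) ->
  forall x, is_derive x 1 f (g x).
Proof.
move=> Fd Ff F'g x; apply/is_derive_epsP => e e0.
have e4 : 0 < e / 4 by rewrite divr_gt0.
have [n nH] := F'g _ e4.
have /is_derive_epsP/(_ _ e4)[r r0 rH] := Fd n x.
exists r => // h hr.
(* By the mean value inequality [F m - F n] has Lipschitz constant [e / 4 + e / 4]; letting [m] grow
   with [n] fixed transfers this to [f - F n]. *)
have key : `|(f (x + h) - F n (x + h)) - (f x - F n x)| <= (e / 4 + e / 4) * `|h|.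
  apply/ler_addgt0Pr => d d0.
  have d2 : 0 < d / 2 by rewrite divr_gt0.
  have [N1 N1H] := Ff (x + h) _ d2; have [N2 N2H] := Ff x _ d2.
  pose m := maxn n (maxn N1 N2).
  have mn : (n <= m)%N by rewrite leq_maxl.
  have mN1 : (N1 <= m)%N by rewrite leq_max leq_maxl orbT.
  have mN2 : (N2 <= m)%N by rewrite leq_max leq_maxr orbT.
  have : `|(F m (x + h) - F n (x + h)) - (F m x - F n x)| <= (e / 4 + e / 4) * `|h|.
    rewrite -[h in X in _ <= X](addKr x h) (addrC (- x)).
    apply: (@mvt_norm_le (fun y => F m y - F n y) (fun y => F' m y - F' n y)).
    move=> y _; rewrite -(subrKA (g y)).
    rewrite (le_trans (ler_normD _ _))// lerD//; first exact: nH.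
    by rewrite distrC nH.
  have := N1H m mN1; have := N2H m mN2.
  rewrite !ler_norml => /andP[? ?] /andP[? ?] /andP[? ?].
  by apply/andP; split; lra.
have := rH h hr; have := nH n x (leqnn n); move: key.
rewrite !ler_norml => /andP[k1 k2] /andP[l1 l2] /andP[m1 m2].
have hh : `|h * (F' n x - g x)| <= e / 4 * `|h|.
  by rewrite normrM mulrC ler_wpM2r// ler_norml l1.
move: hh; rewrite ler_norml => /andP[h1 h2].
by apply/andP; split; lra.
Qed.

End Derivatives.

(** * Smooth functions and estimates on their derivatives of every order *)

Section Smooth.
Variable R : realType.
Implicit Types (f g k : R -> R) (x y s t c p A B : R).

Lemma smooth_is_derive f n x : smooth f -> is_derive x 1 ((derive1n n f)) ((derive1n (n.+1) f) x).
Proof. by move=> fs; rewrite derive1nS derive1E; exact/derivableP. Qed.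

Lemma smooth_is_derive0 f x : smooth f -> is_derive x 1 f ((derive1 f) x).
Proof. by move=> fs; have := smooth_is_derive 0 x fs; rewrite derive1n1. Qed.

(** A candidate for the whole sequence of derivatives, checked one differentiation at a time, yields
    smoothness and the formula for every order together. Most closure properties below are
    instances. *)
Lemma smooth_jet (F : nat -> R -> R) :
  (forall n x, is_derive x 1 (F n) (F n.+1 x)) ->
  smooth (F 0%N) /\ forall n, (derive1n (n) (F 0%N)) = F n.
Proof.
move=> FH; have E n : (derive1n (n) (F 0%N)) = F n.
  elim: n => // n IH; rewrite derive1nS IH; apply/funext => x.
  by rewrite derive1E; case: (FH n x).
by split=> // n x; rewrite E; case: (FH n x).
Qed.

Lemma smooth_derive1 f : smooth f -> smooth ((derive1 f)).
Proof. by move=> fs n x; rewrite -derive1Sn. Qed.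

Lemma smooth_derive1n f n : smooth f -> smooth ((derive1n n f)).
Proof. by move=> fs m x; rewrite /derive1n -iterD; exact: fs. Qed.

Lemma derive1nD f m n : derive1n n (derive1n m f) = (derive1n (n + m) f).
Proof. by rewrite /derive1n -iterD. Qed.

Lemma smooth_continuous f : smooth f -> continuous f.
Proof. by move=> fs x; exact: (is_derive_continuous (smooth_is_derive0 x fs)). Qed.

Let lin_jet c f g : smooth f -> smooth g -> forall n x,
  is_derive x 1 (fun y => c * (derive1n n f) y + (derive1n n g) y)
    (c * (derive1n (n.+1) f) x + (derive1n (n.+1) g) x).
Proof.
by move=> fs gs n x; apply: is_derive_add; [apply: is_derive_scal|];
  exact: smooth_is_derive.
Qed.

Lemma smooth_lin c f g : smooth f -> smooth g -> smooth (fun y => c * f y + g y).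
Proof. by move=> fs gs; exact: (smooth_jet (lin_jet c fs gs)).1. Qed.

Lemma derive1n_lin c f g n : smooth f -> smooth g ->
  derive1n n (fun y => c * f y + g y) = fun y => c * (derive1n n f) y + (derive1n n g) y.
Proof. by move=> fs gs; exact: (smooth_jet (lin_jet c fs gs)).2. Qed.

Let affine_jet c p f : smooth f -> forall n x,
  is_derive x 1 (fun y => c ^+ n * (derive1n n f) (c * y + p))
    (c ^+ n.+1 * (derive1n (n.+1) f) (c * x + p)).
Proof.
move=> fs n x; rewrite exprSr -mulrA (mulrC c); apply: is_derive_scal.
apply: (is_derive_chain (g := fun y => c * y + p)); last exact: is_derive_affine.
exact: smooth_is_derive.
Qed.

Lemma smooth_affine c p f : smooth f -> smooth (fun y => f (c * y + p)).
Proof.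
move=> fs; have := (smooth_jet (affine_jet c p fs)).1.
by under eq_fun do rewrite expr0 mul1r.
Qed.

Lemma derive1n_affine c p f n : smooth f ->
  derive1n n (fun y => f (c * y + p)) = fun y => c ^+ n * (derive1n n f) (c * y + p).
Proof.
move=> fs; have := (smooth_jet (affine_jet c p fs)).2 n => <-; congr derive1n.
by apply/funext => y; rewrite expr0 mul1r.
Qed.

Lemma smooth_cst c : smooth (fun=> c : R).
Proof.
have H m x : is_derive x 1 ((fun n (_ : R) => if n is 0 then c else 0) m)
    ((fun n (_ : R) => if n is 0 then c else 0) m.+1 x).
  by case: m => [|m]; exact: is_derive_cstl.
exact: (smooth_jet H).1.
Qed.

Lemma derive1n_cst c n : derive1n n.+1 (fun=> c : R) = fun=> 0 : R.
Proof.
have H m x : is_derive x 1 ((fun n (_ : R) => if n is 0 then c else 0) m)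
    ((fun n (_ : R) => if n is 0 then c else 0) m.+1 x).
  by case: m => [|m]; exact: is_derive_cstl.
exact: ((smooth_jet H).2 n.+1).
Qed.

Lemma smooth_add f g : smooth f -> smooth g -> smooth (fun y => f y + g y).
Proof.
by move=> fs gs; have := smooth_lin (c := 1) fs gs; under eq_fun do rewrite mul1r.
Qed.

Lemma derive1n_add f g n : smooth f -> smooth g ->
  derive1n n (fun y => f y + g y) = fun y => (derive1n n f) y + (derive1n n g) y.
Proof.
move=> fs gs; have := derive1n_lin 1 n fs gs.
under [in X in X = _ -> _]eq_fun do rewrite mul1r.
by move=> ->; apply/funext => y; rewrite mul1r.
Qed.

Lemma smooth_scal c f : smooth f -> smooth (fun y => c * f y).
Proof.
by move=> fs; have := smooth_lin (c := c) fs (@smooth_cst 0); under eq_fun do rewrite addr0.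
Qed.

Lemma derive1n_scal c f n : smooth f ->
  derive1n n (fun y => c * f y) = fun y => c * (derive1n n f) y.
Proof.
move=> fs; have := derive1n_lin c n fs (@smooth_cst 0).
under [in X in X = _ -> _]eq_fun do rewrite addr0.
move=> ->; apply/funext => y; case: n => [|n]; first by rewrite addr0.
by rewrite derive1n_cst addr0.
Qed.

Lemma smooth_sub f g : smooth f -> smooth g -> smooth (fun y => f y - g y).
Proof.
move=> fs gs; have := smooth_lin (c := -1) gs fs.
by under eq_fun do rewrite mulN1r addrC.
Qed.

Lemma derive1n_sub f g n : smooth f -> smooth g ->
  derive1n n (fun y => f y - g y) = fun y => (derive1n n f) y - (derive1n n g) y.
Proof.
move=> fs gs; have := derive1n_lin (-1) n gs fs.
under [in X in X = _ -> _]eq_fun do rewrite mulN1r addrC.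
by move=> ->; apply/funext => y; rewrite mulN1r addrC.
Qed.

Lemma smooth_dilate p t f : smooth f -> smooth (fun y => f ((y - p) / t)).
Proof.
move=> fs; have := smooth_affine (c := t^-1) (p := - p / t) fs.
by under eq_fun => y do rewrite mulrC -mulrDl.
Qed.

Lemma derive1n_dilate p t f n : smooth f ->
  derive1n n (fun y => f ((y - p) / t)) = fun y => t^-1 ^+ n * (derive1n n f) ((y - p) / t).
Proof.
move=> fs; have := derive1n_affine t^-1 (- p / t) n fs.
under [in X in X = _ -> _]eq_fun do rewrite mulrC -mulrDl.
by move=> ->; apply/funext => y; rewrite (mulrC t^-1) -mulrDl.
Qed.

Lemma smooth_id : smooth (fun y : R => y).
Proof.
have H n x : is_derive x 1
    ((fun n (y : R) => match n with 0 => y | 1 => 1 | _ => 0 end) n)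
    ((fun n (y : R) => match n with 0 => y | 1 => 1 | _ => 0 end) n.+1 x).
  by case: n => [|[|n]] /=; [exact: is_derive_var|exact: is_derive_cstl|
    exact: is_derive_cstl].
exact: (smooth_jet H).1.
Qed.

(* [leibniz f g n i j] is the n-th derivative of f^(i) g^(j); this recursive
   form of the Leibniz rule avoids binomial coefficients. *)
Fixpoint leibniz f g (n i j : nat) : R -> R := fun y =>
  if n is m.+1 then leibniz f g m i.+1 j y + leibniz f g m i j.+1 y
  else (derive1n (i) f) y * (derive1n (j) g) y.

Let leibniz_jet f g : smooth f -> smooth g -> forall n i j x,
  is_derive x 1 (leibniz f g n i j) (leibniz f g n.+1 i j x).
Proof.
move=> fs gs; elim=> [|n IH] i j x.
  by apply: is_derive_mul; exact: smooth_is_derive.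
by apply: is_derive_add; exact: IH.
Qed.

Lemma smooth_mul f g : smooth f -> smooth g -> smooth (fun y => f y * g y).
Proof.
by move=> fs gs; exact: (smooth_jet (fun n => leibniz_jet fs gs n 0 0)).1.
Qed.

Let derive1n_mul f g n : smooth f -> smooth g ->
  derive1n n (fun y => f y * g y) = leibniz f g n 0 0.
Proof.
by move=> fs gs; exact: ((smooth_jet (fun n => leibniz_jet fs gs n 0 0)).2 n).
Qed.

(** The weight [s] serves two settings: [s = 1] for sup norms, [s = (1 + |z|)^-1] for symbol
    estimates. *)
Definition jet_bound (N : nat) A s f x :=
  forall k : nat, (k <= N)%N -> `|derive1n k f x| <= A * s ^+ k.

(** Each level of the recursion [leibniz] doubles the number of terms, whence [2 ^+ N]; the weights
    multiply to the right power because every term of order [n] carries [n] derivatives in total. *)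
Lemma jet_bound_mul N A B s f g x : smooth f -> smooth g -> 0 <= s ->
  jet_bound N A s f x -> jet_bound N B s g x ->
  jet_bound N (2 ^+ N * A * B) s (fun y => f y * g y) x.
Proof.
move=> fs gs s0 fA gB.
have A0 : 0 <= A by have := fA 0%N isT; rewrite expr0 mulr1; apply: le_trans.
have B0 : 0 <= B by have := gB 0%N isT; rewrite expr0 mulr1; apply: le_trans.
have H n : forall i j, (n + i + j <= N)%N ->
    `|leibniz f g n i j x| <= 2 ^+ n * A * B * s ^+ (n + i + j).
  elim: n => [|n IH] i j nN /=.
    rewrite normrM expr0 mul1r add0n exprD mulrACA.
    have iN : (i <= N)%N by apply: leq_trans nN; rewrite add0n leq_addr.
    have jN : (j <= N)%N by apply: leq_trans nN; rewrite leq_addl.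
    by rewrite ler_pM// ?fA// gB.
  rewrite (le_trans (ler_normD _ _))//.
  have E1 : (n + i.+1 + j = n.+1 + i + j)%N by rewrite addnS.
  have E2 : (n + i + j.+1 = n.+1 + i + j)%N by rewrite addnS.
  have h1 := IH i.+1 j; rewrite E1 in h1; have h2 := IH i j.+1; rewrite E2 in h2.
  rewrite (le_trans (lerD (h1 nN) (h2 nN)))//.
  by rewrite exprS; lra.
move=> k kN; rewrite derive1n_mul//; have := H k 0%N 0%N; rewrite !addn0 => /(_ kN).
move/le_trans; apply; rewrite ler_wpM2r ?exprn_ge0// ler_wpM2r// ler_wpM2r//.
by rewrite ler_eXn2l// ltr1n.
Qed.

Lemma smooth_recip f : smooth f -> (forall x, f x != 0) -> smooth (fun y => (f y)^-1).
Proof.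
move=> fs f0.
(* [G n] is the numerator of the [n]-th derivative of [f^-1] over the denominator [f ^+ n.+1]. *)
pose G := fix G n : R -> R := if n is m.+1
  then fun y => derive1 (G m) y * f y - m.+1%:R * (G m y * (derive1 f) y) else fun=> 1.
have Gs n : smooth (G n).
  elim: n => [|n IH] /=; first exact: smooth_cst.
  exact (smooth_sub (smooth_mul (smooth_derive1 IH) fs)
    (smooth_scal (smooth_mul IH (smooth_derive1 fs)))).
have H n x : is_derive x 1 ((fun n y => G n y * (f y)^-1 ^+ n.+1) n)
    ((fun n y => G n y * (f y)^-1 ^+ n.+1) n.+1 x).
  apply: (is_derive_eq (is_derive_mul (smooth_is_derive0 x (Gs n))
    (is_derive_pow n.+1 (is_derive_recip (f0 x) (smooth_is_derive0 x fs))))).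
  rewrite /= !exprVn exprS !exprS; field.
  by rewrite f0 expf_neq0.
have := (smooth_jet H).1.
by under eq_fun do rewrite /= mul1r expr1.
Qed.

End Smooth.

(** * Test functions, their supports and seminorms *)

Section TestFunctions.
Variable R : realType.
Implicit Types (f g k phi psi : R -> R) (x y s t c p d e r h A B M K L : R).

Lemma derive1n_near f g n x r : 0 < r -> smooth f -> smooth g ->
  (forall y, `|y - x| < r -> f y = g y) -> derive1n n f x = derive1n n g x.
Proof.
move=> + fs gs; elim: n x r => [|n IH] x r r0 fg; first by apply: fg; rewrite subrr normr0.
apply: (is_derive_uniq (smooth_is_derive n x fs)).
apply: (is_derive_near (r := r / 2) (f := derive1n n g)); first by rewrite divr_gt0.
  move=> y yx; apply/esym; apply: (IH _ (r / 2)); first by rewrite divr_gt0.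
  move=> z zy; apply: fg; rewrite (splitr r) -(subrKA y).
  by rewrite (le_lt_trans (ler_normD _ _))// ltrD.
exact: smooth_is_derive.
Qed.

Lemma derive1n_near_cst c f n x r : 0 < r -> smooth f ->
  (forall y, `|y - x| < r -> f y = c) -> derive1n n f x = if n is 0 then c else 0.
Proof.
move=> r0 fs fc; rewrite (derive1n_near n r0 fs (@smooth_cst R c) fc).
by case: n => // n; rewrite derive1n_cst.
Qed.

Definition ball_supported M phi := forall x, M < `|x| -> phi x = 0.

Definition norm_bound (N : nat) B phi :=
  forall (k : nat) x, (k <= N)%N -> `|derive1n k phi x| <= B.

Lemma derive1n_ball_supported M phi n : smooth phi -> ball_supported M phi ->
  ball_supported M (derive1n n phi).
Proof.
move=> phis phiM x Mx.
have r0 : 0 < `|x| - M by rewrite subr_gt0.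
rewrite (derive1n_near_cst (c := 0) n r0 phis); first by case: n.
move=> y yx; apply: phiM; have := ler_normB x (x - y).
rewrite distrC in yx; rewrite subKr => ?.
by have := lerB_dist x (x - y); rewrite subKr; lra.
Qed.

Lemma test_smooth phi : test_function phi -> smooth phi.
Proof. by case. Qed.

Lemma test_functionP phi :
  test_function phi <-> smooth phi /\ exists2 M, 0 < M & ball_supported M phi.
Proof.
split=> [[phis [M phiM]]|[phis [M M0 phiM]]]; split=> //; last by exists M.
exists (`|M| + 1); first by rewrite ltr_wpDl.
by move=> x Mx; apply: phiM; have := ler_norm M; lra.
Qed.

Lemma ball_supported_le M M' phi : M <= M' -> ball_supported M phi ->
  ball_supported M' phi.
Proof. by move=> MM' phiM x Mx; apply: phiM; exact: le_lt_trans Mx. Qed.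

Lemma test_lin c phi psi : test_function phi -> test_function psi ->
  test_function (fun y => c * phi y + psi y).
Proof.
move=> [phis [M phiM]] [psis [M' psiM]]; split; first exact (smooth_lin (c := c) phis psis).
exists (Num.max M M') => x; rewrite gt_max => /andP[? ?].
by rewrite phiM// psiM// mulr0 addr0.
Qed.

Lemma test_add phi psi : test_function phi -> test_function psi ->
  test_function (fun y => phi y + psi y).
Proof.
move=> a b; have := test_lin 1 a b.
by under eq_fun do rewrite mul1r.
Qed.

Lemma test_sub phi psi : test_function phi -> test_function psi ->
  test_function (fun y => phi y - psi y).
Proof.
move=> a b; have := test_lin (-1) b a.
by under eq_fun do rewrite mulN1r addrC.
Qed.

Lemma test0 : test_function (fun=> 0 : R).
Proof. by split; [exact: smooth_cst|exists 0]. Qed.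

Lemma test_scal c phi : test_function phi -> test_function (fun y => c * phi y).
Proof.
by move=> a; have := test_lin c a test0; under eq_fun do rewrite addr0.
Qed.

Lemma test_mul phi f : test_function phi -> smooth f ->
  test_function (fun y => phi y * f y).
Proof.
move=> [phis [M phiM]] fs; split; first exact (smooth_mul phis fs).
by exists M => x Mx; rewrite phiM// mul0r.
Qed.

Lemma test_derive1 phi : test_function phi -> test_function (derive1 phi).
Proof.
move=> [phis [M phiM]]; split; first exact (smooth_derive1 phis).
exists M; have := @derive1n_ball_supported M phi 1 phis phiM.
by rewrite derive1n1.
Qed.

Lemma ball_supported_dilate M phi p t : 0 < t -> t <= 1 -> ball_supported M phi ->
  ball_supported (`|p| + `|M|) (fun y => phi ((y - p) / t)).
Proof.
move=> t0 t1 phiM x Mx; apply: phiM; rewrite normrM normfV (gtr0_norm t0).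
rewrite ltr_pdivlMr//; have := lerB_dist x p; have := ler_norm M => ? ?.
have : M * t <= `|M|; last by lra.
by rewrite (le_trans (ler_norm _))// normrM (gtr0_norm t0) ler_piMr.
Qed.

Lemma test_dilate phi p t : t != 0 -> test_function phi ->
  test_function (fun y => phi ((y - p) / t)).
Proof.
move=> t0 [phis [M phiM]]; split; first exact (smooth_dilate (p := p) (t := t) phis).
exists (`|p| + `|M| * `|t|) => x Mx; apply: phiM.
have t0' : 0 < `|t| by rewrite normr_gt0.
rewrite normrM normfV ltr_pdivlMr//.
have := lerB_dist x p; have := ler_norm M => ? ?.
have : M * `|t| <= `|M| * `|t| by rewrite ler_wpM2r.
lra.
Qed.

Lemma derive1_dilate phi p t : smooth phi ->
  derive1 (fun y => phi ((y - p) / t)) = fun y => t^-1 * derive1 phi ((y - p) / t).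
Proof. by move=> phis; have := derive1n_dilate p t 1 phis; rewrite !derive1n1 expr1. Qed.

Lemma norm_bound_ge0 N B phi : norm_bound N B phi -> 0 <= B.
Proof. by move=> H; apply: le_trans (H 0%N 0 isT). Qed.

Lemma norm_bound_le N B B' phi : B <= B' -> norm_bound N B phi -> norm_bound N B' phi.
Proof. by move=> BB H k x kN; exact: le_trans (H k x kN) BB. Qed.

Lemma norm_bound_leN N N' B phi : (N <= N')%N -> norm_bound N' B phi -> norm_bound N B phi.
Proof. by move=> NN H k x kN; exact: (H k x (leq_trans kN NN)). Qed.

Lemma norm_bound_sub N B B' phi psi : smooth phi -> smooth psi ->
  norm_bound N B phi -> norm_bound N B' psi ->
  norm_bound N (B + B') (fun y => phi y - psi y).
Proof.
move=> a b H H' k x kN; rewrite derive1n_sub//.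
by rewrite (le_trans (ler_normB _ _))// lerD// ?H// H'.
Qed.

Lemma norm_bound_scal N B c phi : smooth phi ->
  norm_bound N B phi -> norm_bound N (`|c| * B) (fun y => c * phi y).
Proof. by move=> a H k x kN; rewrite derive1n_scal// normrM ler_wpM2l// H. Qed.

Lemma norm_bound_dilate N B phi p t : 0 < t -> t <= 1 -> smooth phi ->
  norm_bound N B phi -> norm_bound N (t^-1 ^+ N * B) (fun y => phi ((y - p) / t)).
Proof.
move=> t0 t1 a H k x kN; rewrite derive1n_dilate// normrM ler_pM ?H//.
have t0' : 0 <= t^-1 by rewrite invr_ge0 ltW.
by rewrite ger0_norm ?exprn_ge0// ler_weXn2l// invf_ge1.
Qed.

Lemma norm_bound_jet N B phi : norm_bound N B phi <-> forall x, jet_bound N B 1 phi x.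
Proof.
by split=> H k x kN; rewrite ?expr1n ?mulr1;
  [have := H x k|have := H x k kN; rewrite expr1n mulr1]; auto.
Qed.

Lemma norm_bound_mul N B B' phi psi : smooth phi -> smooth psi ->
  norm_bound N B phi -> norm_bound N B' psi ->
  norm_bound N (2 ^+ N * B * B') (fun y => phi y * psi y).
Proof.
move=> a b /norm_bound_jet H /norm_bound_jet H'; apply/norm_bound_jet => x.
exact: jet_bound_mul.
Qed.

Lemma continuous_bounded_ball f M : continuous f ->
  exists2 B, 0 <= B & forall x, `|x| <= M -> `|f x| <= B.
Proof.
move=> cf; have [M0|M0] := ltP M 0.
  by exists 0 => // x xM; have := le_lt_trans xM M0; rewrite ltNge normr_ge0.
have [||c cM cH] := @EVT_max R (fun x => `|f x|) (- M) M.
- by lra.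
- apply: continuous_subspaceT => x; apply: continuous_comp; first exact: cf.
  exact: norm_continuous.
exists `|f c| => // x xM; apply: cH.
by rewrite in_itv/= -ler_norml.
Qed.

Lemma jets_bounded_ball f (N : nat) M : smooth f ->
  exists2 B, 0 <= B & forall (k : nat) x, (k <= N)%N -> `|x| <= M -> `|derive1n k f x| <= B.
Proof.
move=> fs; elim: N => [|N [B B0 IH]].
  have [B B0 H] := continuous_bounded_ball M (smooth_continuous fs).
  by exists B => // -[|//] x _; exact: H.
have [B' B'0 H] := continuous_bounded_ball M (smooth_continuous (smooth_derive1n (n := N.+1) fs)).
exists (B + B') => [|k x]; first exact: addr_ge0.
rewrite leq_eqVlt => /orP[/eqP->|kN] xM.
  by rewrite (le_trans (H x xM))// lerDr.
by rewrite (le_trans (IH k x kN xM))// lerDl.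
Qed.

Lemma test_norm_bound N phi : test_function phi -> exists B, norm_bound N B phi.
Proof.
move=> [phis [M phiM]]; have [B B0 H] := jets_bounded_ball N M phis.
exists B => k x kN; have [|Mx] := leP `|x| M; first exact: H.
by rewrite (derive1n_ball_supported k phis phiM)// normr0.
Qed.

End TestFunctions.

(** * The uniform boundedness principle on test functions with support in a fixed ball *)

Section UniformBoundedness.
Variable R : realType.
Implicit Types (phi psi : R -> R) (x y s t c p d e r h A B M C K L : R).

(** The intervals of radius [d n] about [u n] meet pairwise, so the supremum of their left ends lies
    in all of them. *)
Lemma nested_limit (u d : nat -> R) n0 : (forall n, 0 <= d n) ->
  (forall n m, (n0 <= n)%N -> (n <= m)%N -> `|u m - u n| <= d n) ->
  exists l, forall n, (n0 <= n)%N -> `|l - u n| <= d n.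
Proof.
move=> d0 H.
have K n m : (n0 <= n)%N -> (n0 <= m)%N -> u n - d n <= u m + d m.
  move=> nn mm; have [nm|/ltnW mn] := leqP n m.
    by have := H n m nn nm; rewrite ler_norml => /andP[]; have := d0 m; lra.
  by have := H m n mm mn; rewrite ler_norml => /andP[]; have := d0 n; lra.
pose E := [set u n - d n | n in [set n | (n0 <= n)%N]].
have E0 : E !=set0 by exists (u n0 - d n0); exists n0 => /=.
have Eb n : (n0 <= n)%N -> ubound E (u n + d n).
  by move=> nn _ [m /= mm <-]; exact: K.
exists (sup E) => n nn; rewrite ler_distl; apply/andP; split.
  apply: sup_upper_bound; last by exists n.
  by split=> //; exists (u n + d n); exact: Eb.
by apply: sup_le_ub => //; exact: Eb.
Qed.

(* Gliding hump: if no uniform seminorm estimate held, one could build nested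
   "balls" (S, N, d) in D_M, the n-th one consisting of functions psi with
   |T i psi| > n for some i; their common point contradicts pointwise
   boundedness. *)
Lemma uniform_boundedness (I : Type) (T : I -> (R -> R) -> R) M :
  (forall i c phi psi, test_function phi -> test_function psi ->
    T i (fun y => c * phi y + psi y) = c * T i phi + T i psi) ->
  (forall i, exists N C, forall phi, test_function phi -> ball_supported M phi ->
    forall B, norm_bound N B phi -> `|T i phi| <= C * B) ->
  (forall phi, test_function phi -> ball_supported M phi ->
    exists L, forall i, `|T i phi| <= L) ->
  exists N C, 0 <= C /\ forall i phi, test_function phi -> ball_supported M phi ->
    forall B, norm_bound N B phi -> `|T i phi| <= C * B.
Proof.
move=> Tlin Tcont Tbnd; apply: contrapT => notub.
have big N K d : 0 < K -> 0 < d -> exists i phi, [/\ test_function phi,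
    ball_supported M phi, norm_bound N d phi & K < `|T i phi|].
  move=> K0 d0; apply: contrapT => notbig; apply: notub; exists N, (K / d).
  split=> [|i phi tphi phiM B phiB]; first by rewrite divr_ge0// ltW.
  rewrite leNgt; apply/negP => lt; apply: notbig.
  have B0 := norm_bound_ge0 phiB.
  have Kd : 0 < K / d by rewrite divr_gt0.
  (* [B] may vanish, so one divides by a number strictly between [B] and the ratio: it is positive,
     and the strict inequality survives. *)
  pose B' := (B + `|T i phi| / (K / d)) / 2.
  have lt' : B < `|T i phi| / (K / d) by rewrite ltr_pdivlMr// mulrC.
  have BB' : B < B' by rewrite /B'; lra.
  have B'0 : 0 < B' by exact: le_lt_trans BB'.
  have TB' : K / d * B' < `|T i phi| by rewrite mulrC -ltr_pdivlMr// /B'; lra.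
  exists i, (fun y => d / B' * phi y); split.
  - exact: test_scal.
  - by move=> x xM; rewrite phiM// mulr0.
  - have := norm_bound_scal (d / B') (test_smooth tphi) (norm_bound_le (ltW BB') phiB).
    suff -> : `|d / B'| * B' = d by [].
    have dB : 0 < d / B' by exact: divr_gt0.
    by rewrite (gtr0_norm dB); field; rewrite gt_eqF.
  - have -> : T i (fun y => d / B' * phi y) = d / B' * T i phi.
      have := Tlin i (d / B') phi (fun=> 0) tphi (test0 R).
      have T0 : T i (fun=> 0) = 0.
        have := Tlin i 1 (fun=> 0) (fun=> 0) (test0 R) (test0 R).
        have -> : (fun _ : R => 1 * 0 + 0 : R) = fun=> 0 by rewrite mulr0 addr0.
        lra.
      rewrite T0 addr0 => <-; congr T.
      by apply/funext => y; rewrite addr0.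
    have dB : 0 < d / B' by exact: divr_gt0.
    rewrite normrM (gtr0_norm dB).
    have -> : K = d / B' * (K / d * B') by field; rewrite !gt_eqF.
    by rewrite ltr_pM2l.
pose good (s : (R -> R) * nat * R) := [/\ test_function s.1.1,
  ball_supported M s.1.1 & 0 < s.2].
have step (ns : nat * {s | good s}) : exists s' : {s | good s},
    [/\ ((proj1_sig ns.2).1.2 < (proj1_sig s').1.2)%N, (proj1_sig s').2 <= (proj1_sig ns.2).2 / 2,
      norm_bound (proj1_sig ns.2).1.2 ((proj1_sig ns.2).2 / 2)
        (fun y => (proj1_sig s').1.1 y - (proj1_sig ns.2).1.1 y) &
      forall psi, test_function psi -> ball_supported M psi ->
        norm_bound (proj1_sig s').1.2 (proj1_sig s').2 (fun y => psi y - (proj1_sig s').1.1 y) ->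
        exists i, ns.1%:R < `|T i psi| ].
  case: ns => n [[[S N] d] [/= tS SM d0]].
  have d2 : 0 < d / 2 by rewrite divr_gt0.
  have [L TL] := Tbnd S tS SM.
  have L0 : 0 <= `|L| by [].
  (* The summand with [L] pays for [T i S], which is bounded in [i]; the summand 1 is a margin for
     the whole ball around the new centre. *)
  have [|i [phi [tphi phiM phid Tphi]]] := big N (n%:R + 1 + `|L|) (d / 2) _ d2.
    by rewrite ltr_wpDr// ltr_wpDl.
  pose S' y := S y + phi y.
  have tS' : test_function S' by exact: test_add.
  have S'M : ball_supported M S'.
    by move=> x xM; rewrite /S' SM// phiM// addr0.
  have TS' : n%:R + 1 < `|T i S'|.
    have -> : T i S' = T i phi + T i S.
      rewrite -[T i phi]mul1r -Tlin//; congr T.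
      by apply/funext => y; rewrite /S' mul1r addrC.
    have := lerB_normD (T i phi) (T i S); have := TL i; have := ler_norm L; lra.
  have [Ni [Ci Tc]] := Tcont i.
  (* On a ball of this radius [T i] changes by at most 1, which uses up exactly the margin. *)
  pose d' := Num.min (d / 2) ((`|Ci| + 1)^-1).
  have Ci0 : 0 < `|Ci| + 1 by rewrite ltr_wpDl.
  have d'0 : 0 < d' by rewrite lt_min d2 invr_gt0.
  have gS' : good (S', maxn N.+1 Ni, d') by split.
  exists (exist _ (S', maxn N.+1 Ni, d') gS') => /=; split.
  - by rewrite leq_maxl.
  - by rewrite ge_min lexx.
  - have -> // : (fun y => S' y - S y) = phi.
    by apply/funext => y; rewrite /S' addrC addKr.
  - move=> psi tpsi psiM /(norm_bound_leN (leq_maxr _ _)) bnd.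
    exists i; have tps := test_sub tpsi tS'.
    have psM : ball_supported M (fun y => psi y - S' y).
      by move=> x xM; rewrite psiM// S'M// subr0.
    have := Tc _ tps psM _ bnd.
    have -> : T i (fun y => psi y - S' y) = T i psi - T i S'.
      rewrite [RHS]addrC -[- T i S']mulN1r -Tlin//; congr T.
      by apply/funext => y; rewrite mulN1r addrC.
    have : Ci * d' <= 1.
      rewrite (@le_trans _ _ ((`|Ci| + 1) * d'))//.
        by rewrite ler_wpM2r ?ltW//; have := ler_norm Ci; lra.
      by rewrite mulrC -ler_pdivlMr// div1r ge_min lexx orbT.
    have := lerB_dist (T i S') (T i psi); rewrite [X in _ <= X -> _]distrC.
    lra.
have [F FH] := choice step.
have g0 : good ((fun=> 0), 0%N, 1) by split=> //; exact: test0.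
pose st := fix st n := if n is m.+1 then F (m, st m) else exist good _ g0.
pose S n := (proj1_sig (st n)).1.1; pose N n := (proj1_sig (st n)).1.2.
pose d n := (proj1_sig (st n)).2.
have tS n : test_function (S n) by have := proj2_sig (st n); case.
have SM n : ball_supported M (S n) by have := proj2_sig (st n); case.
have d0 n : 0 < d n by have := proj2_sig (st n); case.
have stH n : [/\ (N n < N n.+1)%N, d n.+1 <= d n / 2,
    norm_bound (N n) (d n / 2) (fun y => S n.+1 y - S n y) &
    forall psi, test_function psi -> ball_supported M psi ->
      norm_bound (N n.+1) (d n.+1) (fun y => psi y - S n.+1 y) ->
      exists i, n%:R < `|T i psi|].
  exact: FH (n, st n).
have Nn n : (n <= N n)%N.
  by elim: n => // n IH; have [+ _ _ _] := stH n; exact: leq_ltn_trans.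
have Nle n m : (n <= m)%N -> (N n <= N m)%N.
  elim: m => [|m IH]; first by rewrite leqn0 => /eqP ->.
  rewrite leq_eqVlt => /orP[/eqP->//|/IH nm].
  by have [/ltnW + _ _ _] := stH m; exact: leq_trans.
have ds n : d n <= 2^-1 ^+ n.
  elim: n => [|n IH]; first by rewrite expr0.
  have [_ + _ _] := stH n; move/le_trans; apply.
  by rewrite exprS mulrC ler_wpM2l.
have cauchy n m k x : (k <= N n)%N -> (n <= m)%N ->
    `|derive1n k (S m) x - derive1n k (S n) x| <= d n - d m.
  move=> kn; elim: m => [|m IH]; first by rewrite leqn0 => /eqP ->; rewrite !subrr normr0.
  rewrite leq_eqVlt => /orP[/eqP->|]; first by rewrite !subrr normr0.
  rewrite ltnS => nm; have [_ dm + _] := stH m.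
  move=> /(_ k x (leq_trans kn (Nle _ _ nm))).
  rewrite derive1n_sub; [|exact: test_smooth..].
  have := IH nm; have := ler_normD (derive1n k (S m.+1) x - derive1n k (S m) x)
    (derive1n k (S m) x - derive1n k (S n) x).
  rewrite subrKA; lra.
have lim k x : exists l, forall n, (k <= n)%N -> `|l - derive1n k (S n) x| <= d n.
  apply: (@nested_limit (fun n => derive1n k (S n) x) d k) => [n|n m kn nm].
    exact: ltW.
  by rewrite (le_trans (cauchy n m k x (leq_trans kn (Nn n)) nm))// gerDl oppr_le0 ltW.
have [G GH] := choice (fun kx : nat * R => lim kx.1 kx.2).
have Gd k x : is_derive x 1 (fun y => G (k, y)) (G (k.+1, x)).
  have dle e : 0 < e -> exists n0, forall n, (n0 <= n)%N -> d n <= e.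
    move=> e0; have : @GRing.exp R 2^-1 n @[n --> \oo] --> (0 : R).
      by apply: cvg_expr; rewrite ger0_norm ?invr_ge0// invf_lt1// ltr1n.
    move=> /cvgrPdist_le/(_ e e0)[n0 _ H]; exists n0 => n nn.
    have := H n nn; rewrite /= sub0r normrN ger0_norm ?exprn_ge0 ?invr_ge0//.
    exact: le_trans (ds n).
  (* The shift by [k.+1] brings every index into the range where the rate [d] holds for the orders
     [k] and [k.+1] alike. *)
  apply: (@is_derive_limit _ (fun n => derive1n k (S (n + k.+1)))
    (fun n => derive1n k.+1 (S (n + k.+1))) (fun y => G (k, y)) (fun y => G (k.+1, y))).
  - by move=> n y; apply: smooth_is_derive; exact: test_smooth.
  - move=> y e /dle[n0 H]; exists n0 => n nn; rewrite distrC.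
    have kn : (k <= n + k.+1)%N by rewrite addnS ltnW// ltnS leq_addl.
    by rewrite (le_trans (GH (k, y) _ kn))// H// (leq_trans nn)// leq_addr.
  - move=> e /dle[n0 H]; exists n0 => n y nn; rewrite distrC.
    have kn : (k.+1 <= n + k.+1)%N by rewrite leq_addl.
    by rewrite (le_trans (GH (k.+1, y) _ kn))// H// (leq_trans nn)// leq_addr.
have [Gs Gn] := smooth_jet Gd.
pose P y := G (0%N, y).
have PM : ball_supported M P.
  move=> x xM; apply/eqP; rewrite -normr_le0; apply/ler_addgt0Pr => e e0.
  rewrite add0r; have : @GRing.exp R 2^-1 n @[n --> \oo] --> (0 : R).
    by apply: cvg_expr; rewrite ger0_norm ?invr_ge0// invf_lt1// ltr1n.
  move=> /cvgrPdist_le/(_ e e0)[n0 _ H].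
  have := H n0 (leqnn _); rewrite /= sub0r normrN ger0_norm ?exprn_ge0 ?invr_ge0//.
  apply: le_trans; apply: le_trans (ds n0).
  have := GH (0%N, x) n0 isT; rewrite /= SM// subr0.
  by [].
have tP : test_function P by split=> //; exists M.
have [L TL] := Tbnd P tP PM.
have [n nL] : exists n : nat, L < n%:R.
  by exists (Num.bound `|L|); apply: le_lt_trans (ler_norm L) (archi_boundP _).
have [_ _ _ /(_ P tP PM)] := stH n.
case=> [k x kn|i]; last by rewrite ltNge (le_trans (TL i))// ltW.
rewrite derive1n_sub//; last exact: test_smooth.
rewrite Gn.
(* The limit has the rate [d n.+1] at index [n.+1] only for orders up to [n.+1]. For higher orders
   one passes through an index [m >= k], using that [S] is Cauchy in the seminorm of order [N n.+1],
   and lets [d m] tend to 0. *)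
have [kle|] := leqP k n.+1; first exact: (GH (k, x)).
move=> nk.
apply/ler_addgt0Pr => e e0.
have : @GRing.exp R 2^-1 n @[n --> \oo] --> (0 : R).
  by apply: cvg_expr; rewrite ger0_norm ?invr_ge0// invf_lt1// ltr1n.
move=> /cvgrPdist_le/(_ e e0)[n0 _ H].
pose m := maxn n0 k.
have := H m (leq_maxl _ _); rewrite /= sub0r normrN ger0_norm ?exprn_ge0 ?invr_ge0// => me.
have := GH (k, x) m (leq_maxr _ _).
have nm : (n.+1 <= m)%N by rewrite (leq_trans (ltnW nk))// leq_maxr.
have := cauchy n.+1 m k x kn nm; have := ds m; have := d0 m => /=.
have := ler_normD (G (k, x) - derive1n k (S m) x)
  (derive1n k (S m) x - derive1n k (S n.+1) x).
rewrite subrKA; lra.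
Qed.

End UniformBoundedness.

(** * The smooth step and the plateau function *)

Section SmoothStep.
Variable R : realType.
Implicit Types (x y z t h e v : R).

Definition flat x := if 0 < x then expR (- x^-1) else 0 : R.

Lemma flat_ge0 x : 0 <= flat x.
Proof. by rewrite /flat; case: ifP => // _; exact: expR_ge0. Qed.

Lemma flat_gt0 x : 0 < x -> 0 < flat x.
Proof. by rewrite /flat => ->; exact: expR_gt0. Qed.

Lemma horner_le_pow (p : {poly R}) :
  exists2 K : R, 0 <= K & forall v, 1 <= v -> `|p.[v]| <= K * v ^+ size p.
Proof.
exists (\sum_(i < size p) `|p`_i|) => [|v v1]; first by rewrite sumr_ge0.
rewrite horner_coef (le_trans (ler_norm_sum _ _ _))// mulr_suml ler_sum// => i _.
have v0 : 0 <= v by apply: le_trans v1.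
rewrite normrM ler_wpM2l// ger0_norm ?exprn_ge0//.
by rewrite ler_weXn2l// ltnW.
Qed.

Lemma expR_ge_pow v (k : nat) : 0 <= v -> (v / k.+1%:R) ^+ k.+1 <= expR v.
Proof.
move=> v0; have k0 : k.+1%:R != 0 :> R by rewrite pnatr_eq0.
have E : v = k.+1%:R * (v / k.+1%:R) by field.
rewrite [in X in _ <= X]E expRM_natl.
rewrite lerXn2r ?nnegrE ?expR_ge0 ?divr_ge0//.
by rewrite (le_trans _ (expR_ge1Dx _))// lerDr.
Qed.

(** In the variable [v = 1/x] one has [d/dx = - v^2 d/dv]; applied to [P(v) exp(-v)], this gives the
    recursion for the polynomial factor of the [n]-th derivative of [exp(-1/x)]. *)
Let P := fix P n : {poly R} :=
  if n is m.+1 then 'X^2 * (P m - (P m)^`()%R) else 1.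

Let F n x := if 0 < x then (P n).[x^-1] * expR (- x^-1) else 0.

Let F_deriv n x : is_derive x 1 (F n) (F n.+1 x).
Proof.
have [x0|x0|->] := ltgtP x 0.
- apply: (@is_derive_near _ (fun=> 0) _ _ _ (- x)); first by rewrite oppr_gt0.
    move=> y; rewrite ltr_norml => /andP[_ yx]; rewrite /F ltNge.
    by have -> : y <= 0 by lra.
  by rewrite /F ltNge ltW//; exact: is_derive_cstl.
- apply: (@is_derive_near _ (fun y => (P n).[y^-1] * expR (- y^-1)) _ _ _ x) => //.
    move=> y; rewrite ltr_norml => /andP[yx _]; rewrite /F.
    by have -> : 0 < y by lra.
  have xinv : is_derive x 1 (fun y : R => y^-1) (- x^-1 ^+ 2).
    apply: (is_derive_eq (is_derive_recip (lt0r_neq0 x0) (is_derive_var x))).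
    by rewrite mulN1r exprVn.
  have hP : is_derive x^-1 1 (horner (P n)) ((P n)^`()%R).[x^-1].
    by apply: DeriveDef; [exact: derivable_horner|rewrite -derive1E derivE].
  have := is_derive_mul (is_derive_chain hP xinv)
    (is_derive_chain (g := fun y => - y^-1) (is_derive_expR (- x^-1)) (is_derive_opp xinv)).
  move=> H; apply: (is_derive_eq H); rewrite /F x0.
  have -> : P n.+1 = 'X^2 * (P n - (P n)^`()%R) by [].
  rewrite hornerM hornerXn hornerD hornerN; ring.
have -> : F n.+1 0 = 0 by rewrite /F ltxx.
apply/is_derive_epsP => e e0; have [K K0 KH] := horner_le_pow (P n).
(* The exponential is compared with the power [k.+1 = size (P n) + 2], which leaves a factor
   [h ^+ 2]: one power more than the derivative 0 at the origin asks for. *)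
pose k := (size (P n)).+1; pose C := K * k.+1%:R ^+ k.+1.
have C0 : 0 <= C by rewrite mulr_ge0 ?exprn_ge0.
exists (Num.min 1 (e / (C + 1))).
  by rewrite lt_min ltr01 divr_gt0// ltr_wpDl.
move=> h; rewrite lt_min => /andP[h1 hC].
rewrite add0r mulr0 subr0 {2}/F ltxx subr0 /F.
case: ifPn => [h0|_]; last by rewrite normr0 mulr_ge0// (ltW e0).
rewrite (gtr0_norm h0) in h1 hC *; set v := h^-1.
have v1 : 1 <= v by rewrite /v invf_ge1// ltW.
have v0 : 0 < v by rewrite invr_gt0.
rewrite normrM (gtr0_norm (expR_gt0 _)) expRN.
have ev : v ^+ k.+1 / k.+1%:R ^+ k.+1 <= expR v.
  by rewrite -expr_div_n expR_ge_pow// ltW.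
have : (expR v)^-1 <= k.+1%:R ^+ k.+1 / v ^+ k.+1.
  rewrite -[X in _ <= X]invrK invfM invrK mulrC.
  by rewrite lef_pV2 ?posrE ?expR_gt0// divr_gt0 ?exprn_gt0.
move=> ev'; apply: (@le_trans _ _ (K * v ^+ size (P n) * (k.+1%:R ^+ k.+1 / v ^+ k.+1))).
  by rewrite ler_pM ?KH// invr_ge0 expR_ge0.
have -> : K * v ^+ size (P n) * (k.+1%:R ^+ k.+1 / v ^+ k.+1) = C * h ^+ 2.
  rewrite /C /k !(exprS v) /v; field.
  by rewrite expf_neq0 ?invr_neq0 ?gt_eqF//= gt_eqF.
rewrite expr2 mulrA ler_wpM2r ?(ltW h0)//.
move: hC; rewrite ltr_pdivlMr ?ltr_wpDl//.
by rewrite mulrDr mulr1 mulrC; lra.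
Qed.

Lemma flat_smooth : smooth flat.
Proof.
have := (smooth_jet F_deriv).1; congr smooth.
by apply/funext => x; rewrite /F /flat hornerE mul1r.
Qed.

Definition sstep x := flat x / (flat x + flat (1 - x)).

Lemma sstep_den_gt0 x : 0 < flat x + flat (1 - x).
Proof.
have [x0|x0] := ltP 0 x.
  by rewrite ltr_pwDl ?flat_gt0 ?flat_ge0.
by rewrite ltr_wpDl ?flat_ge0 ?flat_gt0//; lra.
Qed.

Lemma sstep_smooth : smooth sstep.
Proof.
apply: (smooth_mul flat_smooth); apply: smooth_recip.
  apply: (smooth_add flat_smooth).
  have := smooth_affine (c := -1) (p := 1) flat_smooth.
  by under eq_fun do rewrite mulN1r addrC.
by move=> x; rewrite gt_eqF// sstep_den_gt0.
Qed.

Lemma sstep_eq0 x : x <= 0 -> sstep x = 0.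
Proof. by move=> x0; rewrite /sstep {1}/flat ltNge x0 mul0r. Qed.

Lemma sstep_eq1 x : 1 <= x -> sstep x = 1.
Proof.
move=> x1; rewrite /sstep; have -> : flat (1 - x) = 0.
  by rewrite /flat ltNge; have -> : 1 - x <= 0 by lra.
by rewrite addr0 divff// gt_eqF// flat_gt0//; lra.
Qed.

Lemma sstep_ge0 x : 0 <= sstep x.
Proof. by rewrite divr_ge0 ?flat_ge0 ?ltW ?sstep_den_gt0. Qed.

Lemma sstep_le1 x : sstep x <= 1.
Proof. by rewrite ler_pdivrMr ?sstep_den_gt0// mul1r lerDl flat_ge0. Qed.

Definition plateau x := sstep (2 - x) * sstep (2 + x).

Lemma plateau_smooth : smooth plateau.
Proof.
apply: smooth_mul.
  have := smooth_affine (c := -1) (p := 2) sstep_smooth.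
  by under eq_fun do rewrite mulN1r addrC.
have := smooth_affine (c := 1) (p := 2) sstep_smooth.
by under eq_fun do rewrite mul1r addrC.
Qed.

Lemma plateau_eq1 x : `|x| <= 1 -> plateau x = 1.
Proof. by rewrite ler_norml => /andP[? ?]; rewrite /plateau !sstep_eq1 ?mulr1//; lra. Qed.

Lemma plateau_eq0 x : 2 <= `|x| -> plateau x = 0.
Proof.
rewrite ler_normr => /orP[x2|x2]; rewrite /plateau.
  by rewrite sstep_eq0 ?mul0r//; lra.
by rewrite [sstep (2 + x)]sstep_eq0 ?mulr0//; lra.
Qed.

Lemma plateau_ge0 x : 0 <= plateau x.
Proof. by rewrite mulr_ge0 ?sstep_ge0. Qed.

Lemma plateau_le1 x : plateau x <= 1.
Proof. by rewrite mulr_ile1 ?sstep_ge0 ?sstep_le1. Qed.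

Lemma plateau_test : test_function plateau.
Proof. by split; [exact: plateau_smooth|exists 2 => x /ltW/plateau_eq0]. Qed.

End SmoothStep.

(** * Distributions, uniform control under dilations, differentiation in a parameter *)

Section Dist.
Variable R : realType.
Implicit Types (f k phi psi theta : R -> R) (p r t x y z c d h A B M C L : R).
Implicit Types (g u : schwartz_distribution R).

Lemma dist_lin g c phi psi : test_function phi -> test_function psi ->
  g (fun x => c * phi x + psi x) = c * g phi + g psi.
Proof. exact: dist_linear. Qed.

Lemma dist_add g phi psi : test_function phi -> test_function psi ->
  g (fun x => phi x + psi x) = g phi + g psi.
Proof.
move=> a b; have := dist_lin g 1 a b; rewrite mul1r => <-; congr (dist_app g).
by apply/funext => x; rewrite mul1r.
Qed.

Lemma dist_sub g phi psi : test_function phi -> test_function psi ->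
  g (fun x => phi x - psi x) = g phi - g psi.
Proof.
move=> a b; have := dist_lin g (-1) b a; rewrite mulN1r addrC => <-.
by congr (dist_app g); apply/funext => x; rewrite mulN1r addrC.
Qed.

Lemma dist0 g : g (fun=> 0) = 0.
Proof.
have := dist_sub g (test0 R) (test0 R); rewrite [RHS]subrr => E.
by rewrite -[RHS]E; congr (dist_app g); apply/funext => x; rewrite subrr.
Qed.

Lemma dist_scal g c phi : test_function phi -> g (fun x => c * phi x) = c * g phi.
Proof.
move=> a; have := dist_lin g c a (test0 R); rewrite dist0 addr0 => <-.
by congr (dist_app g); apply/funext => x; rewrite addr0.
Qed.

Lemma dist_opp g phi : test_function phi -> g (fun x => - phi x) = - g phi.
Proof.
move=> a; have := dist_scal g (-1) a; rewrite mulN1r => <-.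
by congr (dist_app g); apply/funext => x; rewrite mulN1r.
Qed.

Lemma dist_bound g M : exists (N : nat) C, 0 <= C /\ forall phi B,
  test_function phi -> ball_supported M phi -> norm_bound N B phi ->
  `|g phi| <= C * B.
Proof.
have [N [C H]] := dist_continuous g M; exists N, `|C|; split=> // phi B tphi phiM bnd.
rewrite (le_trans (H phi tphi phiM B bnd))// ler_wpM2r ?ler_norm//.
exact: norm_bound_ge0 bnd.
Qed.

(** Pairings at scale [r] around [p] are [O(r ^+ e)], with one seminorm for all scales. For [e = 1]
    this says that the averages [rescaled] stay bounded; [e = 0] is what the derivative of a
    distribution with a point value satisfies. *)
Definition tame (e : nat) g p := forall M, exists (N : nat) C, 0 <= C /\
  forall r phi B, 0 < r -> r <= 1 -> test_function phi -> ball_supported M phi ->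
    norm_bound N B phi -> `|g (fun y => phi ((y - p) / r))| <= C * B * r ^+ e.

(** The normalized dilations with [r] in []0, 1]] form a pointwise bounded family, to which uniform
    boundedness applies. The hypothesis bounds it below some [rho] that depends on [phi]; between
    [rho] and 1 the seminorm estimate of [g] does. *)
Lemma tameP (e : nat) g p :
  (forall phi, test_function phi -> exists L rho : R, 0 < rho /\
    forall r, 0 < r -> r < rho -> `|g (fun y => phi ((y - p) / r))| <= L * r ^+ e) ->
  tame e g p.
Proof.
move=> H M.
have [N0 [C0 [C00 C0H]]] := dist_bound g (`|p| + `|M|).
have bnd r phi B : 0 < r -> r <= 1 -> test_function phi -> ball_supported M phi ->
    norm_bound N0 B phi ->
    `|g (fun y => phi ((y - p) / r))| <= C0 * (r^-1 ^+ N0 * B).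
  move=> r0 r1 tphi phiM phiB; apply: C0H.
  - by apply: test_dilate => //; rewrite gt_eqF.
  - exact: ball_supported_dilate.
  - by apply: norm_bound_dilate => //; exact: test_smooth.
pose T (i : {r : R | 0 < r /\ r <= 1}) phi :=
  g (fun y => phi ((y - p) / sval i)) / sval i ^+ e.
have [N [C [C0' CH]]] : exists N C, 0 <= C /\ forall i phi, test_function phi ->
    ball_supported M phi -> forall B, norm_bound N B phi -> `|T i phi| <= C * B.
  apply: uniform_boundedness.
  - move=> [r [r0 r1]] c phi psi a b; rewrite /T /= dist_lin ?mulrDl ?mulrA//;
      by apply: test_dilate => //; rewrite gt_eqF.
  - move=> [r [r0 r1]]; exists N0, (C0 * r^-1 ^+ N0 / r ^+ e) => phi tphi phiM B phiB.
    have re : 0 < r ^+ e by rewrite exprn_gt0.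
    rewrite /T /= normrM normfV (gtr0_norm re) mulrAC ler_wpM2r ?invr_ge0 ?(ltW re)//.
    by rewrite -mulrA bnd.
  - move=> phi tphi phiM; have [L [rho [rho0 LH]]] := H phi tphi.
    have [B phiB] := test_norm_bound N0 tphi.
    have B0 := norm_bound_ge0 phiB.
    exists (`|L| + C0 * (rho^-1 ^+ N0 * B) / rho ^+ e) => -[r [r0 r1]].
    have re : 0 < r ^+ e by rewrite exprn_gt0.
    have L'0 : 0 <= C0 * (rho^-1 ^+ N0 * B) / rho ^+ e.
      have h1 : 0 <= rho^-1 ^+ N0 by rewrite exprn_ge0// invr_ge0 ltW.
      have h2 : 0 <= rho ^+ e by rewrite exprn_ge0// ltW.
      by rewrite divr_ge0// mulr_ge0// mulr_ge0.
    rewrite /T /= normrM normfV (gtr0_norm re) ler_pdivrMr//.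
    have [rr|rr] := ltP r rho.
      rewrite (le_trans (LH r r0 rr))// ler_wpM2r ?(ltW re)//.
      by rewrite (le_trans (ler_norm L))// lerDl.
    rewrite (le_trans (bnd r phi B r0 r1 tphi phiM phiB))//.
    have rr0 : r^-1 <= rho^-1 by rewrite lef_pV2.
    have rr1 : r^-1 ^+ N0 <= rho^-1 ^+ N0.
      by rewrite lerXn2r ?nnegrE ?invr_ge0 ?(ltW r0) ?(ltW rho0).
    have rr2 : rho ^+ e <= r ^+ e by rewrite lerXn2r ?nnegrE ?(ltW r0) ?(ltW rho0).
    apply: (@le_trans _ _ (C0 * (rho^-1 ^+ N0 * B))).
      by rewrite ler_wpM2l// ler_wpM2r.
    rewrite mulrDl ler_wpDl ?mulr_ge0 ?(ltW re)//.
    rewrite mulrAC -mulrA ler_peMr//.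
      by rewrite !mulr_ge0// exprn_ge0// invr_ge0 ltW.
    by rewrite ler_pdivlMr ?exprn_gt0// mul1r.
exists N, C; split=> // r phi B r0 r1 tphi phiM phiB.
have re : 0 < r ^+ e by rewrite exprn_gt0.
have := CH (exist _ r (conj r0 r1)) phi tphi phiM B phiB.
by rewrite /T /= normrM normfV (gtr0_norm re) ler_pdivrMr.
Qed.

(** A Lipschitz condition on [K1] in the parameter makes the first-order remainder of [K] quadratic
    in [h], for each derivative that the seminorm of [u] sees. The factor [theta] confines all
    bounds to a compact set. *)
Lemma dist_derive_param u theta (K K1 : R -> R -> R) s0 d :
  0 < d -> test_function theta ->
  (forall s, `|s - s0| < d -> smooth (K s)) ->
  (forall s, `|s - s0| < d -> smooth (K1 s)) ->
  (forall n s y, `|s - s0| < d ->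
    is_derive s 1 (fun s => derive1n n (K s) y) (derive1n n (K1 s) y)) ->
  (forall n M, exists L, forall s y, `|s - s0| < d -> `|y| <= M ->
    `|derive1n n (K1 s) y - derive1n n (K1 s0) y| <= L * `|s - s0|) ->
  is_derive s0 1 (fun s => u (fun y => theta y * K s y)) (u (fun y => theta y * K1 s0 y)).
Proof.
move=> d0 ttheta Ks K1s Kd K1L.
have [thetas [M M0 thetaM]] := (test_functionP theta).1 ttheta.
have [N [C [C0 CH]]] := dist_bound u M.
have s0d : `|s0 - s0| < d by rewrite subrr normr0.
have [A A0 thetaA] := jets_bounded_ball N M thetas.
have [L L0 LH] : exists2 L, 0 <= L & forall n s y, (n <= N)%N -> `|s - s0| < d -> `|y| <= M ->
    `|derive1n n (K1 s) y - derive1n n (K1 s0) y| <= L * `|s - s0|.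
  elim: N {C C0 CH thetaA} => [|N [L L0 IH]].
    have [L LH] := K1L 0%N M; exists `|L| => // n s y; rewrite leqn0 => /eqP -> sd yM.
    by rewrite (le_trans (LH s y sd yM))// ler_wpM2r// ler_norm.
  have [L' L'H] := K1L N.+1 M; exists (L + `|L'|) => [|n s y]; first by rewrite addr_ge0.
  rewrite leq_eqVlt => /orP[/eqP->|nN] sd yM.
    by rewrite (le_trans (L'H s y sd yM))// ler_wpM2r// (le_trans (ler_norm _))// lerDr.
  by rewrite (le_trans (IH n s y nN sd yM))// ler_wpM2r// lerDl.
have rem h : `|h| < d -> `|u (fun y => theta y * K (s0 + h) y) -
    u (fun y => theta y * K s0 y) - h * u (fun y => theta y * K1 s0 y)| <=
    C * (2 ^+ N * A * (L * `|h| ^+ 2)).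
  move=> hd; have s1d : `|s0 + h - s0| < d by rewrite addrC addKr.
  pose Q y := K (s0 + h) y - K s0 y - h * K1 s0 y.
  have Qs : smooth Q.
    exact (smooth_sub (smooth_sub (Ks _ s1d) (Ks _ s0d)) (smooth_scal (c := h) (K1s _ s0d))).
  have -> : u (fun y => theta y * K (s0 + h) y) -
    u (fun y => theta y * K s0 y) - h * u (fun y => theta y * K1 s0 y) =
    u (fun y => theta y * Q y).
    have t1 := test_mul ttheta (Ks _ s1d); have t2 := test_mul ttheta (Ks _ s0d).
    have t3 := test_mul ttheta (K1s _ s0d).
    rewrite -(dist_scal u h t3) -(dist_sub u t1 t2).
    rewrite -(dist_sub u (test_sub t1 t2) (test_scal h t3)).
    by congr (dist_app u); apply/funext => y; rewrite /Q; ring.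
  apply: CH.
  - exact: test_mul.
  - by move=> x xM; rewrite thetaM// mul0r.
  move=> n y nN; have [yM|yM] := leP `|y| M; last first.
    have QM : ball_supported M (fun y => theta y * Q y).
      by move=> x xM; rewrite thetaM// mul0r.
    rewrite (derive1n_ball_supported n (smooth_mul thetas Qs) QM yM) normr0.
    by rewrite ?mulr_ge0 ?exprn_ge0.
  have jt : jet_bound N A 1 theta y.
    by move=> m mN; rewrite expr1n mulr1 thetaA.
  suff jQ : jet_bound N (L * `|h| ^+ 2) 1 Q y.
    by have := jet_bound_mul thetas Qs ler01 jt jQ nN; rewrite expr1n mulr1.
  move=> m mN; rewrite expr1n mulr1 /Q derive1n_sub; last 2 first.
  - exact (smooth_sub (Ks _ s1d) (Ks _ s0d)).
  - exact (smooth_scal (c := h) (K1s _ s0d)).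
  rewrite derive1n_sub; [|exact: Ks|exact: Ks].
  rewrite derive1n_scal; last exact: K1s.
  have hs s : Num.min s0 (s0 + h) <= s <= Num.max s0 (s0 + h) -> `|s - s0| <= `|h|.
    have [h0|h0] := leP 0 h.
      by rewrite min_l ?max_r ?lerDl// => /andP[? ?]; rewrite !ger0_norm//; lra.
    have sh : s0 + h <= s0 by lra.
    rewrite (min_r sh) (max_l sh) => /andP[? ?].
    have ? : s - s0 <= 0 by lra.
    by rewrite !ler0_norm ?(ltW h0)//; lra.
  have := @mvt_norm_le _ (fun s => derive1n m (K s) y - s * derive1n m (K1 s0) y)
    (fun s => derive1n m (K1 s) y - derive1n m (K1 s0) y) s0 (s0 + h) (L * `|h|).
  have -> : derive1n m (K (s0 + h)) y - (s0 + h) * derive1n m (K1 s0) y -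
    (derive1n m (K s0) y - s0 * derive1n m (K1 s0) y) =
    derive1n m (K (s0 + h)) y - derive1n m (K s0) y - h * derive1n m (K1 s0) y by ring.
  rewrite [s0 + h - s0]addrC addKr -mulrA -expr2; apply.
  - move=> s /hs sh; apply: is_derive_sub; first by apply: Kd; exact: le_lt_trans hd.
    apply: (is_derive_eq (is_derive_mul (is_derive_var s)
      (is_derive_cstl s (derive1n m (K1 s0) y)))).
    by rewrite mul1r mulr0 addr0.
  - move=> s /hs sh; rewrite (le_trans (LH m s y mN _ yM))// ?ler_wpM2l//.
    exact: le_lt_trans hd.
apply/is_derive_epsP => e e0; set D := C * (2 ^+ N * A * L).
have D0 : 0 <= D by rewrite !mulr_ge0 ?exprn_ge0.
exists (Num.min d (e / (D + 1))); first by rewrite lt_min d0 divr_gt0// ltr_wpDl.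
move=> h; rewrite lt_min => /andP[hd]; rewrite ltr_pdivlMr ?ltr_wpDl// => he.
rewrite (le_trans (rem h hd))//.
have -> : C * (2 ^+ N * A * (L * `|h| ^+ 2)) = D * `|h| * `|h| by rewrite /D; ring.
rewrite ler_wpM2r// mulrC; have : 0 <= `|h| by [].
by lra.
Qed.

End Dist.

(** * Derivatives of pairings with respect to the centre and the scale of the kernel *)

Section Scaling.
Variable R : realType.
Implicit Types (f k phi psi theta : R -> R) (p r t x y z c d h s A B M C L : R).
Implicit Types (g u : schwartz_distribution R).

Lemma smooth_mulc c k : smooth k -> smooth (fun z => k (c * z)).
Proof.
move=> ks; have := smooth_affine (c := c) (p := 0) ks.
by under eq_fun do rewrite addr0.
Qed.

Lemma derive1n_mulc c k n : smooth k ->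
  derive1n n (fun z => k (c * z)) = fun z => c ^+ n * derive1n n k (c * z).
Proof.
move=> ks; have := derive1n_affine c 0 n ks.
under [in X in X = _ -> _]eq_fun do rewrite addr0.
by move=> ->; apply/funext => y; rewrite addr0.
Qed.

Lemma dist_derive_shift u theta k t x : 0 < t -> test_function theta -> smooth k ->
  is_derive x 1 (fun x => u (fun y => theta y * k ((y - x) / t)))
    (- t^-1 * u (fun y => theta y * derive1 k ((y - x) / t))).
Proof.
move=> t0 tt ks; have k's := smooth_derive1 ks.
have Es n s y : is_derive s 1 (fun s => derive1n n k ((y - s) / t))
    (- t^-1 * derive1n n.+1 k ((y - s) / t)).
  have aff : is_derive s 1 (fun s => (y - s) / t) (- t^-1).
    apply: (@is_derive_near _ (fun s => - t^-1 * s + y / t) _ _ _ 1 ltr01); last exact: is_derive_affine.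
    by move=> w _; rewrite mulNr mulrC; ring.
  by rewrite mulrC; apply: (is_derive_chain (g := fun s => (y - s) / t) _ aff);
    exact: smooth_is_derive.
have -> : - t^-1 * u (fun y => theta y * derive1 k ((y - x) / t)) =
    u (fun y => theta y * (- t^-1 * derive1 k ((y - x) / t))).
  rewrite -(dist_scal u (- t^-1) (test_mul tt (smooth_dilate (p := x) (t := t) k's))).
  by congr (dist_app u); apply/funext => y; rewrite mulrCA.
have K1s s : smooth (fun y => - t^-1 * derive1 k ((y - s) / t)).
  exact (smooth_scal (c := - t^-1) (smooth_dilate (p := s) (t := t) k's)).
have K1E n s y : derive1n n (fun y => - t^-1 * derive1 k ((y - s) / t)) y =
    t^-1 ^+ n * (- t^-1 * derive1n n.+1 k ((y - s) / t)).
  rewrite derive1n_scal; last exact (smooth_dilate (p := s) (t := t) k's).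
  by rewrite derive1n_dilate// -derive1Sn mulrCA.
have H1 s : `|s - x| < 1 -> smooth (fun y => k ((y - s) / t)).
  by move=> _; exact (smooth_dilate (p := s) (t := t) ks).
have H2 n s y : `|s - x| < 1 ->
    is_derive s 1 (fun s => derive1n n (fun y => k ((y - s) / t)) y)
    (derive1n n (fun y => - t^-1 * derive1 k ((y - s) / t)) y).
  move=> _; rewrite K1E.
  apply: (@is_derive_near _ (fun s => t^-1 ^+ n * derive1n n k ((y - s) / t)) _ _ _ 1 ltr01).
    by move=> s' _; rewrite derive1n_dilate.
have H3 n M : exists L, forall s y, `|s - x| < 1 -> `|y| <= M ->
    `|derive1n n (fun y => - t^-1 * derive1 k ((y - s) / t)) y -
      derive1n n (fun y => - t^-1 * derive1 k ((y - x) / t)) y| <= L * `|s - x|.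
  have [B B0 HB] := continuous_bounded_ball ((M + (`|x| + 1)) / t)
    (smooth_continuous (smooth_derive1n (n := n.+2) ks)).
  exists (`|t^-1 ^+ n| * (t^-1 * (t^-1 * B))) => s y sx yM; rewrite !K1E -!mulrBr.
  rewrite normrM -mulrA ler_wpM2l// normrM normrN (gtr0_norm (_ : 0 < t^-1)) ?invr_gt0//.
  rewrite -mulrA ler_wpM2l ?invr_ge0 ?(ltW t0)//.
  apply: (@mvt_norm_le _ _ (fun s => - t^-1 * derive1n n.+2 k ((y - s) / t))).
  move=> s' ss'; rewrite normrM normrN (gtr0_norm (_ : 0 < t^-1)) ?invr_gt0//.
  rewrite ler_wpM2l ?invr_ge0 ?(ltW t0)// HB//.
  rewrite normrM normfV (gtr0_norm t0) ler_pM2r ?invr_gt0//.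
  rewrite (le_trans (ler_normB _ _))// lerD//.
  have : `|s' - x| <= 1.
    move: sx ss'; rewrite ltr_norml ler_norml => /andP[? ?].
    by have [?|?] := leP x s => /andP[? ?]; apply/andP; split; lra.
  by have := lerB_dist s' x; lra.
exact (dist_derive_param u ltr01 tt H1 (fun s _ => K1s s) H2 H3).
Qed.

(** The generator of dilations: differentiating [k ((y - x) / t)] in [t] replaces [k] by [euler k]
    and multiplies by [- t^-1]. *)
Definition euler k z := z * derive1 k z.

Lemma euler_smooth k : smooth k -> smooth (euler k).
Proof. by move=> ks; exact (smooth_mul (@smooth_id R) (smooth_derive1 ks)). Qed.

Lemma derive1n_euler k n z : smooth k ->
  derive1n n (euler k) z = n%:R * derive1n n k z + z * derive1n n.+1 k z.
Proof.
move=> ks; have H m x : is_derive x 1 (fun z => m%:R * derive1n m k z + z * derive1n m.+1 k z)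
    (m.+1%:R * derive1n m.+1 k x + x * derive1n m.+2 k x).
  apply: (is_derive_eq (is_derive_add (is_derive_scal m%:R (smooth_is_derive m x ks))
    (is_derive_mul (is_derive_var x) (smooth_is_derive m.+1 x ks)))).
  by rewrite -natr1; ring.
have := (smooth_jet H).2 n => /(congr1 (fun f => f z)) <-; congr (derive1n n _ z).
by apply/funext => w; rewrite mul0r add0r derive1n1.
Qed.

(** The [n]-th derivative in [y] of the dilated kernel, viewed as a function of the scale. *)
Let G n k x y s := s^-1 ^+ n * derive1n n k ((y - x) / s).

Let G_deriv n k x y s : 0 < s -> smooth k ->
  is_derive s 1 (G n k x y) (- s^-1 * G n (euler k) x y s).
Proof.
move=> s0 ks; have sn0 := lt0r_neq0 s0.
have inv : is_derive s 1 (fun s : R => s^-1) (- s^-1 ^+ 2).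
  apply: (is_derive_eq (is_derive_recip sn0 (is_derive_var s))).
  by rewrite mulN1r exprVn.
have lin : is_derive s 1 (fun s => (y - x) / s) ((y - x) * - s^-1 ^+ 2).
  exact: is_derive_scal.
apply: (is_derive_eq (is_derive_mul (is_derive_pow n inv)
  (is_derive_chain (g := fun s => (y - x) / s) (smooth_is_derive n _ ks) lin))).
rewrite /G derive1n_euler//; case: n => [|n]; first by rewrite !expr0; ring.
by rewrite /= (exprS _ n); ring.
Qed.

Lemma dist_derive_dilate u theta k t x : 0 < t -> test_function theta -> smooth k ->
  is_derive t 1 (fun t => u (fun y => theta y * k ((y - x) / t)))
    (- t^-1 * u (fun y => theta y * euler k ((y - x) / t))).
Proof.
move=> t0 tt ks; have es := euler_smooth ks; have ees := euler_smooth es.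
have t2 : 0 < t / 2 by rewrite divr_gt0.
have -> : - t^-1 * u (fun y => theta y * euler k ((y - x) / t)) =
    u (fun y => theta y * (- t^-1 * euler k ((y - x) / t))).
  rewrite -(dist_scal u (- t^-1) (test_mul tt (smooth_dilate (p := x) (t := t) es))).
  by congr (dist_app u); apply/funext => y; rewrite mulrCA.
have K1s s : smooth (fun y => - s^-1 * euler k ((y - x) / s)).
  exact (smooth_scal (c := - s^-1) (smooth_dilate (p := x) (t := s) es)).
have K1E n s y : derive1n n (fun y => - s^-1 * euler k ((y - x) / s)) y =
    - s^-1 * G n (euler k) x y s.
  rewrite derive1n_scal; last exact (smooth_dilate (p := x) (t := s) es).
  by rewrite derive1n_dilate.
have H1 s : `|s - t| < t / 2 -> smooth (fun y => k ((y - x) / s)).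
  by move=> _; exact (smooth_dilate (p := x) (t := s) ks).
have H2 n s y : `|s - t| < t / 2 ->
    is_derive s 1 (fun s => derive1n n (fun y => k ((y - x) / s)) y)
    (derive1n n (fun y => - s^-1 * euler k ((y - x) / s)) y).
  rewrite ltr_norml => /andP[st _]; rewrite K1E.
  have s0 : 0 < s by lra.
  apply: (@is_derive_near _ (G n k x y) _ _ _ 1 ltr01).
    by move=> s' _; rewrite derive1n_dilate.
  exact: G_deriv.
have H3 n M : exists L, forall s y, `|s - t| < t / 2 -> `|y| <= M ->
    `|derive1n n (fun y => - s^-1 * euler k ((y - x) / s)) y -
      derive1n n (fun y => - t^-1 * euler k ((y - x) / t)) y| <= L * `|s - t|.
  (* [w] bounds the inverse of every scale within [t / 2] of [t]. *)
  set w := 2 / t.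
  have w0 : 0 < w by rewrite divr_gt0.
  have [B1 B10 HB1] := continuous_bounded_ball ((M + `|x|) * w)
    (smooth_continuous (smooth_derive1n (n := n) es)).
  have [B2 B20 HB2] := continuous_bounded_ball ((M + `|x|) * w)
    (smooth_continuous (smooth_derive1n (n := n) ees)).
  exists (w ^+ 2 * (w ^+ n * B1) + w ^+ 2 * (w ^+ n * B2)) => s y st yM; rewrite !K1E.
  apply: (@mvt_norm_le _ (fun s => - s^-1 * G n (euler k) x y s)
    (fun s => s^-1 ^+ 2 * G n (euler k) x y s + s^-1 ^+ 2 * G n (euler (euler k)) x y s)).
    move=> s' ss'; have s'0 : 0 < s'.
      move: st ss'; rewrite ltr_norml => /andP[? ?].
      by have [?|?] := leP t s => /andP[? ?]; lra.
    apply: (is_derive_eq (is_derive_mul (is_derive_opp (is_derive_recip (lt0r_neq0 s'0)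
      (is_derive_var s'))) (G_deriv n x y s'0 es))).
    by rewrite exprVn; field; rewrite gt_eqF.
  move=> s' ss'; have s't : t / 2 <= s'.
    move: st ss'; rewrite ltr_norml => /andP[? ?].
    by have [?|?] := leP t s => /andP[? ?]; lra.
  have s'0 : 0 < s' by lra.
  have s'w : s'^-1 <= w by rewrite /w -[2 / t]invf_div lef_pV2.
  have s'i : 0 <= s'^-1 by rewrite invr_ge0 ltW.
  have vM : `|(y - x) / s'| <= (M + `|x|) * w.
    rewrite normrM (ger0_norm s'i) ler_pM// (le_trans (ler_normB _ _))// lerD//.
  have pw m : s'^-1 ^+ m <= w ^+ m by rewrite lerXn2r ?nnegrE// (ltW w0).
  rewrite (le_trans (ler_normD _ _))// lerD// normrM (ger0_norm (exprn_ge0 2 s'i)) ler_pM ?exprn_ge0//.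
  - by rewrite /G normrM (ger0_norm (exprn_ge0 n s'i)) ler_pM ?exprn_ge0// HB1.
  - by rewrite /G normrM (ger0_norm (exprn_ge0 n s'i)) ler_pM ?exprn_ge0// HB2.
exact (dist_derive_param u t2 tt H1 (fun s _ => K1s s) H2 H3).
Qed.

End Scaling.

(** * Symbol classes: each derivative gains one power of decay *)

Section Symbols.
Variable R : realType.
Implicit Types (f k phi psi theta : R -> R) (a p r t x y z c d h s l A B M C L : R).
Implicit Types (g u : schwartz_distribution R).

(** The classical symbol class of order [a], truncated at [N] derivatives and with an explicit
    constant. The decay condition in [T0] puts its members here with [a < -1]. *)
Definition symbol (N : nat) a B k := forall z,
  jet_bound N (B * (1 + `|z|) `^ a) (1 + `|z|)^-1 k z.

Lemma symbol_ge0 N a B k : symbol N a B k -> 0 <= B.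
Proof.
move=> /(_ 0 0%N isT); rewrite normr0 addr0 powR1 mulr1 expr0 mulr1.
exact: le_trans.
Qed.

Lemma symbol_mul N a b A B f k : smooth f -> smooth k ->
  symbol N a A f -> symbol N b B k -> symbol N (a + b) (2 ^+ N * A * B) (fun y => f y * k y).
Proof.
move=> fs ks fA kB z.
have s0 : 0 <= (1 + `|z|)^-1 by rewrite invr_ge0 addr_ge0.
have := jet_bound_mul fs ks s0 (fA z) (kB z).
have -> // : 2 ^+ N * (A * (1 + `|z|) `^ a) * (B * (1 + `|z|) `^ b) =
  2 ^+ N * A * B * (1 + `|z|) `^ (a + b).
rewrite powRD; first by ring.
by apply/implyP => _; rewrite gt_eqF// ltr_wpDr.
Qed.

Lemma symbol_norm_bound N a B k : a <= 0 -> symbol N a B k -> norm_bound N B k.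
Proof.
move=> a0 H m z mN; have B0 := symbol_ge0 H.
have z1 : 1 <= 1 + `|z| by rewrite lerDl.
have z0 : 0 < 1 + `|z| by exact: lt_le_trans z1.
apply: le_trans (H z m mN) _; rewrite -[X in _ <= X]mulr1.
apply: ler_pM; rewrite ?mulr_ge0 ?powR_ge0 ?exprn_ge0 ?invr_ge0 ?(ltW z0)//.
- by rewrite ler_piMr// -[X in _ <= X](powRr0 (1 + `|z|)) ler_powR.
- by rewrite exprn_ile1 ?invr_ge0 ?(ltW z0)// invf_le1.
Qed.

(** For [|z| >= 1] one has [c <= 1 + |c z|]. The factor [c ^+ m] of the chain rule is then
    compensated by the [m] extra powers of decay, and since [a <= 0] the weight itself yields the
    power [a] of [c]. *)
Lemma symbol_scaled_jet N a B k c z : a <= 0 -> smooth k -> symbol N a B k ->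
  0 < c -> 1 <= `|z| -> jet_bound N (B * c `^ a) 1 (fun z => k (c * z)) z.
Proof.
move=> a0 ks H c0 z1 m mN; have B0 := symbol_ge0 H.
have cz : c <= 1 + `|c * z|.
  by rewrite normrM (gtr0_norm c0) (@le_trans _ _ (c * `|z|)) ?ler_peMr ?lerDr// ltW.
have cz0 : 0 < 1 + `|c * z| by exact: lt_le_trans cz.
rewrite derive1n_mulc// expr1n mulr1 normrM (ger0_norm (exprn_ge0 m (ltW c0))).
have := H (c * z) m mN; rewrite -(ler_pM2l (exprn_gt0 m c0)); move/le_trans; apply.
rewrite mulrCA -[X in _ <= X]mulr1 ler_pM ?mulr_ge0 ?powR_ge0 ?exprn_ge0 ?invr_ge0 ?(ltW c0) ?(ltW cz0)//.
- rewrite ler_wpM2l// -(opprK a) !(powRN _ (- a)) lef_pV2 ?posrE ?powR_gt0//.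
  by rewrite ge0_ler_powR ?nnegrE ?oppr_ge0 ?(ltW c0) ?(ltW cz0).
- by rewrite -exprMn exprn_ile1 ?mulr_ge0 ?invr_ge0 ?(ltW c0) ?(ltW cz0)// ler_pdivrMr// mul1r.
Qed.

End Symbols.

(** * Tame distributions paired with kernels that are not compactly supported *)

Section TameSymbol.
Variable R : realType.
Implicit Types (f k phi psi theta : R -> R) (a p r t x y z c d h s l A B M C L D : R).
Implicit Types (g u : schwartz_distribution R).

Lemma test_mulr phi f : smooth f -> test_function phi ->
  test_function (fun y => f y * phi y).
Proof.
by move=> fs tphi; have := test_mul tphi fs; under eq_fun do rewrite mulrC.
Qed.

Lemma smooth_1plateau : smooth (fun z : R => 1 - plateau z).
Proof. exact (smooth_sub (@smooth_cst R 1) (@plateau_smooth R)). Qed.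

Lemma norm_bound_1plateau N A : norm_bound N A (@plateau R) ->
  norm_bound N (1 + A) (fun z : R => 1 - plateau z).
Proof.
move=> bA; apply: norm_bound_sub => //; [exact: smooth_cst|exact: plateau_smooth|].
by move=> [|k] x _; rewrite ?derive1n_cst ?normr0 ?ler01//= normr1.
Qed.

Lemma dilate_test_bound theta N A p l : smooth theta -> 0 < l -> l <= 1 ->
  norm_bound N A theta ->
  smooth (fun z => theta (p + l * z)) /\ norm_bound N A (fun z => theta (p + l * z)).
Proof.
move=> ts l0 l1 tA.
have E : (fun z => theta (p + l * z)) = fun z => theta (l * z + p).
  by apply/funext => z; rewrite addrC.
rewrite E; split; first exact (smooth_affine (c := l) (p := p) ts).
move=> m z mN; rewrite derive1n_affine// normrM (ger0_norm (exprn_ge0 m (ltW l0))).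
by rewrite -[A]mul1r ler_pM ?exprn_ge0 ?(ltW l0)// ?exprn_ile1 ?(ltW l0)// tA.
Qed.

(** The factor [b] vanishes on the unit ball, so only the region covered by [symbol_scaled_jet]
    matters. It will be [euler plateau] for an intermediate scale and [1 - plateau] for the far
    part. *)
Lemma symbol_cut_bound N theta A k a B b D p l c : smooth theta -> smooth k ->
  smooth b -> (forall z, `|z| < 1 -> b z = 0) -> norm_bound N A theta -> norm_bound N D b ->
  symbol N a B k -> a <= 0 -> 0 < l -> l <= 1 -> 0 < c ->
  norm_bound N (2 ^+ N * (2 ^+ N * A * (B * c `^ a)) * D)
    (fun z => theta (p + l * z) * k (c * z) * b z).
Proof.
move=> ts ks bs b0 tA bD kB a0 l0 l1 c0 m z mN.
have [tls tlA] := dilate_test_bound p ts l0 l1 tA.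
have kcs := smooth_mulc (c := c) ks.
have tks := smooth_mul tls kcs.
have A0 := norm_bound_ge0 tA; have D0 := norm_bound_ge0 bD; have B0 := symbol_ge0 kB.
have [z1|z1] := ltP `|z| 1.
  have r0 : 0 < 1 - `|z| by rewrite subr_gt0.
  have nz y : `|y - z| < 1 - `|z| -> theta (p + l * y) * k (c * y) * b y = 0.
    by move=> yz; rewrite b0 ?mulr0//; have := lerB_dist y z; lra.
  rewrite (derive1n_near_cst m r0 (smooth_mul tks bs) nz).
  have -> : (if m is 0 then 0 else 0) = 0 :> R by case: (m).
  by rewrite normr0 !mulr_ge0 ?powR_ge0 ?exprn_ge0.
have j1 := symbol_scaled_jet a0 ks kB c0 z1.
have j2 : jet_bound N A 1 (fun z => theta (p + l * z)) z by move/norm_bound_jet: tlA.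
have j3 : jet_bound N D 1 b z by move/norm_bound_jet: bD.
have := jet_bound_mul tks bs ler01 (jet_bound_mul tls kcs ler01 j2 j1) j3 mN.
by rewrite expr1n mulr1.
Qed.

Lemma euler_plateau_eq0 z : `|z| < 1 -> euler (@plateau R) z = 0.
Proof.
move=> z1; rewrite /euler -derive1n1.
have r0 : 0 < 1 - `|z| by rewrite subr_gt0.
have nz y : `|y - z| < 1 - `|z| -> plateau y = 1.
  by move=> yz; rewrite plateau_eq1//; have := lerB_dist y z; lra.
by rewrite (derive1n_near_cst 1 r0 (@plateau_smooth R) nz) mulr0.
Qed.

Lemma euler_plateau_test : test_function (euler (@plateau R)).
Proof.
have [bs [M bM]] := test_derive1 (@plateau_test R).
split; first exact: euler_smooth (@plateau_smooth R).
by exists M => x Mx; rewrite /euler bM// mulr0.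
Qed.

Lemma euler_plateau_ball2 : ball_supported 2 (euler (@plateau R)).
Proof.
move=> z z2; rewrite /euler -derive1n1.
have b2 : ball_supported 2 (@plateau R) by move=> y /ltW; exact: plateau_eq0.
by rewrite (derive1n_ball_supported 1 (@plateau_smooth R) b2 z2) mulr0.
Qed.

Lemma is_derive_powRN a x : 0 < x ->
  is_derive x 1 (fun x => x `^ a) (a * x `^ (a - 1)).
Proof. exact: is_derive1_powR. Qed.

Lemma smooth_dilate_test theta p l : l != 0 -> test_function theta ->
  test_function (fun z => theta (p + l * z)).
Proof.
move=> l0 tt; have := test_dilate (- p / l) (invr_neq0 l0) tt.
by congr test_function; apply/funext => z; congr theta; field.
Qed.

(** Stands for integrating the bound on [F'] from [r] to 1: with [E = D / b], [- E] times the power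
    [- b] of [l] is a primitive of that bound, and both signs of [F] are compared with it by
    monotonicity. *)
Lemma powR_int_le a b r D (F F' : R -> R) : 0 < b -> 0 < r -> r <= 1 -> 0 <= D ->
  (forall l, r <= l -> l <= 1 -> is_derive l 1 F (F' l)) ->
  (forall l, r <= l -> l <= 1 -> `|F' l| <= D * l `^ (- b - 1)) ->
  `|F 1 - F r| <= D / b * r `^ (- b).
Proof.
move=> b0 r0 r1 D0 Fd F'D; set E := D / b.
have E0 : 0 <= E by rewrite divr_ge0// ltW.
have key (sg : R) : `|sg| = 1 -> sg * (F 1 - F r) <= E * r `^ (- b).
  move=> sg1.
  have : - E * r `^ (- b) - sg * F r <= - E * 1 `^ (- b) - sg * F 1.
    have dG l : r <= l <= 1 -> is_derive l 1 (fun l => - E * l `^ (- b) - sg * F l)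
        (- E * (- b * l `^ (- b - 1)) - sg * F' l).
      move=> /andP[rl l1].
      exact (is_derive_sub (is_derive_scal (- E) (is_derive_powRN (- b) (lt_le_trans r0 rl)))
        (is_derive_scal sg (Fd l rl l1))).
    apply: (le_of_derive_ge0 r1 dG).
    move=> l /andP[rl l1]; have := F'D l rl l1.
    have -> : - E * (- b * l `^ (- b - 1)) = D * l `^ (- b - 1).
      by rewrite mulrA mulrNN /E divfK// gt_eqF.
    rewrite subr_ge0; apply: le_trans; rewrite (le_trans (ler_norm _))//.
    by rewrite normrM sg1 mul1r.
  by rewrite powR1 mulrBr; lra.
rewrite ler_norml; apply/andP; split.
  by have := key (-1); rewrite normrN normr1 => /(_ erefl); lra.
by have := key 1; rewrite normr1 => /(_ erefl); lra.
Qed.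

(* Uniform control on non-compactly supported functions: the part of [k(./r)]
   at distance about l from p is treated at the scale l, the contribution of
   all scales in [r, 1] being integrated. *)
Lemma tame_symbol (e : nat) g p theta a : tame e g p -> test_function theta ->
  a + e%:R < 0 ->
  exists (N : nat) C, 0 <= C /\ forall r k B, 0 < r -> r <= 1 -> smooth k ->
    symbol N a B k -> `|g (fun y => theta y * k ((y - p) / r))| <= C * B * r ^+ e.
Proof.
move=> tg tt ae.
have a0 : a < 0 by have : 0 <= e%:R :> R by []; lra.
have [ts [Mt Mt0 tM]] := (test_functionP theta).1 tt.
have [N1 [C1 [C10 H1]]] := tg 2.
have [N2 [C2 [C20 H2]]] := dist_bound g Mt.
pose N := maxn N1 N2.
have [A tA] := test_norm_bound N tt.
have [Ab bA] := test_norm_bound N (@plateau_test R).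
have [Ae eA] := test_norm_bound N euler_plateau_test.
have A0 := norm_bound_ge0 tA; have Ab0 := norm_bound_ge0 bA; have Ae0 := norm_bound_ge0 eA.
set W := 2 ^+ N : R; have W0 : 0 <= W by rewrite exprn_ge0.
pose D1 := C1 * (W * (W * A) * Ae); pose b := - (a + e%:R).
have b0 : 0 < b by rewrite oppr_gt0.
pose C := C1 * (W * (W * A) * Ab) + D1 / b + C2 * (W * (W * A) * (1 + Ab)).
have D10 : 0 <= D1 by rewrite !mulr_ge0.
exists N, C; split.
  by rewrite !addr_ge0 ?divr_ge0 ?mulr_ge0 ?addr_ge0// ltW.
move=> r k B r0 r1 ks kB; have B0 := symbol_ge0 kB.
have rn0 : r != 0 by rewrite gt_eqF.
have re0 : 0 <= r ^+ e by rewrite exprn_ge0// ltW.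
have tkr := test_mul tt (smooth_dilate (p := p) (t := r) ks).
(* The contribution from distance about [l] or less. The pairing is [Th r], plus the increase of
   [Th] from [r] to 1, plus a remainder living at distance at least 1 from [p]. *)
pose Th l := g (fun y => theta y * k ((y - p) / r) * plateau ((y - p) / l)).
have ThR : `|Th r| <= C1 * (W * (W * A) * Ab) * B * r ^+ e.
  pose ph z := theta (p + r * z) * k z * plateau z.
  have tph : test_function ph.
    exact (test_mulr (smooth_mul (smooth_dilate_test p rn0 tt).1 ks) (@plateau_test R)).
  have -> : Th r = g (fun y => ph ((y - p) / r)).
    congr (dist_app g); apply/funext => y; rewrite /ph.
    by congr (theta _ * _ * _); field.
  have := H1 r ph (W * (W * A * B) * Ab) r0 r1 tph.
  have -> : C1 * (W * (W * A * B) * Ab) * r ^+ e = C1 * (W * (W * A) * Ab) * B * r ^+ e by ring.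
  apply.
    by move=> z /ltW z2; rewrite /ph plateau_eq0// mulr0.
  apply: (norm_bound_leN (leq_maxl N1 N2)).
  have [tls tlA] := dilate_test_bound p ts r0 r1 tA.
  exact (norm_bound_mul (smooth_mul tls ks) (@plateau_smooth R)
    (norm_bound_mul tls ks tlA (symbol_norm_bound (ltW a0) kB)) bA).
have Th' l : r <= l -> l <= 1 ->
    is_derive l 1 Th (- l^-1 * g (fun y => theta y * k ((y - p) / r) * euler (@plateau R) ((y - p) / l))).
  move=> rl l1; apply: (dist_derive_dilate g p _ tkr (@plateau_smooth R)).
  exact: lt_le_trans rl.
(* With [b = - (a + e)] the scale [l] contributes the power [- b - 1] of [l]. As [b > 0], the
   integral over [[r, 1]] is governed by its lower end, and the powers [- a] and [- b] of [r]
   combine to [r ^+ e]. *)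
have split_pow l : 0 < l -> l^-1 * ((l / r) `^ a * l ^+ e) = r `^ (- a) * l `^ (- b - 1).
  move=> l0; have E1 : r^-1 `^ a = r `^ (- a).
    by rewrite -(powR_inv1 (ltW r0)) -powRrM mulN1r.
  have E2 : l `^ (-1) = l^-1 by rewrite powR_inv1 ?(ltW l0).
  have E3 : l `^ e%:R = l ^+ e by rewrite powR_mulrn ?(ltW l0).
  rewrite powRM ?invr_ge0 ?(ltW l0) ?(ltW r0)// E1 -E2 -E3.
  have -> : l `^ (- b - 1) = l `^ (-1) * l `^ a * l `^ e%:R.
    rewrite -!powRD; [|by apply/implyP => _; rewrite gt_eqF..].
    by congr (_ `^ _); rewrite /b; ring.
  by ring.
have diff : `|Th 1 - Th r| <= D1 / b * B * r ^+ e.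
  have := @powR_int_le a b r (D1 * B * r `^ (- a)) Th
    (fun l => - l^-1 * g (fun y => theta y * k ((y - p) / r) * euler (@plateau R) ((y - p) / l)))
    b0 r0 r1.
  have -> : D1 * B * r `^ (- a) / b * r `^ (- b) = D1 / b * B * r ^+ e.
    have -> : D1 * B * r `^ (- a) / b * r `^ (- b) = D1 / b * B * (r `^ (- a) * r `^ (- b)) by ring.
    rewrite -powRD; last by apply/implyP => _; rewrite gt_eqF.
    by rewrite -powR_mulrn ?(ltW r0)//; congr (_ * _ `^ _); rewrite /b; ring.
  apply => //; first by rewrite !mulr_ge0// powR_ge0.
  move=> l rl l1; have l0 : 0 < l by exact: lt_le_trans rl.
  have ln0 : l != 0 by rewrite gt_eqF.
  pose ps z := theta (p + l * z) * k (l / r * z) * euler (@plateau R) z.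
  have -> : (fun y => theta y * k ((y - p) / r) * euler (@plateau R) ((y - p) / l)) =
      fun y => ps ((y - p) / l).
    apply/funext => y; rewrite /ps; congr (theta _ * k _ * _).
      by field.
    by field; apply/andP.
  have tps : test_function ps.
    exact (test_mulr (smooth_mul (smooth_dilate_test p ln0 tt).1
      (smooth_mulc (c := l / r) ks)) euler_plateau_test).
  rewrite normrM normrN normfV (gtr0_norm l0).
  have lr0 : 0 < l / r by rewrite divr_gt0.
  have := H1 l ps (W * (W * A * (B * (l / r) `^ a)) * Ae) l0 l1 tps.
  move=> {}H1; have {}H1 := H1 _ _.
  have : `|g (fun y => ps ((y - p) / l))| <= C1 * (W * (W * A * (B * (l / r) `^ a)) * Ae) * l ^+ e.
    apply: H1; first by move=> z z2; rewrite /ps euler_plateau_ball2// mulr0.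
    apply: (norm_bound_leN (leq_maxl N1 N2)).
    exact (symbol_cut_bound p ts ks (euler_smooth (@plateau_smooth R)) euler_plateau_eq0
      tA eA kB (ltW a0) l0 l1 lr0).
  rewrite -(ler_pM2l (_ : 0 < l^-1)) ?invr_gt0//; move/le_trans; apply.
  have -> : l^-1 * (C1 * (W * (W * A * (B * (l / r) `^ a)) * Ae) * l ^+ e) =
     D1 * B * (l^-1 * ((l / r) `^ a * l ^+ e)) by rewrite /D1; ring.
  by rewrite split_pow// mulrA.
have rest : `|g (fun y => theta y * k ((y - p) / r)) - Th 1| <= C2 * (W * (W * A) * (1 + Ab)) * B * r ^+ e.
  have tb : test_function (fun y => theta y * k ((y - p) / r) * plateau ((y - p) / 1)).
    exact (test_mul tkr (smooth_dilate (p := p) (t := 1) (@plateau_smooth R))).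
  rewrite -(dist_sub g tkr tb).
  pose ps z := theta (p + 1 * z) * k (r^-1 * z) * (1 - plateau z).
  have pE y : p + 1 * ((y - p) / 1) = y by rewrite mul1r divr1; ring.
  have -> : (fun x => theta x * k ((x - p) / r) - theta x * k ((x - p) / r) * plateau ((x - p) / 1)) =
      fun y => ps ((y - p) / 1).
    apply/funext => y; rewrite /ps pE divr1 [r^-1 * _]mulrC; ring.
  have pss : smooth ps.
    exact (smooth_mul (smooth_mul (smooth_dilate_test p (oner_neq0 R) tt).1
      (smooth_mulc (c := r^-1) ks)) smooth_1plateau).
  have psT : test_function (fun y => ps ((y - p) / 1)).
    split; first exact (smooth_dilate (p := p) (t := 1) pss).
    by exists Mt => y yM; rewrite /ps pE tM// !mul0r.
  apply: (@le_trans _ _ (C2 * (W * (W * A * (B * r^-1 `^ a)) * (1 + Ab)))).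
    apply: H2 => //.
      by move=> y yM; rewrite /ps pE tM// !mul0r.
    apply: (norm_bound_leN (leq_maxr N1 N2)).
    have := norm_bound_dilate p ltr01 (lexx 1) pss; rewrite invr1.
    move=> /(_ N (W * (W * A * (B * r^-1 `^ a)) * (1 + Ab))).
    rewrite expr1n mul1r; apply.
    have ri0 : 0 < r^-1 by rewrite invr_gt0.
    have b1 z : `|z| < 1 -> 1 - plateau z = 0 by move=> /ltW z1; rewrite plateau_eq1// subrr.
    exact (symbol_cut_bound p ts ks smooth_1plateau b1 tA (norm_bound_1plateau bA) kB
      (ltW a0) ltr01 (lexx 1) ri0).
  have : r^-1 `^ a <= r ^+ e.
    rewrite -(powR_inv1 (ltW r0)) -powRrM mulN1r -(powR_mulrn _ (ltW r0)).
    by rewrite ger_powR ?r0//; lra.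
  move=> ra.
  have -> : C2 * (W * (W * A * (B * r^-1 `^ a)) * (1 + Ab)) = C2 * (W * (W * A) * (1 + Ab)) * B * r^-1 `^ a by ring.
  by rewrite ler_wpM2l// !mulr_ge0// addr_ge0.
have -> : C * B * r ^+ e = C1 * (W * (W * A) * Ab) * B * r ^+ e + D1 / b * B * r ^+ e +
   C2 * (W * (W * A) * (1 + Ab)) * B * r ^+ e by rewrite /C; ring.
move: ThR diff rest; clear; rewrite !ler_norml => /andP[? ?] /andP[? ?] /andP[? ?].
by apply/andP; split; lra.
Qed.

End TameSymbol.

(** * One-sided limits and a criterion for their existence *)

Section Limits.
Variable R : realType.
Implicit Types (f k phi psi theta : R -> R) (a p r t x y z c d e h s l A B M C L D : R).

Lemma right_limP f l : f t @[t --> 0^'+] --> l <->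
  forall e, 0 < e -> exists2 r, 0 < r & forall t, 0 < t -> t < r -> `|f t - l| <= e.
Proof.
split=> [/cvgrPdist_le H e e0|H].
  have [r /= r0 rH] := H e e0; exists r => // t t0 tr; rewrite distrC.
  by apply: rH => //=; rewrite sub0r normrN gtr0_norm.
apply/cvgrPdist_le => e e0; have [r r0 rH] := H e e0.
exists r => //= t /=; rewrite sub0r normrN => tr t0; rewrite distrC.
by apply: rH => //; rewrite gtr0_norm in tr.
Qed.

Lemma punctured_limP f l : f t @[t --> 0^'] --> l <->
  forall e, 0 < e -> exists2 r, 0 < r & forall t, t != 0 -> `|t| < r -> `|f t - l| <= e.
Proof.
split=> [/cvgrPdist_le H e e0|H].
  have [r /= r0 rH] := H e e0; exists r => // t t0 tr; rewrite distrC.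
  by apply: rH => //=; rewrite sub0r normrN.
apply/cvgrPdist_le => e e0; have [r r0 rH] := H e e0.
exists r => //= t /=; rewrite sub0r normrN => tr t0; rewrite distrC.
by apply: rH.
Qed.

Lemma right_lim_uniq f l l' : f t @[t --> 0^'+] --> l ->
  f t @[t --> 0^'+] --> l' -> l = l'.
Proof. by move=> H H'; apply: (cvg_unique _ H H'). Qed.

(** [f] is Lipschitz near 0, and its limit is the supremum of the lower bounds [f t - B t]. The
    linear rate is kept because it makes limits of distributions continuous. *)
Lemma limit_of_bounded_derivative (f f' : R -> R) B d : 0 < d -> 0 <= B ->
  (forall t, 0 < t -> t <= d -> is_derive t 1 f (f' t)) ->
  (forall t, 0 < t -> t <= d -> `|f' t| <= B) ->
  exists2 l, f t @[t --> 0^'+] --> l & forall t, 0 < t -> t <= d -> `|f t - l| <= B * t.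
Proof.
move=> d0 B0 fd fB.
have lip s t : 0 < s -> s <= t -> t <= d -> `|f t - f s| <= B * (t - s).
  move=> s0 st td.
  have fd' x : Num.min s t <= x <= Num.max s t -> is_derive x 1 f (f' x).
    rewrite min_l// max_r// => /andP[sx xt].
    exact: (fd x (lt_le_trans s0 sx) (le_trans xt td)).
  rewrite -(ger0_norm (_ : 0 <= t - s)) ?subr_ge0//.
  apply: (mvt_norm_le fd') => x; rewrite min_l// max_r// => /andP[sx xt].
  by apply: fB; [exact: lt_le_trans sx|exact: le_trans td].
pose E := [set f t - B * t | t in [set t | 0 < t <= d]].
have E0 : E !=set0 by exists (f d - B * d); exists d => //=; rewrite d0 lexx.
have Bt t : 0 < t -> 0 <= B * t by move=> t0; rewrite mulr_ge0// ltW.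
have ubE t : 0 < t -> t <= d -> ubound E (f t + B * t).
  move=> t0 td _ [s /= /andP[s0 sd] <-].
  have [st|/ltW ts] := leP s t.
    have := lip s t s0 st td; rewrite ler_norml => /andP[? ?].
    by have := Bt s s0; have := Bt t t0; lra.
  have := lip t s t0 ts sd; rewrite ler_norml => /andP[? ?].
  by have := Bt s s0; have := Bt t t0; lra.
have key t : 0 < t -> t <= d -> `|f t - sup E| <= B * t.
  move=> t0 td; rewrite distrC ler_distl; apply/andP; split.
    apply: sup_upper_bound; last by exists t => //=; rewrite t0 td.
    by split=> //; exists (f t + B * t); exact: ubE.
  by apply: sup_le_ub => //; exact: ubE.
exists (sup E) => //; apply/right_limP => e e0.
exists (Num.min d (e / (B + 1))); first by rewrite lt_min d0 divr_gt0// ltr_wpDl.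
move=> t t0; rewrite lt_min ltr_pdivlMr ?ltr_wpDl// => /andP[td te].
rewrite (le_trans (key t t0 (ltW td)))//.
by rewrite mulrC; lra.
Qed.

End Limits.

(** * Integrals and primitives of test functions *)

Section Integrals.
Variable R : realType.
Implicit Types (f k phi psi theta F : R -> R) (a p r t x y z c d e h s l A B M C L D : R).
Notation mu := (@lebesgue_measure R).

Lemma integral_itv_derive f F a b : a < b -> continuous f ->
  (forall x, is_derive x 1 F (f x)) -> \int[mu]_(x in `[a, b]) f x = F b - F a.
Proof.
move=> ab fc Ff; have Fc : continuous F.
  by move=> x; exact: (is_derive_continuous (Ff x)).
rewrite /Rintegral (@continuous_FTC2 R f F a b)//.
- exact: continuous_subspaceT.
- split; first by move=> x _; case: (Ff x).
  + by apply: cvg_at_right_filter; exact: Fc.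
  + by apply: cvg_at_left_filter; exact: Fc.
- by move=> x _; rewrite derive1E; case: (Ff x).
Qed.

(** Only the trace of [D] on the support counts, so the line and the two half-lines all reduce to a
    compact interval. *)
Lemma integral_ball_supported (D : set R) f F M a b : a < b -> continuous f ->
  (forall x, is_derive x 1 F (f x)) -> ball_supported M f ->
  (forall x, `|x| <= M -> D x <-> a <= x <= b) ->
  \int[mu]_(x in D) f x = F b - F a.
Proof.
move=> ab fc Ff fM DM; rewrite -(integral_itv_derive ab fc Ff).
rewrite Rintegral_mkcond [RHS]Rintegral_mkcond; congr Rintegral.
apply/funext => x; rewrite /patch.
have [xM|xM] := leP `|x| M; last by rewrite fM//; do 2 case: ifP.
have -> // : (x \in D) = (x \in `[a, b]%classic).
apply/idP/idP; rewrite !inE /= in_itv/=.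
  by move=> /DM; apply.
by move=> H; apply/DM.
Qed.


Lemma test_continuous phi : test_function phi -> continuous phi.
Proof. by move=> /test_smooth; exact: smooth_continuous. Qed.

Lemma test_integrable phi (D : set R) : measurable D -> test_function phi ->
  mu.-integrable D (EFin \o phi).
Proof.
move=> mD tphi; apply: (integrableS measurableT) => //.
have [_ [M M0 phiM]] := (test_functionP phi).1 tphi.
have -> : EFin \o phi = (EFin \o phi) \_ `[- M, M].
  apply/funext => x; rewrite /patch; case: ifPn => //.
  rewrite notin_setE /= in_itv/= => /negP; rewrite -ler_norml -ltNge => xM.
  by rewrite phiM.
have H : mu.-integrable `[- M, M] (EFin \o phi).
  apply: continuous_compact_integrable; first exact: segment_compact.
  by apply: continuous_subspaceT; exact: test_continuous.
by apply: (integrable_mkcond _ _).1 => //.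
Qed.

Lemma integral_test phi F M : test_function phi -> (forall x, is_derive x 1 F (phi x)) ->
  0 < M -> ball_supported M phi -> \int[mu]_x phi x = F M - F (- M).
Proof.
move=> tphi Fd M0 phiM.
apply: (integral_ball_supported (M := M)) => //; first by lra.
- exact: test_continuous.
- by move=> x; rewrite ler_norml => ->.
Qed.

Lemma integral_test_neg phi F M : test_function phi -> (forall x, is_derive x 1 F (phi x)) ->
  0 < M -> ball_supported M phi -> \int[mu]_(x in `]-oo, 0%R]) phi x = F 0 - F (- M).
Proof.
move=> tphi Fd M0 phiM.
apply: (integral_ball_supported (M := M)) => //; first by lra.
- exact: test_continuous.
- by move=> x; rewrite ler_norml /= in_itv/= => /andP[-> _].
Qed.

Lemma integral_test_pos phi F M : test_function phi -> (forall x, is_derive x 1 F (phi x)) ->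
  0 < M -> ball_supported M phi -> \int[mu]_(x in `[0%R, +oo[) phi x = F M - F 0.
Proof.
move=> tphi Fd M0 phiM.
apply: (integral_ball_supported (M := M)) => //.
- exact: test_continuous.
- by move=> x; rewrite ler_norml /= in_itv/= => /andP[_ ->]; rewrite !andbT.
Qed.

Definition prim phi x := \int[mu]_(t in `]-oo, x]) phi t.

Lemma prim_derive phi x : test_function phi -> is_derive x 1 (prim phi) (phi x).
Proof.
move=> tphi; have [||||H1 H2] := @continuous_FTC1 R phi (BInfty _ true) x (x + 1).
- by rewrite ltrDl.
- exact: test_integrable.
- exact: ltNyr.
- exact: test_continuous.
exact (DeriveDef H1 (etrans (esym (derive1E _ _)) H2)).
Qed.

Lemma prim_eq0 phi M x : ball_supported M phi -> x < - M -> prim phi x = 0.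
Proof.
move=> phiM xM; rewrite /prim -[RHS](@Rintegral_set0 _ _ _ mu phi).
rewrite Rintegral_mkcond [RHS]Rintegral_mkcond; congr Rintegral.
apply/funext => y; rewrite /patch in_set0; case: ifPn => //.
rewrite inE /= in_itv/= => yx; rewrite phiM//.
by rewrite ltr_normr; apply/orP; right; lra.
Qed.

Lemma prim_eq_integral phi M x : test_function phi -> ball_supported M phi -> M < x ->
  prim phi x = \int[mu]_y phi y.
Proof.
move=> tphi phiM Mx; rewrite /prim Rintegral_mkcond; congr Rintegral.
apply/funext => y; rewrite /patch; case: ifPn => //.
rewrite notin_setE /= in_itv/= => /negP; rewrite -ltNge => xy.
by rewrite phiM// ltr_normr; apply/orP; left; lra.
Qed.

(** The primitive that vanishes to the right of the support. This side is chosen because a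
    distribution defined through [upper] then vanishes to the left of [[a, b]], as the normalization
    at [a] demands. *)
Definition upper phi x := (\int[mu]_y phi y) - prim phi x.

Lemma upper_derive phi x : test_function phi -> is_derive x 1 (upper phi) (- phi x).
Proof.
move=> tphi; apply: (is_derive_eq (is_derive_sub (is_derive_cstl x _) (prim_derive x tphi))).
by rewrite sub0r.
Qed.

Lemma upper_eq0 phi M x : test_function phi -> ball_supported M phi -> M < x ->
  upper phi x = 0.
Proof. by move=> tphi phiM Mx; rewrite /upper (prim_eq_integral tphi phiM Mx) subrr. Qed.

Lemma upper_eq_integral phi M x : ball_supported M phi -> x < - M ->
  upper phi x = \int[mu]_y phi y.
Proof. by move=> phiM Mx; rewrite /upper (prim_eq0 phiM Mx) subr0. Qed.

Lemma upper_jet phi n : test_function phi ->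
  smooth (upper phi) /\ derive1n n.+1 (upper phi) = fun x => - derive1n n phi x.
Proof.
move=> tphi.
have H m x : is_derive x 1 ((fun m x => if m is k.+1 then - derive1n k phi x else upper phi x) m)
    ((fun m x => if m is k.+1 then - derive1n k phi x else upper phi x) m.+1 x).
  case: m => [|m] /=; first exact: upper_derive.
  by apply: is_derive_opp; apply: smooth_is_derive; exact: test_smooth.
have [s1 s2] := smooth_jet H; split; first exact: s1.
exact: (s2 n.+1).
Qed.

Lemma upper_smooth phi : test_function phi -> smooth (upper phi).
Proof. by move=> tphi; exact: (upper_jet 0 tphi).1. Qed.

(** Identities for [upper], and through them those for integrals under dilation, are proved by
    comparing derivatives and values far to the right. *)
Lemma upper_uniq phi F M : test_function phi -> (forall x, is_derive x 1 F (- phi x)) ->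
  (forall x, M < x -> F x = 0) -> upper phi = F.
Proof.
move=> tphi Fd F0; have [_ [M' M'0 phiM]] := (test_functionP phi).1 tphi.
apply/funext => x; apply/eqP; rewrite -subr_eq0.
pose z := Num.max M M' + 1.
have -> : upper phi x - F x = upper phi z - F z.
  apply: (@derive_zero_cst _ (fun x => upper phi x - F x)) => y.
  by apply: (is_derive_eq (is_derive_sub (upper_derive y tphi) (Fd y))); rewrite subrr.
have Mz : M < z by rewrite ltr_pwDr// le_max lexx.
have Mz' : M' < z by rewrite ltr_pwDr// le_max lexx orbT.
by rewrite (upper_eq0 tphi phiM Mz') F0// subrr.
Qed.

Lemma upper_lin c phi psi : test_function phi -> test_function psi ->
  upper (fun y => c * phi y + psi y) = fun y => c * upper phi y + upper psi y.
Proof.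
move=> tphi tpsi; have [_ [M M0 phiM]] := (test_functionP phi).1 tphi.
have [_ [M' M'0 psiM]] := (test_functionP psi).1 tpsi.
apply: (upper_uniq (M := Num.max M M')); first exact: test_lin.
  move=> x; apply: (is_derive_eq (is_derive_add (is_derive_scal c (upper_derive x tphi))
    (upper_derive x tpsi))); ring.
move=> x; rewrite gt_max => /andP[Mx Mx'].
by rewrite (upper_eq0 tphi phiM Mx) (upper_eq0 tpsi psiM Mx') mulr0 addr0.
Qed.

Lemma upper_derive1 phi : test_function phi -> upper (derive1 phi) = fun y => - phi y.
Proof.
move=> tphi; have [phis [M M0 phiM]] := (test_functionP phi).1 tphi.
apply: (upper_uniq (M := M)); first exact: test_derive1.
  by move=> x; apply: is_derive_opp; exact: smooth_is_derive0.
by move=> x Mx; rewrite phiM ?oppr0// (lt_le_trans Mx)// ler_norm.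
Qed.

Lemma upper_dilate phi p t : 0 < t -> test_function phi ->
  upper (fun y => phi ((y - p) / t)) = fun y => t * upper phi ((y - p) / t).
Proof.
move=> t0 tphi; have [phis [M M0 phiM]] := (test_functionP phi).1 tphi.
apply: (upper_uniq (M := p + t * M)).
- by apply: test_dilate => //; rewrite gt_eqF.
- move=> x; have aff : is_derive x 1 (fun y => (y - p) / t) t^-1.
    apply: (@is_derive_near _ (fun y => t^-1 * y + (- p / t)) _ _ _ 1 ltr01).
    by move=> w _; rewrite mulrC -mulrDl.
    exact: is_derive_affine.
  apply: (is_derive_eq (is_derive_scal t (is_derive_chain (g := fun y => (y - p) / t)
    (upper_derive _ tphi) aff))).
  by rewrite mulrCA divff ?mulr1// gt_eqF.
- move=> x Mx; rewrite (upper_eq0 tphi phiM) ?mulr0//.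
  by rewrite ltr_pdivlMr// mulrC; lra.
Qed.

Lemma integral_dilate phi p t : 0 < t -> test_function phi ->
  \int[mu]_y phi ((y - p) / t) = t * \int[mu]_y phi y.
Proof.
move=> t0 tphi; have [phis [M M0 phiM]] := (test_functionP phi).1 tphi.
have tpt : test_function (fun y => phi ((y - p) / t)).
  by apply: test_dilate => //; rewrite gt_eqF.
have [_ [M' M'0 phiM']] := (test_functionP _).1 tpt.
pose z := Num.min (- M' - 1) (p - t * M - 1).
have z1 : z < - M' by rewrite /z gt_min; apply/orP; left; lra.
have z2 : (z - p) / t < - M.
  have : z < p - t * M by rewrite /z gt_min; apply/orP; right; lra.
  by rewrite ltr_pdivrMr//; lra.
by rewrite -(upper_eq_integral phiM' z1) upper_dilate// (upper_eq_integral phiM z2).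
Qed.

Lemma integral_reflect phi : test_function phi ->
  \int[mu]_y phi (- y) = \int[mu]_y phi y.
Proof.
move=> tphi; have [phis [M M0 phiM]] := (test_functionP phi).1 tphi.
have E : (fun y => phi (- y)) = fun y => phi ((y - 0) / -1).
  by apply/funext => y; rewrite subr0 invrN1 mulrN1.
have tr : test_function (fun y => phi (- y)).
  by rewrite E; apply: test_dilate => //; rewrite oppr_eq0 oner_neq0.
have rM : ball_supported M (fun y => phi (- y)).
  by move=> y yM; rewrite phiM// normrN.
have dr x : is_derive x 1 (fun y => - prim phi (- y)) (phi (- x)).
  apply: (is_derive_eq (is_derive_opp (is_derive_chain (g := fun y => - y)
    (prim_derive _ tphi) (is_derive_opp (is_derive_var x))))).
  by rewrite mulrN1 opprK.
rewrite (integral_test tr dr M0 rM) (integral_test tphi (fun x => prim_derive x tphi) M0 phiM).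
by rewrite !opprK addrC.
Qed.

End Integrals.

(** * Restriction of a tame distribution to a half-line *)

Section Restriction.
Variable R : realType.
Implicit Types (f k phi psi theta : R -> R) (a b p r t x y z c d e h s l A B M C L D : R).
Implicit Types (g gp u v U : schwartz_distribution R).
Notation mu := (@lebesgue_measure R).

(** Zero up to 1 and one from 2 on, so that [cut ((y - p) / d)] stays off [p] and tends to the
    indicator of []p, +oo[] as [d] decreases to 0. *)
Definition cut z : R := sstep (z - 1).

Lemma cut_smooth : smooth cut.
Proof.
have := smooth_affine (c := 1) (p := -1) (@sstep_smooth R).
by under eq_fun do rewrite mul1r.
Qed.

Lemma cut_eq0 z : z <= 1 -> cut z = 0.
Proof. by move=> z1; rewrite /cut sstep_eq0// subr_le0. Qed.

Lemma cut_eq1 z : 2 <= z -> cut z = 1.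
Proof. by move=> z2; rewrite /cut sstep_eq1//; lra. Qed.

Lemma euler_cut_ball2 : ball_supported 2 (euler cut).
Proof.
move=> z z2; have r0 : 0 < `|z| - 2 by rewrite subr_gt0.
rewrite /euler -derive1n1.
have [z0|z0] := leP 0 z.
  have H y : `|y - z| < `|z| - 2 -> cut y = 1.
    by rewrite (ger0_norm z0) ltr_norml => /andP[? _]; rewrite cut_eq1//; lra.
  by rewrite (derive1n_near_cst 1 r0 cut_smooth H) mulr0.
have H y : `|y - z| < `|z| - 2 -> cut y = 0.
  by rewrite (ltr0_norm z0) ltr_norml => /andP[_ ?]; rewrite cut_eq0//; lra.
by rewrite (derive1n_near_cst 1 r0 cut_smooth H) mulr0.
Qed.

Lemma euler_cut_test : test_function (euler cut).
Proof.
by split; [exact: euler_smooth cut_smooth|exists 2; exact: euler_cut_ball2].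
Qed.

Lemma norm_bound_mul_ball f M (N : nat) : smooth f -> exists2 C, 0 <= C &
  forall psi B, smooth psi -> ball_supported M psi -> norm_bound N B psi ->
    norm_bound N (C * B) (fun y => psi y * f y).
Proof.
move=> fs; have [A A0 HA] := jets_bounded_ball N M fs.
have W0 : 0 <= 2 ^+ N :> R by rewrite exprn_ge0.
exists (2 ^+ N * A) => [|psi B psis psiM psiB k x kN]; first by rewrite mulr_ge0.
have B0 := norm_bound_ge0 psiB.
have [xM|xM] := leP `|x| M; last first.
  have pM : ball_supported M (fun y => psi y * f y).
    by move=> y yM; rewrite psiM// mul0r.
  by rewrite (derive1n_ball_supported k (smooth_mul psis fs) pM xM) normr0 !mulr_ge0.
have j1 : jet_bound N B 1 psi x by move/norm_bound_jet: psiB.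
have j2 : jet_bound N A 1 f x by move=> m mN; rewrite expr1n mulr1 HA.
have := jet_bound_mul psis fs ler01 j1 j2 kN; rewrite expr1n mulr1.
by rewrite mulrAC.
Qed.

Lemma dist_diff_exists g v : exists u : schwartz_distribution R,
  forall psi, test_function psi -> u psi = g psi - v psi :> R.
Proof.
have lin c phi psi : test_function phi -> test_function psi ->
    g (fun x => c * phi x + psi x) - v (fun x => c * phi x + psi x) =
    c * (g phi - v phi) + (g psi - v psi) :> R.
  by move=> a1 a2; rewrite !dist_lin//; ring.
have cont M : exists (N : nat) C, forall phi, test_function phi ->
    (forall x, M < `|x| -> phi x = 0) -> forall B,
    (forall (k : nat) x, (k <= N)%N -> `|derive1n k phi x| <= B) ->
    `|g phi - v phi| <= C * B.
  have [N1 [C1 [C10 H1]]] := dist_bound g M.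
  have [N2 [C2 [C20 H2]]] := dist_bound v M.
  exists (maxn N1 N2), (C1 + C2) => phi tphi phiM B phiB.
  rewrite (le_trans (ler_normB _ _))// mulrDl lerD//.
    by apply: H1 => //; exact: (norm_bound_leN (leq_maxl N1 N2)).
  by apply: H2 => //; exact: (norm_bound_leN (leq_maxr N1 N2)).
by exists (SchwartzDistribution lin cont).
Qed.

Lemma tame_pt (e : nat) g p phi : tame e g p -> test_function phi ->
  exists2 L, 0 <= L & forall r, 0 < r -> r <= 1 ->
    `|g (fun y => phi ((y - p) / r))| <= L * r ^+ e.
Proof.
move=> tg tphi; have [_ [M M0 phiM]] := (test_functionP phi).1 tphi.
have [N [C [C0 H]]] := tg M; have [B phiB] := test_norm_bound N tphi.
have B0 := norm_bound_ge0 phiB.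
by exists (C * B) => [|r r0 r1]; [rewrite mulr_ge0|exact: H].
Qed.

Lemma tame_theta (e : nat) g p theta M : tame e g p -> test_function theta ->
  exists (N : nat) C, 0 <= C /\
  forall r phi B, 0 < r -> r <= 1 -> test_function phi -> ball_supported M phi ->
    norm_bound N B phi ->
    `|g (fun y => theta y * phi ((y - p) / r))| <= C * B * r ^+ e.
Proof.
move=> tg tt; have [N [C [C0 H]]] := tg M.
have [A tA] := test_norm_bound N tt; have A0 := norm_bound_ge0 tA.
exists N, (C * (2 ^+ N * A)); split; first by rewrite !mulr_ge0// exprn_ge0.
move=> r phi B r0 r1 tphi phiM phiB; have rn0 : r != 0 by rewrite gt_eqF.
have [tls tlA] := dilate_test_bound p (test_smooth tt) r0 r1 tA.
have -> : (fun y => theta y * phi ((y - p) / r)) =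
    fun y => (fun z => theta (p + r * z) * phi z) ((y - p) / r).
  by apply/funext => y; congr (theta _ * _); field.
have -> : C * (2 ^+ N * A) * B * r ^+ e = C * (2 ^+ N * A * B) * r ^+ e by ring.
apply: (H r (fun z => theta (p + r * z) * phi z) _ r0 r1).
- exact (test_mulr tls tphi).
- by move=> z zM; rewrite phiM// mulr0.
- exact (norm_bound_mul tls (test_smooth tphi) tlA phiB).
Qed.

Definition tame_all g := forall x, tame 1 g x.

Definition is_restriction g p gp := forall psi, test_function psi ->
  g (fun y => psi y * cut ((y - p) / d)) @[d --> 0^'+] --> gp psi.

(** The derivative of the pairing in [d] is [- d^-1] times a pairing with [euler cut] at scale [d].
    That function is compactly supported, so tameness of exponent 1 bounds the derivative and the
    limit exists. The bound on [psi] is asked only up to scale [d0], which allows a dilated [psi]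
    later. *)
Lemma restriction_estimate g p : tame 1 g p -> exists (N : nat) C, 0 <= C /\
  forall psi B d0, test_function psi -> 0 < d0 -> d0 <= 1 ->
  (forall d, 0 < d -> d <= d0 -> norm_bound N B (fun z => psi (p + d * z) * euler cut z)) ->
  exists2 l, g (fun y => psi y * cut ((y - p) / d)) @[d --> 0^'+] --> l &
   forall d, 0 < d -> d <= d0 -> `|g (fun y => psi y * cut ((y - p) / d)) - l| <= C * B * d.
Proof.
move=> tg; have [N [C [C0 H]]] := tg 2.
exists N, C; split=> // psi B d0 tpsi d00 d01 psiB.
have B0 : 0 <= B by exact: norm_bound_ge0 (psiB d0 d00 (lexx _)).
apply: (@limit_of_bounded_derivative _ (fun d => g (fun y => psi y * cut ((y - p) / d)))
  (fun d => - d^-1 * g (fun y => psi y * euler cut ((y - p) / d))) (C * B) d0) => //.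
- by rewrite mulr_ge0.
- by move=> d d0' _; exact: (dist_derive_dilate g p d0' tpsi cut_smooth).
- move=> d dp dd0; have dn0 : d != 0 by rewrite gt_eqF.
  have -> : (fun y => psi y * euler cut ((y - p) / d)) =
      fun y => (fun z => psi (p + d * z) * euler cut z) ((y - p) / d).
    by apply/funext => y; congr (psi _ * _); field.
  rewrite normrM normrN normfV (gtr0_norm dp) mulrC ler_pdivrMr//.
  have := H d (fun z => psi (p + d * z) * euler cut z) B dp (le_trans dd0 d01).
  rewrite expr1; apply; last exact: psiB.
    exact (test_mulr (smooth_dilate_test p dn0 tpsi).1 euler_cut_test).
  by move=> z z2; rewrite euler_cut_ball2// mulr0.
Qed.

Lemma restriction_exists g p : tame 1 g p -> exists gp, is_restriction g p gp.
Proof.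
move=> tg; have [N [C [C0 H]]] := restriction_estimate tg.
have [Ak kA] := test_norm_bound N euler_cut_test; have Ak0 := norm_bound_ge0 kA.
have bnd psi B d : test_function psi -> norm_bound N B psi -> 0 < d -> d <= 1 ->
    norm_bound N (2 ^+ N * B * Ak) (fun z => psi (p + d * z) * euler cut z).
  move=> tpsi psiB d0 d1.
  have [tls tlA] := dilate_test_bound p (test_smooth tpsi) d0 d1 psiB.
  exact (norm_bound_mul tls (test_smooth euler_cut_test) tlA kA).
have lim1 psi : exists l, test_function psi ->
    g (fun y => psi y * cut ((y - p) / d)) @[d --> 0^'+] --> l.
  have [tpsi|] := pselect (test_function psi); last by move=> ?; exists 0.
  have [B psiB] := test_norm_bound N tpsi.
  have [l Hl _] := H psi _ 1 tpsi ltr01 (lexx 1) (fun d => bnd psi B d tpsi psiB).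
  by exists l.
have [G GH] := choice lim1.
have tcut psi d : test_function psi -> test_function (fun y => psi y * cut ((y - p) / d)).
  by move=> tpsi; exact (test_mul tpsi (smooth_dilate (p := p) (t := d) cut_smooth)).
have lin c phi psi : test_function phi -> test_function psi ->
    G (fun x => c * phi x + psi x) = c * G phi + G psi.
  move=> tphi tpsi; apply: (right_lim_uniq (GH _ (test_lin c tphi tpsi))).
  under eq_fun => d.
    under eq_fun do rewrite mulrDl -mulrA.
    rewrite (dist_lin g c (tcut phi d tphi) (tcut psi d tpsi)).
    over.
  by apply: cvgD; [apply: cvgMr; exact: GH|exact: GH].
(* The limit differs from the pairing at [d = 1] by at most the linear rate, and both are controlled
   by seminorms. *)
have cont M : exists (N : nat) C, forall phi, test_function phi ->
    (forall x, M < `|x| -> phi x = 0) -> forall B,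
    (forall (k : nat) x, (k <= N)%N -> `|derive1n k phi x| <= B) ->
    `|G phi| <= C * B.
  have [N2 [C2 [C20 H2]]] := dist_bound g M.
  have [C3 C30 H3] := @norm_bound_mul_ball (fun y => cut ((y - p) / 1)) M N2
    (smooth_dilate (p := p) (t := 1) cut_smooth).
  exists (maxn N N2), (C2 * C3 + C * (2 ^+ N * Ak)) => phi tphi phiM B phiB.
  have b1 := norm_bound_leN (leq_maxl N N2) phiB.
  have b2 := norm_bound_leN (leq_maxr N N2) phiB.
  have [l Hl lH] := H phi _ 1 tphi ltr01 (lexx 1) (fun d => bnd phi B d tphi b1).
  rewrite (right_lim_uniq (GH phi tphi) Hl).
  have := lH 1 ltr01 (lexx 1); rewrite mulr1.
  have : `|g (fun y => phi y * cut ((y - p) / 1))| <= C2 * (C3 * B).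
    apply: H2; first exact: tcut.
    - by move=> y yM; rewrite phiM// mul0r.
    - exact: (H3 phi B (test_smooth tphi) phiM b2).
  have := lerB_dist l (g (fun y => phi y * cut ((y - p) / 1))).
  rewrite [X in _ <= X -> _]distrC; lra.
by exists (SchwartzDistribution lin cont) => psi tpsi; exact: GH.
Qed.

Lemma restriction_right g p gp psi rho : is_restriction g p gp -> test_function psi ->
  0 < rho -> (forall y, y < p + rho -> psi y = 0) -> gp psi = g psi.
Proof.
move=> H tpsi rho0 psi0; apply: (right_lim_uniq (H psi tpsi)).
apply/right_limP => e e0; exists (rho / 2); first by rewrite divr_gt0.
move=> t t0 tr; have -> : (fun y => psi y * cut ((y - p) / t)) = psi.
  apply/funext => y; have [yp|yp] := ltP y (p + rho); first by rewrite psi0// mul0r.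
  by rewrite cut_eq1 ?mulr1// ler_pdivlMr//; lra.
by rewrite subrr normr0 ltW.
Qed.

Lemma restriction_left g p gp psi : is_restriction g p gp -> test_function psi ->
  (forall y, p <= y -> psi y = 0) -> gp psi = 0.
Proof.
move=> H tpsi psi0; apply: (right_lim_uniq (H psi tpsi)).
apply/right_limP => e e0; exists 1 => // t t0 _.
have -> : (fun y => psi y * cut ((y - p) / t)) = fun=> 0.
  apply/funext => y; have [yp|yp] := leP p y; first by rewrite psi0// mul0r.
  rewrite cut_eq0 ?mulr0// ler_pdivrMr//; lra.
by rewrite dist0 subrr normr0 ltW.
Qed.

Lemma restriction_tame g p gp : tame_all g -> is_restriction g p gp -> tame_all gp.
Proof.
move=> tg H x; apply: tameP => phi tphi.
have [phis [M M0 phiM]] := (test_functionP phi).1 tphi.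
have tr r : 0 < r -> test_function (fun y => phi ((y - x) / r)).
  by move=> r0; apply: test_dilate => //; rewrite gt_eqF.
have phi0 r y : 0 < r -> M * r < `|y - x| -> phi ((y - x) / r) = 0.
  by move=> r0 h; rewrite phiM// normrM normfV (gtr0_norm r0) ltr_pdivlMr.
have small D r : 0 < D -> r < D / (2 * M) -> M * r < D / 2.
  by move=> D0; rewrite ltr_pdivlMr ?mulr_gt0//; lra.
have [xp|xp|xp] := ltgtP x p.
- exists 0, ((p - x) / (2 * M)); split; first by rewrite divr_gt0 ?mulr_gt0 ?subr_gt0.
  move=> r r0 rM; rewrite (restriction_left H (tr r r0)) ?normr0 ?mul0r// => y py.
  apply: phi0 => //; have := small (p - x) r; rewrite subr_gt0 => /(_ xp rM).
  by rewrite ger0_norm; lra.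
- have [L L0 HL] := tame_pt (tg x) tphi.
  exists L, (Num.min 1 ((x - p) / (2 * M))); split.
    by rewrite lt_min ltr01 divr_gt0 ?mulr_gt0 ?subr_gt0.
  move=> r r0; rewrite lt_min => /andP[r1 rM].
  have xp2 : 0 < (x - p) / 2 by rewrite divr_gt0// subr_gt0.
  rewrite (restriction_right H (tr r r0) xp2).
    by apply: HL => //; exact: ltW.
  move=> y yp; apply: phi0 => //; have := small (x - p) r; rewrite subr_gt0 => /(_ xp rM).
  by rewrite ler0_norm; lra.
(* At the cutting point the estimate is used only up to [d = r]: there the pairing is one with the
   dilation of the fixed function [phi cut], and for smaller [d] the norms do not depend on [r]. *)
- subst x; have [N [C [C0 HE]]] := restriction_estimate (tg p).
  have [Ak kA] := test_norm_bound N euler_cut_test; have Ak0 := norm_bound_ge0 kA.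
  have [B phiB] := test_norm_bound N tphi; have B0 := norm_bound_ge0 phiB.
  have tpc := test_mul tphi cut_smooth.
  have [L L0 HL] := tame_pt (tg p) tpc.
  exists (L + C * (2 ^+ N * B * Ak)), 1; split => // r r0 r1.
  have rn0 : r != 0 by rewrite gt_eqF.
  have HB d : 0 < d -> d <= r -> norm_bound N (2 ^+ N * B * Ak)
      (fun z => phi ((p + d * z - p) / r) * euler cut z).
    move=> d0 dr; have dr0 : 0 < d / r by rewrite divr_gt0.
    have dr1 : d / r <= 1 by rewrite ler_pdivrMr// mul1r.
    have [tls tlA] := dilate_test_bound 0 phis dr0 dr1 phiB.
    have -> : (fun z => phi ((p + d * z - p) / r) * euler cut z) =
      fun z => phi (0 + d / r * z) * euler cut z.
      by apply/funext => z; congr (phi _ * _); field.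
    exact (norm_bound_mul tls (test_smooth euler_cut_test) tlA kA).
  have [l Hl lH] := HE _ _ r (tr r r0) r0 (ltW r1) HB.
  rewrite (right_lim_uniq (H _ (tr r r0)) Hl) expr1.
  have := lH r r0 (lexx r); have := HL r r0 (ltW r1); rewrite expr1 mulrDl.
  have := lerB_dist l (g (fun y => phi ((y - p) / r) * cut ((y - p) / r))).
  rewrite [X in _ <= X -> _]distrC; lra.
Qed.

End Restriction.

(** * Primitives of compactly supported tame distributions and their point values *)

Section Primitive.
Variable R : realType.
Implicit Types (f k phi psi theta : R -> R) (a b p r t x y z c d e h s l A B M C L D : R).
Implicit Types (g gp u v U : schwartz_distribution R).
Notation mu := (@lebesgue_measure R).

Lemma supported_inP a b u psi rho : supported_in a b u -> test_function psi -> 0 < rho ->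
  (forall y, a - rho < y < b + rho -> psi y = 0) -> u psi = 0.
Proof.
move=> us tpsi rho0 psi0; apply: us => //.
apply/seteqP; split=> // x [/= xc]; rewrite in_itv/= => /andP[ax xb].
have [|y /= [/eqP yp]] := xc (ball x rho); first exact: nbhsx_ballx.
rewrite /ball/= ltr_norml => /andP[? ?]; apply: yp; apply: psi0.
by apply/andP; split; lra.
Qed.

(** On [[a, b]] itself [psi] vanishes, so the neighbourhoods of the two endpoints determine
    [rho]. *)
Lemma supported_in_zero psi a b : a <= b -> test_function psi ->
  closure [set x | psi x != 0] `&` `[a, b] = set0 ->
  exists2 rho, 0 < rho & forall y, a - rho < y < b + rho -> psi y = 0.
Proof.
move=> ab tpsi disj.
have loc x : a <= x <= b -> exists2 r, 0 < r & forall y, `|y - x| < r -> psi y = 0.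
  move=> xab; have : ~ closure [set x | psi x != 0] x.
    by move=> xc; have : (set0 : set R) x by rewrite -disj; split=> //; rewrite /= in_itv.
  apply: contra_notP => H A /nbhs_ballP[r /= r0 rA].
  apply: contrapT => H'; apply: H; exists r => // y yx.
  apply/eqP/negPn/negP => py; apply: H'; exists y; split=> //; apply: rA.
  by rewrite /ball/= distrC.
have [r1 r10 H1] := loc a (introT andP (conj (lexx a) ab)).
have [r2 r20 H2] := loc b (introT andP (conj ab (lexx b))).
exists (Num.min r1 r2); first by rewrite lt_min r10.
move=> y /andP[y1 y2]; have m1 : Num.min r1 r2 <= r1 by rewrite ge_min lexx.
have m2 : Num.min r1 r2 <= r2 by rewrite ge_min lexx orbT.
have [ya|ay] := ltP y a; first by apply: H1; rewrite ltr_norml; apply/andP; split; lra.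
have [by'|yb] := ltP b y; first by apply: H2; rewrite ltr_norml; apply/andP; split; lra.
by have [r r0] := loc y (introT andP (conj ay yb)); apply; rewrite subrr normr0.
Qed.

Definition cutoff_at a b : R -> R := fun y => sstep (2 + y - a) * sstep (2 + b - y).

Lemma cutoff_at_smooth a b : smooth (cutoff_at a b).
Proof.
have H1 := smooth_affine (c := 1) (p := 2 - a) (@sstep_smooth R).
have H2 := smooth_affine (c := -1) (p := 2 + b) (@sstep_smooth R).
have := smooth_mul H1 H2; congr smooth; apply/funext => y; rewrite /cutoff_at.
by congr (sstep _ * sstep _); ring.
Qed.

Lemma cutoff_at_eq1 a b y : a - 1 <= y <= b + 1 -> cutoff_at a b y = 1.
Proof. by move=> /andP[? ?]; rewrite /cutoff_at !sstep_eq1 ?mulr1//; lra. Qed.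

Lemma cutoff_at_ge0 a b y : 0 <= cutoff_at a b y.
Proof. by apply: mulr_ge0; exact: sstep_ge0. Qed.

Lemma cutoff_at_test a b : test_function (cutoff_at a b).
Proof.
split; first exact: cutoff_at_smooth.
exists (`|a| + `|b| + 2) => x; rewrite ltr_normr => /orP[H|H].
  rewrite /cutoff_at [sstep (2 + b - x)]sstep_eq0 ?mulr0//.
  by have := ler_norm b; have : 0 <= `|a| by []; lra.
rewrite /cutoff_at sstep_eq0 ?mul0r//.
by have := ler_norm (- a); rewrite normrN; have : 0 <= `|b| by []; lra.
Qed.

Lemma cutoff_at_cutoff a b : is_cutoff a b (cutoff_at a b).
Proof.
by split; [exact: cutoff_at_test|exists 1 => // x; exact: cutoff_at_eq1].
Qed.

Lemma supported_mul_cutoff a b u theta psi : supported_in a b u -> is_cutoff a b theta ->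
  test_function psi -> u (fun y => theta y * psi y) = u psi.
Proof.
move=> us [tt [e e0 te]] tpsi; apply/eqP; rewrite -subr_eq0; apply/eqP.
have ttp := test_mulr (test_smooth tt) tpsi.
rewrite -(dist_sub u ttp tpsi); apply: (supported_inP us (test_sub ttp tpsi) e0).
move=> y /andP[? ?]; rewrite te ?mul1r ?subrr//.
by apply/andP; split; lra.
Qed.

(** [upper phi] is constant but not zero on the far left; [theta] turns it into a test function, and
    the support of [u] makes this change harmless. *)
Lemma primitive_dist a b u theta : a <= b -> supported_in a b u -> is_cutoff a b theta ->
  exists U, is_derivative_of u U /\
    forall phi, test_function phi -> U phi = u (fun y => theta y * upper phi y) :> R.
Proof.
move=> ab us ct; have tt := ct.1.
pose G phi := u (fun y => theta y * upper phi y).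
have tup phi : test_function phi -> test_function (fun y => theta y * upper phi y).
  by move=> tphi; exact (test_mul tt (upper_smooth tphi)).
have lin c phi psi : test_function phi -> test_function psi ->
    G (fun x => c * phi x + psi x) = c * G phi + G psi.
  move=> tphi tpsi; rewrite /G upper_lin//.
  rewrite -(dist_lin u c (tup phi tphi) (tup psi tpsi)).
  by congr (dist_app u); apply/funext => y; ring.
have [ts [Mt Mt0 tM]] := (test_functionP theta).1 tt.
have [N [C [C0 HC]]] := dist_bound u Mt.
have [A tA] := test_norm_bound N tt; have A0 := norm_bound_ge0 tA.
have cont M : exists (N : nat) C, forall phi, test_function phi ->
    (forall x, M < `|x| -> phi x = 0) -> forall B,
    (forall (k : nat) x, (k <= N)%N -> `|derive1n k phi x| <= B) ->
    `|G phi| <= C * B.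
  pose K := Mt + `|M| + 2.
  exists N, (C * (2 ^+ N * A * K)) => phi tphi phiM B phiB.
  have B0 : 0 <= B by exact: norm_bound_ge0 phiB.
  have K1 : 1 <= K by rewrite /K; have : 0 <= `|M| by []; lra.
  have K0 : 0 <= K by exact: le_trans K1.
  rewrite -mulrA; apply: HC; first exact: tup.
    by move=> y yM; rewrite tM// mul0r.
  move=> m y mN; have [yM|yM] := leP `|y| Mt; last first.
    have pM : ball_supported Mt (fun y => theta y * upper phi y).
      by move=> w wM; rewrite tM// mul0r.
    rewrite (derive1n_ball_supported m (smooth_mul ts (upper_smooth tphi)) pM yM) normr0.
    by rewrite !mulr_ge0// exprn_ge0.
  have j1 : jet_bound N A 1 theta y by move/norm_bound_jet: tA.
  have j2 : jet_bound N (K * B) 1 (upper phi) y.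
    move=> [|j] jN; rewrite expr1n mulr1 ?derive1n0.
      have <- : upper phi y - upper phi (`|M| + 1) = upper phi y.
        have Mlt : M < `|M| + 1 by rewrite (le_lt_trans (ler_norm M))// ltrDl.
        by rewrite (upper_eq0 tphi phiM Mlt) subr0.
      apply: (@le_trans _ _ (B * `|y - (`|M| + 1)|)).
        apply: (@mvt_norm_le _ _ (fun y => - phi y)).
          by move=> w _; exact: upper_derive.
        by move=> w _; rewrite normrN; have := phiB 0%N w isT.
      rewrite mulrC ler_wpM2r// (le_trans (ler_normB _ _))//.
      by rewrite (@ger0_norm _ (`|M| + 1)) ?addr_ge0// /K; lra.
    rewrite (upper_jet j tphi).2 normrN -[X in X <= _]mul1r ler_pM//.
    by apply: phiB; exact: ltnW.
  have := jet_bound_mul ts (upper_smooth tphi) ler01 j1 j2 mN.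
  by rewrite expr1n mulr1 -!mulrA.
exists (SchwartzDistribution lin cont); split=> // phi tphi.
rewrite /= /G upper_derive1//.
have -> : (fun y => theta y * - phi y) = fun y => - (theta y * phi y).
  by apply/funext => y; rewrite mulrN.
rewrite (dist_opp u (test_mul tt (test_smooth tphi))) opprK.
by rewrite (supported_mul_cutoff us ct tphi).
Qed.

Lemma rescaled_pos g x t phi : 0 < t ->
  rescaled g x t phi = t^-1 * g (fun y => phi ((y - x) / t)).
Proof. by move=> t0; rewrite /rescaled gtr0_norm. Qed.

Lemma rescaled_neg g x t phi : rescaled g x (- t) phi = rescaled g x t (fun y => phi (- y)).
Proof.
rewrite /rescaled normrN; congr (_ * dist_app g _); apply/funext => y.
by rewrite invrN mulrN.
Qed.

Lemma test_reflect phi : test_function phi -> test_function (fun y => phi (- y)).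
Proof.
move=> tphi; have := test_dilate 0 (_ : -1 != 0) tphi; rewrite oppr_eq0 oner_neq0 => /(_ isT).
by under eq_fun do rewrite subr0 invrN1 mulrN1.
Qed.

(** A dilation by a negative factor is one by a positive factor of the reflected test function,
    which has the same integral. *)
Lemma has_point_value_right g x l :
  (forall phi, test_function phi ->
    rescaled g x e phi @[e --> 0^'+] --> l * \int[mu]_y phi y) ->
  has_point_value g x l.
Proof.
move=> H phi tphi; apply/punctured_limP => e e0.
have [r1 r10 H1] := (right_limP _ _).1 (H phi tphi) e e0.
have [r2 r20 H2] := (right_limP _ _).1 (H _ (test_reflect tphi)) e e0.
exists (Num.min r1 r2); first by rewrite lt_min r10.
move=> t t0; rewrite lt_min => /andP[tr1 tr2].
have [tn|tp|/eqP] := ltgtP t 0; last by rewrite (negbTE t0).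
  rewrite -[t]opprK rescaled_neg -(integral_reflect tphi).
  by rewrite ltr0_norm// in tr2; apply: H2 => //; rewrite oppr_gt0.
by rewrite gtr0_norm// in tr1; apply: H1.
Qed.

Lemma point_value_right g x l phi : has_point_value g x l -> test_function phi ->
  rescaled g x e phi @[e --> 0^'+] --> l * \int[mu]_y phi y.
Proof.
move=> H tphi; apply/right_limP => e e0.
have [r r0 rH] := (punctured_limP _ _).1 (H phi tphi) e e0.
exists r => // t t0 tr; apply: rH; first by rewrite gt_eqF.
by rewrite gtr0_norm.
Qed.

(** As a derivative of the smooth step it has integral 1, support in [[0, 1]] and an explicit
    primitive; the one-sided support will tell left from right. *)
Definition unit_bump : R -> R := derive1 (@sstep R).

Lemma unit_bump_zero y : (y < 0) || (1 < y) -> unit_bump y = 0.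
Proof.
move=> /orP[y0|y1]; rewrite /unit_bump -derive1n1.
  have r0 : 0 < - y by rewrite oppr_gt0.
  rewrite (derive1n_near_cst (c := 0) 1 r0 (@sstep_smooth R))// => w.
  by rewrite ltr_norml => /andP[_ ?]; rewrite sstep_eq0//; lra.
have r0 : 0 < y - 1 by rewrite subr_gt0.
rewrite (derive1n_near_cst (c := 1) 1 r0 (@sstep_smooth R))// => w.
by rewrite ltr_norml => /andP[? _]; rewrite sstep_eq1//; lra.
Qed.

Lemma unit_bump_ball : ball_supported 2 unit_bump.
Proof.
move=> y; rewrite ltr_normr => /orP[H|H]; rewrite unit_bump_zero//.
  by apply/orP; right; lra.
by apply/orP; left; lra.
Qed.

Lemma unit_bump_test : test_function unit_bump.
Proof.
by split; [exact: smooth_derive1 (@sstep_smooth R)|exists 2; exact: unit_bump_ball].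
Qed.

Lemma unit_bump_derive x : is_derive x 1 (@sstep R) (unit_bump x).
Proof. exact: smooth_is_derive0 (@sstep_smooth R). Qed.

Lemma unit_bump_integral : \int[mu]_y unit_bump y = 1.
Proof.
have two0 : 0 < 2 :> R by [].
rewrite (integral_test unit_bump_test unit_bump_derive two0 unit_bump_ball).
rewrite sstep_eq1 ?ler1n// sstep_eq0 ?subr0//; lra.
Qed.

Lemma primitive_exists a b u : a <= b -> supported_in a b u -> tame_all u ->
  exists U, [/\ is_derivative_of u U, lojasiewicz_distribution U & has_point_value U a 0].
Proof.
move=> ab us ut; pose theta := cutoff_at a b.
have ct : is_cutoff a b theta := cutoff_at_cutoff a b; have tt := ct.1.
have [U [uU UE]] := primitive_dist ab us ct.
have tsc phi x t : 0 < t -> test_function phi -> test_function (fun y => phi ((y - x) / t)).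
  by move=> t0 tphi; apply: test_dilate => //; rewrite gt_eqF.
have RE x t phi : 0 < t -> test_function phi ->
    rescaled U x t phi = u (fun y => theta y * upper phi ((y - x) / t)).
  move=> t0 tphi; rewrite rescaled_pos// UE; last exact: tsc.
  rewrite upper_dilate//.
  have tq : test_function (fun y => theta y * upper phi ((y - x) / t)).
    exact (test_mul tt (smooth_dilate (p := x) (t := t) (upper_smooth tphi))).
  have -> : (fun y => theta y * (t * upper phi ((y - x) / t))) =
      fun y => t * (theta y * upper phi ((y - x) / t)).
    by apply/funext => y; rewrite mulrCA.
  by rewrite (dist_scal u t tq) mulrA mulVf ?mul1r// gt_eqF.
(* [euler (upper phi)] equals [- x phi(x)], of compact support although [upper phi] is not. Hence
   [rescaled U x t phi] has a bounded derivative in [t] and a limit at 0. *)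
have eul phi : test_function phi -> test_function (euler (upper phi)).
  move=> tphi; have [phis [M M0 phiM]] := (test_functionP phi).1 tphi.
  split; first exact: euler_smooth (upper_smooth tphi).
  exists M => y yM; rewrite /euler derive1E; case: (upper_derive y tphi) => _ ->.
  by rewrite phiM// oppr0 mulr0.
have tamed x psi : test_function psi -> exists2 L, 0 <= L & forall r, 0 < r -> r <= 1 ->
    `|u (fun y => theta y * psi ((y - x) / r))| <= L * r.
  move=> tpsi; have [_ [M M0 psiM]] := (test_functionP psi).1 tpsi.
  have [N [C [C0 HC]]] := tame_theta M (ut x) tt.
  have [B psiB] := test_norm_bound N tpsi.
  exists (C * B) => [|r r0 r1]; first by rewrite mulr_ge0// (norm_bound_ge0 psiB).
  by have := HC r psi B r0 r1 tpsi psiM psiB; rewrite expr1.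
have lim x phi : test_function phi -> exists l, rescaled U x e phi @[e --> 0^'+] --> l.
  move=> tphi; have [L L0 HL] := tamed x _ (eul phi tphi).
  have H1 t : 0 < t -> t <= 1 -> is_derive t 1
      (fun t => u (fun y => theta y * upper phi ((y - x) / t)))
      (- t^-1 * u (fun y => theta y * euler (upper phi) ((y - x) / t))).
    by move=> t0 _; exact: (dist_derive_dilate u x t0 tt (upper_smooth tphi)).
  have H2 t : 0 < t -> t <= 1 ->
      `|- t^-1 * u (fun y => theta y * euler (upper phi) ((y - x) / t))| <= L.
    move=> t0 t1; rewrite normrM normrN normfV (gtr0_norm t0) mulrC ler_pdivrMr//.
    exact: HL.
  have [l Hl _] := limit_of_bounded_derivative ltr01 L0 H1 H2.
  exists l; apply/right_limP => e e0; have [r r0 rH] := (right_limP _ _).1 Hl e e0.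
  by exists r => // t t0 tr; rewrite RE//; exact: rH.
have PV x : exists2 gam, has_point_value U x gam &
    rescaled U x e unit_bump @[e --> 0^'+] --> gam.
  have [gam Hgam] := lim x unit_bump unit_bump_test.
  exists gam => //; apply: has_point_value_right => phi tphi.
  set I := \int[mu]_y phi y.
  (* Subtracting the right multiple of [unit_bump] leaves integral zero, so [upper] becomes a test
     function and tameness makes its contribution [O(t)]. The limit for [phi] is thus its integral
     times the limit for [unit_bump]. *)
  have tpsi : test_function (fun y => - I * unit_bump y + phi y).
    exact: test_lin unit_bump_test tphi.
  have tup : test_function (upper (fun y => - I * unit_bump y + phi y)).
    have [_ [M M0 phiM]] := (test_functionP phi).1 tphi.
    split; first exact: upper_smooth.
    exists (Num.max M 2) => y; rewrite gt_max => /andP[]; rewrite !ltr_normr.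
    rewrite upper_lin//; last exact: unit_bump_test.
    have [y0|y0] := ltP 0 y.
      move=> My y2; rewrite (upper_eq0 unit_bump_test unit_bump_ball) ?(upper_eq0 tphi phiM).
      - by rewrite mulr0 addr0.
      - by case/orP: My => //; lra.
      - by case/orP: y2 => //; lra.
    move=> My y2; rewrite (upper_eq_integral unit_bump_ball) ?(upper_eq_integral phiM).
    - by rewrite unit_bump_integral mulr1 addNr.
    - by case/orP: My; lra.
    - by case/orP: y2; lra.
  have [L L0 HL] := tamed x _ tup.
  apply/right_limP => e e0.
  have I0 : 0 < `|I| + 1 by rewrite ltr_wpDl.
  have e2 : 0 < e / 2 / (`|I| + 1) by rewrite !divr_gt0.
  have [r r0 rH] := (right_limP _ _).1 Hgam _ e2.
  have L10 : 0 < L + 1 by rewrite ltr_wpDl.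
  exists (Num.min r (Num.min 1 (e / 2 / (L + 1)))); first by rewrite !lt_min r0 ltr01 !divr_gt0.
  move=> t t0; rewrite !lt_min => /andP[tr /andP[t1]]; rewrite ltr_pdivlMr// => te.
  have := HL t t0 (ltW t1).
  have -> : (fun y => theta y * upper (fun y => - I * unit_bump y + phi y) ((y - x) / t)) =
     fun y => - I * (theta y * upper unit_bump ((y - x) / t)) + theta y * upper phi ((y - x) / t).
    apply/funext => y; rewrite upper_lin//; [ring|exact: unit_bump_test].
  have q1 := test_mul tt (smooth_dilate (p := x) (t := t) (upper_smooth unit_bump_test)).
  have q2 := test_mul tt (smooth_dilate (p := x) (t := t) (upper_smooth tphi)).
  rewrite (dist_lin u (- I) q1 q2) -RE//; last exact: unit_bump_test.
  rewrite -RE// => h1; have := rH t t0 tr; rewrite ler_pdivlMr// => h2.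
  have -> : rescaled U x t phi - gam * I =
    (- I * rescaled U x t unit_bump + rescaled U x t phi) + I * (rescaled U x t unit_bump - gam) by ring.
  rewrite (le_trans (ler_normD _ _))// (splitr e) lerD//.
    by rewrite (le_trans h1)//; lra.
  rewrite normrM; have : 0 <= `|rescaled U x t unit_bump - gam| by [].
  by lra.
exists U; split=> //; first by move=> x; have [gam H _] := PV x; exists gam.
have [gam Hgam _] := PV a.
(* A bump supported in [[-2, -1]]: its dilations at [a] lie to the left of [a - t], where [U]
   vanishes, so the point value at [a] is 0. *)
pose psi y := unit_bump (y + 2).
have psiE : psi = fun y => unit_bump ((y - (-2)) / 1) by apply/funext => y; rewrite divr1 opprK.
have tpsi : test_function psi.
  by rewrite psiE; apply: test_dilate unit_bump_test; rewrite oner_neq0.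
have Ipsi : \int[mu]_y psi y = 1.
  by rewrite psiE (integral_dilate _ ltr01 unit_bump_test) unit_bump_integral mulr1.
suff -> : 0 = gam by [].
have := point_value_right Hgam tpsi; rewrite Ipsi mulr1; apply: right_lim_uniq.
apply/right_limP => e e0; exists 1 => // t t0 _; rewrite RE//.
have up0 z : -1 < z -> upper psi z = 0.
  move=> z1; rewrite psiE (upper_dilate (-2) ltr01 unit_bump_test).
  rewrite mul1r divr1 opprK.
  have -> : upper unit_bump = fun z => 1 - sstep z.
    apply: (upper_uniq (M := 1)); first exact: unit_bump_test.
      move=> x; apply: (is_derive_eq (is_derive_sub (is_derive_cstl x 1) (unit_bump_derive x))).
      by rewrite sub0r.
    by move=> x x1; rewrite sstep_eq1 ?subrr// ltW.
  by rewrite sstep_eq1 ?subrr//; lra.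
have q := test_mul tt (smooth_dilate (p := a) (t := t) (upper_smooth tpsi)).
have q0 y : a - t < y < b + t -> theta y * upper psi ((y - a) / t) = 0.
  move=> /andP[ay _]; rewrite up0 ?mulr0//.
  by rewrite ltr_pdivlMr//; lra.
by rewrite (supported_inP us q t0 q0) subrr normr0 ltW.
Qed.

End Primitive.

Opaque flat sstep plateau cut unit_bump cutoff_at.

(** * Lower and upper limits at [0+] in terms of eventual inequalities *)

Section Einf.
Variable R : realType.
Implicit Types (f : R -> R) (c e r t l : R).

Lemma limf_einf_ge f c r : 0 < r -> (forall t, 0 < t -> t < r -> c <= f t) ->
  (c%:E <= limf_einf (fun t => (f t)%:E) 0^'+)%E.
Proof.
move=> r0 H; rewrite limf_einfE.
apply: (@le_trans _ _ (ereal_inf ((fun t => (f t)%:E) @` [set t | 0 < t < r]))).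
  by apply: le_ereal_inf_tmp => _ [t /= /andP[t0 tr] <-]; rewrite lee_fin H.
apply: ereal_sup_ubound; exists [set t | 0 < t < r] => //.
exists r => //= t /=; rewrite sub0r normrN => tr t0.
by rewrite t0 -(gtr0_norm t0).
Qed.

Lemma limf_esup_le f c r : 0 < r -> (forall t, 0 < t -> t < r -> f t <= c) ->
  (limf_esup (fun t => (f t)%:E) 0^'+ <= c%:E)%E.
Proof.
move=> r0 H; rewrite -[limf_esup _ _]oppeK -limf_einfN leeNl.
rewrite -EFinN; apply: (@limf_einf_ge (fun t => - f t) _ r) => // t t0 tr.
by rewrite lerN2 H.
Qed.

Lemma limf_einf_gt f c : (c%:E < limf_einf (fun t => (f t)%:E) 0^'+)%E ->
  exists2 r, 0 < r & forall t, 0 < t -> t < r -> c <= f t.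
Proof.
rewrite limf_einfE => /ereal_sup_gt[_ [V [r /= r0 rV] <-]] cV.
exists r => // t t0 tr; rewrite -lee_fin (le_trans (ltW cV))//.
apply: ereal_inf_lbound; exists t => //; apply: rV => //=.
by rewrite sub0r normrN gtr0_norm.
Qed.

Lemma limf_esup_lt f c : (limf_esup (fun t => (f t)%:E) 0^'+ < c%:E)%E ->
  exists2 r, 0 < r & forall t, 0 < t -> t < r -> f t <= c.
Proof.
rewrite -[limf_esup _ _]oppeK -limf_einfN lteNl -EFinN => /limf_einf_gt[r r0 rH].
by exists r => // t t0 tr; rewrite -lerN2 rH.
Qed.

Lemma right_lim_einf f l : f t @[t --> 0^'+] --> l ->
  (l%:E <= limf_einf (fun t => (f t)%:E) 0^'+)%E /\
  (limf_esup (fun t => (f t)%:E) 0^'+ <= l%:E)%E.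
Proof.
move=> /right_limP H; split.
  apply/lee_addgt0Pr => e e0; have [r r0 rH] := H e e0.
  rewrite -leeBlDr// -EFinB; apply: (limf_einf_ge r0) => t t0 tr.
  by have := rH t t0 tr; rewrite ler_norml => /andP[? _]; lra.
apply/lee_addgt0Pr => e e0; have [r r0 rH] := H e e0.
rewrite -EFinD; apply: (limf_esup_le r0) => t t0 tr.
by have := rH t t0 tr; rewrite ler_norml => /andP[_ ?]; lra.
Qed.

End Einf.

(** * Countability of the jump set *)

Section JumpSet.
Variable R : realType.
Implicit Types (phi psi : R -> R) (x y z c d e r t l : R).
Implicit Types (g : schwartz_distribution R).
Notation mu := (@lebesgue_measure R).

(** Since [unit_bump] lives on [[0, 1]], its dilations at [x] see only the right side, and those at
    [x - e] only the left side. Both lateral limits thus become limits of one function of two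
    variables along two rays. *)
Lemma lateral_limits_shift g x lm lp : has_lateral_limits g x lm lp ->
  rescaled g x e (@unit_bump R) @[e --> 0^'+] --> lp /\
  rescaled g (x - e) e (@unit_bump R) @[e --> 0^'+] --> lm.
Proof.
move=> H; have two0 : 0 < 2 :> R by [].
split.
  have := H _ (@unit_bump_test R).
  rewrite (integral_test_neg (@unit_bump_test R) (@unit_bump_derive R) two0 (@unit_bump_ball R)).
  rewrite (integral_test_pos (@unit_bump_test R) (@unit_bump_derive R) two0 (@unit_bump_ball R)).
  rewrite !(@sstep_eq0 R 0)// (@sstep_eq0 R (-2)) ?oppr_le0// sstep_eq1 ?ler1n//.
  by rewrite !subr0 mulr0 mulr1 add0r.
pose psi y := unit_bump (y + 1).
have psiE : psi = fun y => unit_bump ((y - (-1)) / 1) by apply/funext => y; rewrite divr1 opprK.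
have tpsi : test_function psi.
  by rewrite psiE; apply: test_dilate (@unit_bump_test R); rewrite oner_neq0.
have dpsi x' : is_derive x' 1 (fun y => sstep (y + 1)) (psi x').
  have aff := is_derive_affine 1 1 x'.
  apply: (@is_derive_near _ (fun y => sstep (1 * y + 1)) _ _ _ 1 ltr01).
    by move=> y _; rewrite mul1r.
  apply: (is_derive_eq (is_derive_chain (g := fun y => 1 * y + 1) (unit_bump_derive _) aff)).
  by rewrite mulr1 mul1r.
have psiM : ball_supported 2 psi.
  move=> y; rewrite ltr_normr => yM; apply: unit_bump_zero.
  by case/orP: yM => h; apply/orP; [right|left]; lra.
have := H _ tpsi.
rewrite (integral_test_neg tpsi dpsi two0 psiM) (integral_test_pos tpsi dpsi two0 psiM).
rewrite add0r !(@sstep_eq1 R 1)// [sstep (-2 + 1)]sstep_eq0; last by lra.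
rewrite [sstep (2 + 1)]sstep_eq1; last by lra.
rewrite subrr subr0 mulr0 mulr1 addr0 => Hl.
apply/right_limP => e e0; have [r r0 rH] := (right_limP _ _).1 Hl e e0.
exists r; first exact: r0.
move=> t t0 tr; have := rH t t0 tr; rewrite /rescaled (gtr0_norm t0).
have -> // : (fun y => psi ((y - x) / t)) = fun y => unit_bump ((y - (x - t)) / t).
by apply/funext => y; rewrite /psi; congr unit_bump; field; rewrite gt_eqF.
Qed.

(* Bagemihl's theorem on ambiguous points: in the (x, t)-half-plane, the
   vertical ray from x1 meets the oblique ray {(x2 - t, t)} from x2 > x1, so
   two jumps of the same type at the same scale cannot be close. *)
Lemma ambiguous_points_countable (h : R -> R -> R) :
  countable [set x | exists lm lp : R, [/\ h x e @[e --> 0^'+] --> lp,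
    h (x - e) e @[e --> 0^'+] --> lm & lm != lp]].
Proof.
set J := [set x | _].
have key x : J x -> exists s : bool * rat * nat, forall t, 0 < t ->
    t < s.2.+1%:R^-1 -> if s.1.1 then ratr s.1.2 < h x t /\ h (x - t) t < ratr s.1.2
    else h x t < ratr s.1.2 /\ ratr s.1.2 < h (x - t) t.
  move=> [lm [lp [/right_limP H1 /right_limP H2 lmp]]].
  have small r r' : 0 < r -> 0 < r' -> exists n : nat, n.+1%:R^-1 < r /\ n.+1%:R^-1 < r'.
    move=> r0 r'0; have m0 : 0 < Num.min r r' by rewrite lt_min r0.
    exists (Num.bound (Num.min r r')^-1).
    suff : (Num.bound (Num.min r r')^-1).+1%:R^-1 < Num.min r r' by rewrite lt_min => /andP.
    have r10 : 0 <= (Num.min r r')^-1 by rewrite invr_ge0 ltW.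
    rewrite invf_plt ?posrE//; apply: lt_trans (archi_boundP r10) _.
    by rewrite ltr_nat.
  have [lt|gt] := ltP lm lp.
    have [q /=] := rat_in_itvoo lt; rewrite in_itv/= => /andP[q1 q2].
    have e1 : 0 < (lp - ratr q) / 2 by rewrite divr_gt0// subr_gt0.
    have e2 : 0 < (ratr q - lm) / 2 by rewrite divr_gt0// subr_gt0.
    have [r1 r10 rH1] := H1 _ e1; have [r2 r20 rH2] := H2 _ e2.
    have [n [n1 n2]] := small r1 r2 r10 r20.
    exists (true, q, n) => t t0 /= tn.
    have := rH1 t t0 (lt_trans tn n1); have := rH2 t t0 (lt_trans tn n2).
    by rewrite !ler_norml => /andP[? ?] /andP[? ?]; split; lra.
  have {}lt : lp < lm by rewrite lt_neqAle eq_sym lmp.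
  have [q /=] := rat_in_itvoo lt; rewrite in_itv/= => /andP[q1 q2].
  have e1 : 0 < (ratr q - lp) / 2 by rewrite divr_gt0// subr_gt0.
  have e2 : 0 < (lm - ratr q) / 2 by rewrite divr_gt0// subr_gt0.
  have [r1 r10 rH1] := H1 _ e1; have [r2 r20 rH2] := H2 _ e2.
  have [n [n1 n2]] := small r1 r2 r10 r20.
  exists (false, q, n) => t t0 /= tn.
  have := rH1 t t0 (lt_trans tn n1); have := rH2 t t0 (lt_trans tn n2).
  by rewrite !ler_norml => /andP[? ?] /andP[? ?]; split; lra.
have key' x : exists s : bool * rat * nat, J x -> forall t, 0 < t ->
    t < s.2.+1%:R^-1 -> if s.1.1 then ratr s.1.2 < h x t /\ h (x - t) t < ratr s.1.2
    else h x t < ratr s.1.2 /\ ratr s.1.2 < h (x - t) t.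
  have [/key[s sH]|nj] := pselect (J x); first by exists s.
  by exists (true, 0, 0%N).
have [S SH] := choice key'.
(* The code records the direction of the jump, a rational separating the two limits, a scale on
   which it separates, and the cell of that size containing [x]. Equal codes force a distance below
   the scale. *)
pose code x := (S x, Num.floor (x * (S x).2.+1%:R)).
apply/countable_injP; exists (fun x => pickle (code x)).
have wl x y : J x -> J y -> code x = code y -> y <= x.
  move=> jx jy; rewrite /code => -[Sxy]; rewrite -Sxy => fxy.
  rewrite leNgt; apply/negP => xy.
  have n0 : 0 < (S x).2.+1%:R :> R by [].
  have xyn : y - x < (S x).2.+1%:R^-1.
    rewrite -[_^-1]div1r ltr_pdivlMr// mulrBl.
    have := floor_le_tmp (x * (S x).2.+1%:R); have := floorD1_gt (y * (S x).2.+1%:R).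
    by rewrite -fxy rmorphD /= mulr1z; lra.
  have xy0 : 0 < y - x by rewrite subr_gt0.
  have := SH x jx (y - x) xy0 xyn; have := SH y jy (y - x) xy0; rewrite -Sxy => /(_ xyn).
  rewrite (_ : y - (y - x) = x); last by ring.
  by case: (S x).1.1 => -[h1 h2] [h3 h4]; [have := lt_trans h2 h3|have := lt_trans h2 h3];
    rewrite ltxx.
move=> x y; rewrite !inE => jx jy /(pcan_inj pickleK) cxy.
by apply/eqP; rewrite eq_le (wl y x)// (wl x y).
Qed.

Lemma jump_set_countable g : countable (jump_set g).
Proof.
apply: sub_countable (ambiguous_points_countable
  (fun z e => rescaled g z e (@unit_bump R))).
apply: subset_card_le => x [lm [lp [/lateral_limits_shift[H1 H2] lmp]]].
by exists lm, lp.
Qed.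

End JumpSet.

(** * Point values tested on the class [T0] *)

Section T0.
Variable R : realType.
Implicit Types (f k phi psi theta : R -> R) (a b p r t x y z c d e h s l A B M C L D : R).
Implicit Types (g u U : schwartz_distribution R).
Notation mu := (@lebesgue_measure R).

Lemma powR_sub_natr x a (m : nat) : 0 < x -> x `^ (a - m%:R) = x `^ a * x^-1 ^+ m.
Proof.
move=> x0; rewrite powRB; last by apply/implyP => _; rewrite gt_eqF.
by rewrite powR_mulrn ?ltW// exprVn.
Qed.

(** On a ball the derivatives are bounded and the weight is bounded below; outside it
    [1 + |z| <= 2 |z|] passes from one weight to the other at the cost of a power of 2. *)
Lemma symbol_of_tail phi a (N : nat) : smooth phi -> a <= 0 ->
  (forall m : nat, exists C A, forall x, A < `|x| ->
    `|derive1n m phi x| <= C * `|x| `^ (a - m%:R)) ->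
  exists B, symbol N a B phi.
Proof.
move=> phis a0 tail.
have one (m : nat) : exists2 B, 0 <= B & forall z,
    `|derive1n m phi z| <= B * (1 + `|z|) `^ a * (1 + `|z|)^-1 ^+ m.
  have [C [A HA]] := tail m; pose A' := Num.max A 1; pose w := a - m%:R.
  have w0 : w <= 0 by rewrite /w subr_le0 (le_trans a0).
  have [K K0 HK] := continuous_bounded_ball A' (smooth_continuous (smooth_derive1n (n := m) phis)).
  pose B := K / (1 + A') `^ w + `|C| * 2 `^ (- w).
  have A'1 : 1 <= A' by rewrite le_max lexx orbT.
  have A'0 : 0 < 1 + A' by lra.
  have B1 : 0 <= K / (1 + A') `^ w by rewrite divr_ge0 ?powR_ge0.
  have B2 : 0 <= `|C| * 2 `^ (- w) by rewrite mulr_ge0 ?powR_ge0.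
  exists B => [|z]; first by rewrite addr_ge0.
  have z0 : 0 < 1 + `|z| by rewrite ltr_pwDl.
  rewrite -mulrA -(powR_sub_natr a m z0) -/w.
  have pz : 0 < (1 + `|z|) `^ w by rewrite powR_gt0.
  have mono x y : 0 < x -> x <= y -> y `^ w <= x `^ w.
    move=> x0 xy; have y0 : 0 < y by exact: lt_le_trans xy.
    rewrite -(opprK w) (powRN x) (powRN y) lef_pV2 ?posrE ?powR_gt0//.
    by rewrite ge0_ler_powR ?nnegrE ?oppr_ge0 ?(ltW x0) ?(ltW y0).
  have [zA|zA] := leP `|z| A'.
    rewrite (le_trans (HK z zA))// mulrDl ler_wpDr ?mulr_ge0// ?(ltW pz)//.
    rewrite mulrAC ler_pdivlMr ?powR_gt0// ler_wpM2l// mono//.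
    by rewrite lerD2l.
  have zA1 : A < `|z| by rewrite (le_lt_trans _ zA)// le_max lexx.
  have z1 : 1 < `|z| by exact: le_lt_trans zA.
  rewrite (le_trans (HA z zA1))// /B mulrDl.
  apply: ler_wpDl; first by rewrite mulr_ge0// (ltW pz).
  rewrite -[X in _ <= X]mulrA (@le_trans _ _ (`|C| * `|z| `^ w))//.
    by rewrite ler_wpM2r ?powR_ge0// ler_norm.
  rewrite ler_wpM2l// powRN -ler_pdivrMl ?invr_gt0 ?powR_gt0// invrK.
  rewrite -powRM//; apply: mono; lra.
elim: N => [|N [B HB]].
  have [B B0 H] := one 0%N; exists B => z m; rewrite leqn0 => /eqP ->; exact: H.
have B0 := symbol_ge0 HB; have [B' B'0 H] := one N.+1.
exists (B + B') => z m; rewrite leq_eqVlt => /orP[/eqP->|mN].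
  apply: le_trans (H z) _; rewrite ler_wpM2r ?exprn_ge0 ?invr_ge0 ?addr_ge0//.
  by rewrite ler_wpM2r ?powR_ge0// lerDr.
apply: le_trans (HB z m mN) _; rewrite ler_wpM2r ?exprn_ge0 ?invr_ge0 ?addr_ge0//.
by rewrite ler_wpM2r ?powR_ge0// lerDl.
Qed.

Lemma tame_T0_bounded u x theta phi : tame 1 u x -> test_function theta -> T0 phi ->
  exists L, forall t, 0 < t -> t <= 1 ->
    `|t^-1 * u (fun y => theta y * phi ((y - x) / t))| <= L.
Proof.
move=> ut tt [phis _ _ [a a1 tail]].
have a11 : a + 1%:R < 0 by rewrite (_ : 1%:R = 1 :> R)//; lra.
have [N [C [C0 H]]] := tame_symbol ut tt a11.
have a0 : a <= 0 by lra.
have [B phiB] := symbol_of_tail N phis a0 tail.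
exists (C * B) => t t0 t1; rewrite normrM normfV (gtr0_norm t0) mulrC ler_pdivrMr//.
by have := H t phi B t0 t1 phis phiB; rewrite expr1.
Qed.

(** Uniformity in [r]: the derivatives of [plateau (z / r)] live in [|z| <= 2 r], where
    [1 + |z| <= 3 r], so each factor [r^-1] is at most [3 / (1 + |z|)]. *)
Lemma symbol_1plateau (N : nat) : exists2 A, 0 <= A & forall r, 1 <= r ->
  symbol N 0 A (fun z : R => 1 - plateau (z / r)).
Proof.
have [A bA] := test_norm_bound N (@plateau_test R).
have A0 := norm_bound_ge0 bA.
exists ((1 + A) * 3 ^+ N) => [|r r1 z m mN]; first by rewrite mulr_ge0 ?exprn_ge0// addr_ge0.
have r0 : 0 < r by exact: lt_le_trans r1.
have z0 : 0 < 1 + `|z| by rewrite ltr_pwDl.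
rewrite powRr0 mulr1.
have ps : smooth (fun z : R => plateau ((z - 0) / r)) := smooth_dilate (p := 0) (t := r) (@plateau_smooth R).
have E : (fun z : R => 1 - plateau (z / r)) = fun z => 1 - plateau ((z - 0) / r).
  by apply/funext => w; rewrite subr0.
rewrite E (derive1n_sub m (smooth_cst (c := 1)) ps).
case: m mN => [|m] mN.
  rewrite !derive1n0 expr0 mulr1; apply: (@le_trans _ _ 1).
    by rewrite ger0_norm ?subr_ge0 ?plateau_le1// gerBl plateau_ge0.
  have h1 : 1 <= 1 + A by rewrite lerDl.
  have h2 : 1 <= 3 ^+ N :> R by rewrite exprn_ege1// ler1n.
  by rewrite -[X in X <= _]mulr1; apply: ler_pM.
rewrite derive1n_cst sub0r normrN.
have [zr|zr] := leP `|z| (2 * r); last first.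
  have rM : ball_supported (2 * r) (fun z : R => plateau ((z - 0) / r)).
    move=> w wr; rewrite plateau_eq0// subr0 normrM normfV (gtr0_norm r0).
    by rewrite ler_pdivlMr// ltW.
  rewrite (derive1n_ball_supported m.+1 ps rM zr) normr0.
  by rewrite !mulr_ge0 ?exprn_ge0 ?invr_ge0 ?(ltW z0)// addr_ge0.
rewrite (derive1n_dilate 0 r m.+1 (@plateau_smooth R)) normrM.
rewrite ger0_norm ?exprn_ge0 ?invr_ge0 ?(ltW r0)// mulrC -mulrA.
apply: ler_pM; rewrite ?exprn_ge0 ?invr_ge0 ?(ltW r0)//.
  by rewrite (le_trans (bA m.+1 _ mN))// lerDr.
apply: (@le_trans _ _ (3 ^+ m.+1 * (1 + `|z|)^-1 ^+ m.+1)).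
  rewrite -exprMn lerXn2r ?nnegrE ?mulr_ge0 ?invr_ge0 ?(ltW r0) ?(ltW z0)//.
  rewrite ler_pdivlMr// mulrC ler_pdivrMr//; lra.
by rewrite ler_wpM2r ?exprn_ge0 ?invr_ge0 ?(ltW z0)// ler_weXn2l// ler1n.
Qed.

(** The function lives in [|z| >= r], where weakening the order from [a] to [b] gains a factor that
    tends to 0 as [r] grows. This buys an arbitrarily small constant. *)
Lemma symbol_tail_small (N : nat) a b phi B : smooth phi -> a < b -> b <= 0 ->
  symbol N a B phi -> forall e, 0 < e ->
  exists2 r0, 0 < r0 & forall r, r0 <= r ->
    symbol N b e (fun z => phi z * (1 - plateau (z / r))).
Proof.
move=> phis ab b0 phiB e e0; have B0 := symbol_ge0 phiB.
have [A A0 HA] := symbol_1plateau N.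
set K := 2 ^+ N * B * A; have K0 : 0 <= K by rewrite !mulr_ge0// exprn_ge0.
pose w := b - a; have w0 : 0 < w by rewrite subr_gt0.
pose r1 := ((K + 1) / e) `^ w^-1.
have q0 : 0 < (K + 1) / e by rewrite divr_gt0// ltr_wpDl.
have r10 : 0 < r1 by rewrite powR_gt0.
have r1w : r1 `^ w = (K + 1) / e.
  by rewrite -powRrM mulVf ?gt_eqF// powRr1// ltW.
exists (Num.max r1 1); first by rewrite lt_max r10.
move=> r; rewrite ge_max => /andP[rr1 r1'] z m mN.
have rp : 0 < r by exact: lt_le_trans r1'.
have ps : smooth (fun z : R => 1 - plateau (z / r)).
  have := smooth_sub (@smooth_cst R 1) (smooth_dilate (p := 0) (t := r) (@plateau_smooth R)).
  by under eq_fun do rewrite subr0.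
have pps := smooth_mul phis ps.
have z0 : 0 < 1 + `|z| by rewrite ltr_pwDl.
have [zr|zr] := ltP `|z| r.
  have d0 : 0 < r - `|z| by rewrite subr_gt0.
  have nz y : `|y - z| < r - `|z| -> phi y * (1 - plateau (y / r)) = 0.
    move=> yz; rewrite plateau_eq1 ?subrr ?mulr0//.
    rewrite normrM normfV (gtr0_norm rp) ler_pdivrMr// mul1r.
    by have := lerB_dist y z; lra.
  rewrite (derive1n_near_cst m d0 pps nz).
  have -> : (if m is 0 then 0 else 0) = 0 :> R by case: (m).
  by rewrite normr0 !mulr_ge0 ?powR_ge0 ?exprn_ge0 ?invr_ge0 ?(ltW z0) ?(ltW e0).
have := symbol_mul phis ps phiB (HA r r1') z mN; rewrite addr0 -/K.
move/le_trans; apply; rewrite ler_wpM2r ?exprn_ge0 ?invr_ge0 ?(ltW z0)//.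
have -> : (1 + `|z|) `^ b = (1 + `|z|) `^ a * (1 + `|z|) `^ w.
  rewrite -powRD; last by apply/implyP => _; rewrite gt_eqF.
  by congr (_ `^ _); rewrite /w; ring.
rewrite mulrCA [X in X <= _]mulrC ler_wpM2l ?powR_ge0//.
have : K + 1 <= e * (1 + `|z|) `^ w.
  rewrite mulrC -ler_pdivrMr// -r1w ge0_ler_powR ?nnegrE ?(ltW w0) ?(ltW r10) ?(ltW z0)//.
  by rewrite (le_trans rr1)// (le_trans zr)// lerDr.
lra.
Qed.

(** [fine] sends an infinite integral to 0, so the value 1 forces the extended integral to be
    finite. *)
Lemma T0_integrable phi : T0 phi -> mu.-integrable setT (EFin \o phi).
Proof.
move=> [phis phi0 phi1 _].
have mphi : measurable_fun setT phi.
  by apply: continuous_measurable_fun; exact: smooth_continuous.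
apply/integrableP; split; first exact/measurable_EFinP.
have -> : (\int[mu]_x `|(EFin \o phi) x| = \int[mu]_x (phi x)%:E)%E.
  by apply: eq_integral => x _; rewrite /= ger0_norm.
have ige : (0 <= \int[mu]_x (phi x)%:E)%E.
  by apply: integral_ge0 => x _; rewrite lee_fin.
move: phi1 ige; rewrite /Rintegral.
case: (\int[mu]_x (phi x)%:E)%E => [r| |] //=; first by rewrite ltry.
by move=> /esym/eqP; rewrite oner_eq0.
Qed.

Lemma T0_plateau_integral phi : T0 phi -> forall e r0, 0 < e ->
  exists2 r, r0 <= r & 0 < r /\ `|(\int[mu]_z (phi z * plateau (z / r))) - 1| <= e.
Proof.
move=> T0phi e r0 e0; have [phis phi0 phi1 _] := T0phi.
have iphi := T0_integrable T0phi.
pose F (n : nat) z := (phi z * plateau (z / n.+1%:R))%:E.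
have pls (n : nat) : smooth (fun z => phi z * plateau (z / n.+1%:R)).
  have := smooth_mul phis (smooth_dilate (p := 0) (t := n.+1%:R) (@plateau_smooth R)).
  by under eq_fun do rewrite subr0.
have [] := @dominated_convergence _ _ R mu setT measurableT F (EFin \o phi) (EFin \o phi).
- move=> n; apply/measurable_EFinP; apply: continuous_measurable_fun.
  exact (smooth_continuous (pls n)).
- by have /integrableP[] := iphi.
- apply: aeW => z _; apply: cvg_near_cst.
  near=> n; rewrite /F plateau_eq1 ?mulr1//.
  have n0 : 0 < n.+1%:R :> R by [].
  rewrite normrM normfV (gtr0_norm n0) ler_pdivrMr// mul1r.
  near: n; exists (Num.bound `|z|) => // n /= zn.
  by rewrite ltW// (lt_le_trans (archi_boundP (normr_ge0 z)))// ler_nat (leq_trans zn)// leqW.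
- exact: iphi.
- apply: aeW => z n _; rewrite /F/= lee_fin normrM (ger0_norm (phi0 _)).
  by rewrite (ger0_norm (plateau_ge0 _)) ler_piMr ?plateau_le1.
move=> _ _ cvF.
have : (\int[mu]_x F n x)%E @[n --> \oo] --> 1%:E.
  move: cvF; rewrite -phi1 /Rintegral fineK//; exact: integrable_fin_num.
move=> /fine_cvgP[_ /cvgrPdist_le/(_ e e0)[n0 _ Hn]].
pose n := maxn n0 (Num.bound `|r0|).
exists n.+1%:R; last first.
  by split=> //; rewrite distrC; exact: (Hn n (leq_maxl _ _)).
rewrite (le_trans (ler_norm _))// ltW// (lt_le_trans (archi_boundP (normr_ge0 r0)))//.
by rewrite ler_nat ltnW// ltnS leq_maxr.
Unshelve. all: by end_near. Qed.

(** The compactly supported part [phi plateau] is a test function, treated by the point value; the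
    tail is a symbol of small constant, treated by tameness at all scales at once. The integral of
    the first part is close to 1. *)
Lemma T0_point_value u x theta phi l e0 : tame 1 u x -> test_function theta ->
  0 < e0 -> (forall y, `|y - x| <= e0 -> theta y = 1) -> has_point_value u x l -> T0 phi ->
  t^-1 * u (fun y => theta y * phi ((y - x) / t)) @[t --> 0^'+] --> l.
Proof.
move=> ut tt e00 th1 ul T0phi; have [phis _ _ [a a1 tail]] := T0phi.
(* The midpoint of [a] and -1: larger than [a], so that the tail is small in order [b], and still
   below -1, so that [tame_symbol] applies with exponent 1. *)
pose b := (a - 1) / 2.
have b1 : b + 1%:R < 0 by rewrite (_ : 1%:R = 1 :> R)// /b; lra.
have [N [C [C0 H]]] := tame_symbol ut tt b1.
have a0 : a <= 0 by lra.
have [B phiB] := symbol_of_tail N phis a0 tail.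
have ab : a < b by rewrite /b; lra.
have b0 : b <= 0 by rewrite /b; lra.
apply/right_limP => e ep.
have e1 : 0 < e / 3 / (C + 1) by rewrite !divr_gt0// ltr_wpDl.
have [r0 r00 Hr0] := symbol_tail_small phis ab b0 phiB e1.
have e2 : 0 < e / 3 / (`|l| + 1) by rewrite !divr_gt0// ltr_wpDl.
have [r rr0 [rp Hr]] := T0_plateau_integral T0phi r0 e2.
have ps : smooth (fun z : R => plateau (z / r)).
  have := smooth_dilate (p := 0) (t := r) (@plateau_smooth R).
  by under eq_fun do rewrite subr0.
have ptest : test_function (fun z => phi z * plateau (z / r)).
  apply: (test_mulr phis).
  have := test_dilate 0 (lt0r_neq0 rp) (@plateau_test R).
  by under eq_fun do rewrite subr0.
have qs : smooth (fun z : R => 1 - plateau (z / r)) := smooth_sub (@smooth_cst R 1) ps.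
have e3 : 0 < e / 3 by rewrite divr_gt0.
have [d d0 Hd] := (right_limP _ _).1 (point_value_right ul ptest) _ e3.
exists (Num.min d (Num.min 1 (e0 / (2 * r)))).
  by rewrite !lt_min d0 ltr01 divr_gt0// mulr_gt0.
move=> t t0; rewrite !lt_min => /andP[td /andP[t1]].
rewrite ltr_pdivlMr ?mulr_gt0// => tr.
have tn0 : t != 0 by rewrite gt_eqF.
have T1 := test_mul tt (smooth_dilate (p := x) (t := t) (test_smooth ptest)).
have T2 := test_mul tt (smooth_dilate (p := x) (t := t) (smooth_mul phis qs)).
have -> : (fun y => theta y * phi ((y - x) / t)) =
   fun y => theta y * (phi ((y - x) / t) * plateau ((y - x) / t / r)) +
     theta y * (phi ((y - x) / t) * (1 - plateau ((y - x) / t / r))).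
  by apply/funext => y; ring.
rewrite (dist_add u T1 T2) mulrDr.
have -> : (fun y => theta y * (phi ((y - x) / t) * plateau ((y - x) / t / r))) =
   fun y => phi ((y - x) / t) * plateau ((y - x) / t / r).
  apply/funext => y; have [yx|yx] := leP `|y - x| e0; first by rewrite th1// mul1r.
  rewrite plateau_eq0 ?mulr0// -mulrA -invfM normrM normfV (gtr0_norm (mulr_gt0 t0 rp)).
  by rewrite ler_pdivlMr ?mulr_gt0//; lra.
have := Hd t t0 td; rewrite /rescaled (gtr0_norm t0) => h1.
have := H t _ _ t0 (ltW t1) (smooth_mul phis qs) (Hr0 r rr0); rewrite expr1 => h2.
have h3 : `|t^-1 * u (fun y => theta y * (phi ((y - x) / t) * (1 - plateau ((y - x) / t / r))))| <= e / 3.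
  rewrite normrM normfV (gtr0_norm t0) mulrC ler_pdivrMr// (le_trans h2)//.
  rewrite ler_wpM2r ?(ltW t0)//.
  have -> : C * (e / 3 / (C + 1)) = e / 3 * (C / (C + 1)) by ring.
  rewrite ler_piMr ?(ltW e3)// ler_pdivrMr ?ltr_wpDl//; lra.
have h4 : `|l * \int[mu]_y (phi y * plateau (y / r)) - l| <= e / 3.
  rewrite -[X in _ - X]mulr1 -mulrBr normrM.
  apply: (@le_trans _ _ ((`|l| + 1) * (e / 3 / (`|l| + 1)))).
    by rewrite ler_pM// lerDl.
  by rewrite mulrC divfK// gt_eqF// ltr_wpDl.
move: h1 h3 h4; clear; rewrite !ler_norml => /andP[? ?] /andP[? ?] /andP[? ?].
by apply/andP; split; lra.
Qed.

End T0.

(** * A single pair that is both major and minor *)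

Section ExactPair.
Variable R : realType.
Implicit Types (f phi psi theta : R -> R) (a b p r t x y z c d e h s l M L : R).
Implicit Types (g u U : schwartz_distribution R).
Notation mu := (@lebesgue_measure R).

Lemma lateral_limits_tame g x lm lp : has_lateral_limits g x lm lp -> tame 1 g x.
Proof.
move=> H; apply: tameP => phi tphi; have := H phi tphi.
set l := (X in _ --> X) => /right_limP/(_ 1 ltr01)[r r0 rH].
exists (`|l| + 1), r; split=> // t t0 tr.
have := rH t t0 tr; rewrite rescaled_pos// => h.
have : `|t^-1 * g (fun y => phi ((y - x) / t))| <= `|l| + 1.
  have := lerB_dist (t^-1 * g (fun y => phi ((y - x) / t))) l; lra.
by rewrite normrM normfV (gtr0_norm t0) expr1 mulrC ler_pdivrMr.
Qed.

Lemma regulated_tame g : regulated_distribution g -> tame_all g.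
Proof. by move=> H x; have [lm [lp]] := H x; exact: lateral_limits_tame. Qed.

Lemma point_value_lateral g x l : has_point_value g x l -> has_lateral_limits g x l l.
Proof.
move=> H phi tphi; have [_ [M M0 phiM]] := (test_functionP phi).1 tphi.
have pd y := prim_derive y tphi.
rewrite (integral_test_neg tphi pd M0 phiM) (integral_test_pos tphi pd M0 phiM).
rewrite -mulrDr [X in l * X](_ : _ = prim phi M - prim phi (- M)); last by ring.
rewrite -(integral_test tphi pd M0 phiM); exact: point_value_right.
Qed.

Lemma lojasiewicz_regulated (G : R -> R) : lojasiewicz_function G -> regulated_function G.
Proof.
move=> [g gl gG]; exists g; last by move=> x _; exact: gG.
by move=> x; exists (G x), (G x); exact: point_value_lateral.
Qed.

Lemma eapp_cutoff a b : is_cutoff a b (xget (fun=> 0) (is_cutoff a b)).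
Proof. by apply: xgetPex; exists (cutoff_at a b); exact: cutoff_at_cutoff. Qed.

Lemma test_split_off psi a b rho : a <= b -> test_function psi -> 0 < rho ->
  (forall y, a - rho < y < b + rho -> psi y = 0) ->
  exists psi1 psi2, [/\ test_function psi1, test_function psi2,
    psi = fun y => psi1 y + psi2 y, forall y, a - rho < y -> psi1 y = 0 &
    forall y, y < b + rho -> psi2 y = 0].
Proof.
move=> ab tpsi rho0 psi0; have rn0 : rho != 0 by rewrite gt_eqF.
pose c y := sstep ((y - b) / rho).
have cs : smooth c := smooth_dilate (p := b) (t := rho) (@sstep_smooth R).
have t2 : test_function (fun y => c y * psi y) := test_mulr cs tpsi.
exists (fun y => psi y - c y * psi y), (fun y => c y * psi y); split.
- exact: test_sub.
- exact: t2.
- by apply/funext => y; rewrite subrK.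
- move=> y yb; have [yb2|yb2] := ltP y (b + rho).
    by rewrite psi0 ?mulr0 ?subr0// yb yb2.
  by rewrite /c sstep_eq1 ?mul1r ?subrr// ler_pdivlMr//; lra.
- move=> y yb; have [yb2|yb2] := ltP (a - rho) y.
    by rewrite psi0 ?mulr0// yb2 yb.
  by rewrite /c sstep_eq0 ?mul0r// ler_pdivrMr//; lra.
Qed.

(** The restrictions to the right of [a] and to the right of [b] are subtracted, which leaves the
    part in between. Endpoints are excluded from the last clause because the cut may change point
    values there. *)
Lemma exact_restriction g a b : tame_all g -> a <= b -> exists u,
  [/\ supported_in a b u, tame_all u &
    forall x l, a < x -> x < b -> has_point_value g x l -> has_point_value u x l].
Proof.
move=> tg ab; have [ga Ha] := restriction_exists (tg a).
have [gb Hb] := restriction_exists (tg b).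
have [u uE] := dist_diff_exists ga gb; exists u; split.
- move=> psi tpsi /(supported_in_zero ab tpsi)[rho rho0 psi0].
  have [psi1 [psi2 [t1 t2 -> psi10 psi20]]] := test_split_off ab tpsi rho0 psi0.
  rewrite (dist_add u t1 t2) (uE psi1 t1) (uE psi2 t2).
  have e1 : ga psi1 = 0 by apply: (restriction_left Ha t1) => y ay; apply: psi10; lra.
  have e2 : gb psi1 = 0 by apply: (restriction_left Hb t1) => y ay; apply: psi10; lra.
  have e3 : ga psi2 = g psi2.
    by apply: (restriction_right Ha t2 rho0) => y ay; apply: psi20; lra.
  by rewrite e1 e2 e3 (restriction_right Hb t2 rho0 psi20) !subrr addr0.
- move=> x; apply: tameP => phi tphi.
  have [L1 L10 H1] := tame_pt (restriction_tame tg Ha x) tphi.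
  have [L2 L20 H2] := tame_pt (restriction_tame tg Hb x) tphi.
  exists (L1 + L2), 1; split=> // r r0 /ltW r1.
  rewrite uE; last by apply: test_dilate => //; rewrite gt_eqF.
  by rewrite mulrDl (le_trans (ler_normB _ _))// lerD// ?H1// H2.
- move=> x l ax xb gl; apply: has_point_value_right => phi tphi.
  have [_ [M M0 phiM]] := (test_functionP phi).1 tphi.
  apply/right_limP => e e0.
  have [r r0 rH] := (right_limP _ _).1 (point_value_right gl tphi) e e0.
  pose d := Num.min (x - a) (b - x); have d0 : 0 < d by rewrite lt_min !subr_gt0 ax.
  exists (Num.min r (d / 2 / M)); first by rewrite lt_min r0 !divr_gt0.
  move=> t t0; rewrite lt_min ltr_pdivlMr// => /andP[tr tM].
  have tphit : test_function (fun y => phi ((y - x) / t)).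
    by apply: test_dilate => //; rewrite gt_eqF.
  have phi0 y : d / 2 <= `|y - x| -> phi ((y - x) / t) = 0.
    move=> yd; apply: phiM; rewrite normrM normfV (gtr0_norm t0) ltr_pdivlMr//.
    by rewrite mulrC; lra.
  have d1 : d <= x - a by rewrite ge_min lexx.
  have d2 : d <= b - x by rewrite ge_min lexx orbT.
  have d20 : 0 < d / 2 by rewrite divr_gt0.
  have := rH t t0 tr; rewrite /rescaled (uE _ tphit).
  rewrite (restriction_right Ha tphit d20); last first.
    by move=> y ya; apply: phi0; rewrite ler0_norm; lra.
  rewrite (restriction_left Hb tphit) ?subr0//.
  by move=> y yb; apply: phi0; rewrite ger0_norm; lra.
Qed.

Lemma exact_pair g f a b : regulated_distribution g ->
  (forall x, ~ jump_set g x -> has_point_value g x (f x)) -> a <= b ->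
  exists u U, major_pair a b (fun x => (f x)%:E) u U /\ minor_pair a b (fun x => (f x)%:E) u U.
Proof.
move=> gr gf ab.
have [u [us ut uv]] := exact_restriction (regulated_tame gr) ab.
have [U [uU Ul Ua]] := primitive_exists ab us ut; exists u, U.
have [tt [e0 e00 th1]] := eapp_cutoff a b.
set theta := xget _ _ in tt th1.
(* The null set also absorbs both endpoints, where [u] need not have the point value of [g]. *)
pose Z := jump_set g `|` [set a; b].
have Zneg : (@lebesgue_measure R).-negligible Z.
  have cneg A : countable A -> (@lebesgue_measure R).-negligible A.
    move=> cA; apply/negligibleP; last exact: countable_lebesgue_measure0.
    exact: countable_measurable.
  by apply: negligibleU; apply: cneg; [exact: jump_set_countable|exact: finite_set_countable].
have pv x phi : a <= x <= b -> ~ Z x -> T0 phi ->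
    rescaled (eapp a b u) x t phi @[t --> 0^'+] --> f x.
  move=> /andP[ax xb] nZ T0phi.
  have xa : x != a by apply/eqP => E; apply: nZ; right; left.
  have xb' : x != b by apply/eqP => E; apply: nZ; right; right.
  have nj : ~ jump_set g x by move=> j; apply: nZ; left.
  have ux : has_point_value u x (f x).
    by apply: uv (gf x nj); rewrite lt_neqAle ?ax ?xb ?andbT// eq_sym.
  have thx y : `|y - x| <= e0 -> theta y = 1.
    by rewrite ler_norml => /andP[? ?]; apply: th1; apply/andP; split; lra.
  have /right_limP H := T0_point_value (ut x) tt e00 thx ux T0phi.
  apply/right_limP => e ep; have [r r0 rH] := H e ep.
  by exists r => // t t0 tr; rewrite /rescaled (gtr0_norm t0); exact: rH.
have bd x phi : T1 phi -> exists L, forall t, 0 < t -> t < 1 ->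
    `|rescaled (eapp a b u) x t phi| <= L.
  move=> [T0phi _]; have [L HL] := tame_T0_bounded (ut x) tt T0phi.
  by exists L => t t0 /ltW t1; rewrite /rescaled (gtr0_norm t0); exact: HL.
(* The exceptional countable set is empty: tameness bounds the averages at every point, jumps and
   endpoints included. *)
split; split=> //; exists set0, Z; split=> //.
- by move=> x phi xab nZ T0phi; have [] := right_lim_einf (pv x phi xab nZ T0phi).
- move=> x phi _ _ T1phi; have [L HL] := bd x phi T1phi.
  apply: (@lt_le_trans _ _ (- L)%:E); first exact: ltNyr.
  by apply: (limf_einf_ge ltr01) => t t0 t1; have := HL t t0 t1; rewrite ler_norml => /andP[].
- by move=> x phi xab nZ T0phi; have [] := right_lim_einf (pv x phi xab nZ T0phi).
- move=> x phi _ _ T1phi; have [L HL] := bd x phi T1phi.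
  apply: (@le_lt_trans _ _ L%:E); last exact: ltry.
  by apply: (limf_esup_le ltr01) => t t0 t1; have := HL t t0 t1; rewrite ler_norml => /andP[].
Qed.

End ExactPair.

(** * The Poisson kernel: derivative bounds, harmonicity, membership in the test classes *)

Section PoissonKernel.
Variable R : realType.
Implicit Types (f k phi psi theta : R -> R) (a b p r s t u x y z rho tau : R).
Notation mu := (@lebesgue_measure R).

Lemma symbolN1P (N : nat) B k : symbol N (-1) B k <->
  forall (m : nat) z, (m <= N)%N -> `|derive1n m k z| <= B * (1 + `|z|)^-1 ^+ m.+1.
Proof.
have E z (m : nat) : B * (1 + `|z|) `^ (-1) * (1 + `|z|)^-1 ^+ m = B * (1 + `|z|)^-1 ^+ m.+1.
  by rewrite powR_inv1 ?addr_ge0// -mulrA -exprS.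
by split=> H => [m z mN|z m mN]; [rewrite -E; exact: H|rewrite E; exact: H].
Qed.

(** For [|s| <= 4] one has [1 + |z| <= 5 (1 + |z - s|)]. A shift by exactly 4 occurs when a kernel
    centred at distance [d] from [p] is viewed from [p] at scale [d / 4]. *)
Lemma symbol_shift (N : nat) B k s : smooth k -> `|s| <= 4 -> symbol N (-1) B k ->
  symbol N (-1) (5 ^+ N.+1 * B) (fun z => k (z - s)).
Proof.
move=> ks s4 kB; have B0 := symbol_ge0 kB; move/symbolN1P : kB => kB.
apply/symbolN1P => m z mN.
have -> : (fun z => k (z - s)) = (fun z => k (1 * z - s)) by apply/funext => y; rewrite mul1r.
rewrite derive1n_affine// expr1n !mul1r (le_trans (kB _ _ mN))//.
rewrite [_ * B]mulrC -mulrA ler_wpM2l//.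
have z0 : 0 < 1 + `|z| by rewrite ltr_pwDl.
have zs0 : 0 < 1 + `|z - s| by rewrite ltr_pwDl.
have le5 : (1 + `|z - s|)^-1 <= 5 / (1 + `|z|).
  rewrite ler_pdivlMr// mulrC ler_pdivrMr//.
  have := lerB_dist z s; have := normr_ge0 (z - s); lra.
rewrite (le_trans (lerXn2r m.+1 _ _ le5))// ?nnegrE ?divr_ge0 ?invr_ge0 ?(ltW z0) ?(ltW zs0)//.
rewrite exprMn ler_wpM2r// ?exprn_ge0// ?invr_ge0 ?(ltW z0)//.
by apply: ler_weXn2l; rewrite ?ler1n.
Qed.

Lemma symbol_derive1 (N : nat) B k : symbol N.+1 (-1) B k -> symbol N (-1) B (derive1 k).
Proof.
move=> kB; have B0 := symbol_ge0 kB; move/symbolN1P : kB => kB.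
apply/symbolN1P => m z mN; rewrite (_ : derive1n m _ = derive1n m.+1 k); last first.
  by rewrite -[derive1 k]/(derive1n 1 k) derive1nD addn1.
rewrite (le_trans (kB _ _ _))// ler_wpM2l// exprS ler_piMl ?exprn_ge0 ?invr_ge0 ?addr_ge0//.
by rewrite invf_le1 ?ltr_pwDl// lerDl.
Qed.

(** The Poisson kernel at height [tau] without its factor [tau / pi]. Dropping the factor gives
    bounds away from the origin that persist as [tau] tends to 0. *)
Definition cauchyq tau u := (tau ^+ 2 + u ^+ 2)^-1.

Lemma cauchyq_den_gt0 tau u : 0 < tau -> 0 < tau ^+ 2 + u ^+ 2.
Proof. by move=> t0; rewrite ltr_pwDl ?exprn_gt0// sqr_ge0. Qed.

Lemma cauchyq_smooth tau : 0 < tau -> smooth (cauchyq tau).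
Proof.
move=> t0; apply: (@smooth_recip _ (fun u => tau ^+ 2 + u ^+ 2)); last first.
  by move=> u; rewrite gt_eqF// cauchyq_den_gt0.
exact (smooth_add (smooth_cst (c := tau ^+ 2)) (smooth_mul (@smooth_id R) (@smooth_id R))).
Qed.

(* The m-th derivative of the identity (tau^2 + u^2) q = 1, of which the bounds on q follow. *)
Lemma cauchyq_rec tau (m : nat) u : 0 < tau ->
  (tau ^+ 2 + u ^+ 2) * derive1n m.+1 (cauchyq tau) u
  + (2 * m.+1%:R) * (u * derive1n m (cauchyq tau) u)
  + (m.+1 * m)%:R * derive1n m.-1 (cauchyq tau) u = 0.
Proof.
move=> t0; have qs := cauchyq_smooth t0; set q := cauchyq tau in qs *.
have dd (v : R) : is_derive v 1 (fun u => tau ^+ 2 + u ^+ 2) (2 * v).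
  have := is_derive_add (is_derive_cstl v (tau ^+ 2)) (is_derive_pow 2 (is_derive_var v)).
  by rewrite add0r mulr1 expr1.
elim: m u => [|m IH] u.
  have H : forall v, (tau ^+ 2 + v ^+ 2) * q v = 1.
    by move=> v; rewrite /q /cauchyq mulfV// gt_eqF// cauchyq_den_gt0.
  have H1 := is_derive_mul (dd u) (smooth_is_derive0 u qs).
  have H2 : is_derive u 1 (fun v => (tau ^+ 2 + v ^+ 2) * q v) 0.
    by rewrite (_ : (fun v => _) = fun=> 1) ?funeqE//; exact: is_derive_cstl.
  by have := is_derive_uniq H1 H2; rewrite muln0 mul0r addr0 mulr1 /= mulrA addrC.
have qd n v := smooth_is_derive n v qs.
have H1 := is_derive_mul (dd u) (qd m.+1 u).
have H2 := is_derive_scal (2 * m.+1%:R) (is_derive_mul (is_derive_var u) (qd m u)).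
have H3 : is_derive u 1 (fun v => (m.+1 * m)%:R * derive1n m.-1 q v) ((m.+1 * m)%:R * derive1n m q u).
  case: m {IH H1 H2} => [|m]; last exact (is_derive_scal _ (qd m u)).
  by rewrite muln0 mul0r (_ : (fun v => _) = fun=> 0) ?funeqE//; [exact: is_derive_cstl|move=> v; rewrite mul0r].
have H := is_derive_add (is_derive_add H1 H2) H3.
have H0 : is_derive u 1 (fun v => (tau ^+ 2 + v ^+ 2) * derive1n m.+1 q v
  + (2 * m.+1%:R) * (v * derive1n m q v) + (m.+1 * m)%:R * derive1n m.-1 q v) 0.
  by rewrite (_ : (fun v => _) = fun=> 0) ?funeqE//; exact: is_derive_cstl.
rewrite -[RHS](is_derive_uniq H H0).
move: (derive1n m.+2 q u) (derive1n m.+1 q u) (derive1n m q u) => A B C /=.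
rewrite !natrM !mulrSr; ring.
Qed.

(** [rho] is a length comparable to the distance of [(u, tau)] from the origin. The induction solves
    the recurrence for the top derivative; the factor [tau^2 + u^2] in front of it is at least
    [rho^2 / K], which accounts for two powers of [rho]. *)
Lemma cauchyq_bound K (N : nat) : 1 <= K -> exists2 C, 0 <= C &
  forall tau u rho, 0 < tau -> 0 < rho -> `|u| <= rho -> rho ^+ 2 <= K * (tau ^+ 2 + u ^+ 2) ->
  forall m : nat, (m <= N)%N -> `|derive1n m (cauchyq tau) u| <= C * rho^-1 ^+ m.+2.
Proof.
move=> K1; elim: N => [|N [C C0 IH]].
  exists K => [|tau u rho t0 r0 ur rK m]; first lra.
  have d0 := cauchyq_den_gt0 u t0.
  rewrite leqn0 => /eqP ->; rewrite /= /cauchyq ger0_norm ?invr_ge0 ?(ltW d0)//.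
  by rewrite exprVn ler_pdivlMr ?exprn_gt0// mulrC ler_pdivrMr.
pose D := K * (2 * N.+1%:R * C + (N.+1 * N)%:R * C).
have D0 : 0 <= D by rewrite mulr_ge0 ?addr_ge0 ?mulr_ge0//; lra.
exists (C + D) => [|tau u rho t0 r0 ur rK m]; first by rewrite addr_ge0.
have ri0 : 0 <= rho^-1 by rewrite invr_ge0 ltW.
rewrite leq_eqVlt ltnS => /predU1P[->|mN]; last first.
  rewrite (le_trans (IH _ _ _ t0 r0 ur rK _ mN))// ler_wpM2r ?exprn_ge0//.
  by rewrite lerDl.
have d0 := cauchyq_den_gt0 u t0; have d1 := ltW d0.
have b1 := IH _ _ _ t0 r0 ur rK N (leqnn N).
have b2 := IH _ _ _ t0 r0 ur rK N.-1 (leq_pred N).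
have := cauchyq_rec N u t0.
move: (derive1n N.+1 (cauchyq tau) u) (derive1n N (cauchyq tau) u) b1 (derive1n N.-1 (cauchyq tau) u) b2
  => A B b1 E b2 rec.
have dA : (tau ^+ 2 + u ^+ 2) * `|A| <= (2 * N.+1%:R * C + (N.+1 * N)%:R * C) * rho^-1 ^+ N.+1.
  rewrite -[X in X * `|A|](ger0_norm d1) -normrM.
  have -> : (tau ^+ 2 + u ^+ 2) * A = - (2 * N.+1%:R * (u * B) + (N.+1 * N)%:R * E).
    by apply/eqP; rewrite -subr_eq0 opprK addrA; apply/eqP.
  rewrite normrN (le_trans (ler_normD _ _))// [leRHS]mulrDl lerD//.
    rewrite normrM ger0_norm ?mulr_ge0// -mulrA ler_wpM2l ?mulr_ge0// normrM.
    rewrite (le_trans (ler_pM _ _ ur b1))// mulrCA ler_wpM2l// exprS mulrA mulfV ?mul1r//.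
    by rewrite gt_eqF.
  rewrite normrM normr_nat -mulrA; case: (N) b2 => [|n] b2; first by rewrite muln0 !mul0r.
  by rewrite ler_wpM2l.
have : rho ^+ 2 * `|A| <= D * rho^-1 ^+ N.+1.
  rewrite (le_trans (ler_wpM2r (normr_ge0 A) rK))// -mulrA /D -mulrA ler_wpM2l//; lra.
rewrite mulrC -ler_pdivlMr ?exprn_gt0// => /le_trans; apply.
rewrite -exprVn -mulrA -exprD addn2 ler_wpM2r ?exprn_ge0//.
by rewrite lerDr.
Qed.

Definition poisson z := pi^-1 * cauchyq 1 z.

Let pi0 : 0 < (pi : R) := pi_gt0 R.

Lemma poisson_smooth : smooth poisson.
Proof. exact (smooth_scal (c := pi^-1) (cauchyq_smooth ltr01)). Qed.

Lemma poisson_ge0 z : 0 <= poisson z.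
Proof. by rewrite mulr_ge0 ?invr_ge0 ?(ltW pi0) ?(ltW (cauchyq_den_gt0 _ _)). Qed.

Lemma poisson_cont : continuous poisson.
Proof. exact (smooth_continuous poisson_smooth). Qed.

Lemma poisson_bound (N : nat) : exists2 C, 0 <= C & forall (m : nat) z, (m <= N)%N ->
  `|derive1n m poisson z| <= C * (1 + `|z|)^-1 ^+ m.+2.
Proof.
have [|C C0 CH] := @cauchyq_bound 2 N; first lra.
exists (pi^-1 * C) => [|m z mN]; first by rewrite mulr_ge0 ?invr_ge0 ?(ltW pi0).
rewrite (derive1n_scal _ m (cauchyq_smooth ltr01)) normrM gtr0_norm ?invr_gt0// -mulrA.
rewrite ler_wpM2l ?invr_ge0 ?(ltW pi0)//.
apply: CH => //; rewrite ?ltr_pwDl ?lerDr//.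
rewrite -[z ^+ 2]real_normK ?num_real//.
have := sqr_ge0 (1 - `|z|); rewrite !expr2; lra.
Qed.

Lemma poisson_symbol (N : nat) : exists B, symbol N (-1) B poisson.
Proof.
have [C C0 CH] := poisson_bound N; exists C; apply/symbolN1P => m z mN.
rewrite (le_trans (CH _ _ mN))// ler_wpM2l// exprS ler_piMl ?exprn_ge0 ?invr_ge0 ?addr_ge0//.
by rewrite invf_le1 ?ltr_pwDl// lerDl.
Qed.

(** The Laplace equation for [t^-1 P((y - x) / t)], multiplied by [t^3] and written for the profile
    [P]. It is the recurrence of [cauchyq] at order 1 in disguise. *)
Lemma poisson_harmonic z : derive1 (derive1 poisson) z
  + 2 * (poisson z + euler poisson z) + euler (fun z => poisson z + euler poisson z) z = 0.
Proof.
have ps := poisson_smooth.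
have es := euler_smooth ps.
rewrite [X in _ + X]/euler.
have -> : derive1 (fun z => poisson z + euler poisson z) z = derive1n 1 poisson z + derive1n 1 (euler poisson) z.
  exact: (congr1 (fun f => f z) (derive1n_add 1 ps es)).
rewrite (derive1n_euler 1 _ ps) /euler.
have := cauchyq_rec 1 z ltr01.
have E n : derive1n n (cauchyq 1) z = pi * derive1n n poisson z.
  by rewrite (derive1n_scal _ n (cauchyq_smooth ltr01)) mulrA mulfV ?mul1r// gt_eqF.
rewrite !E expr1n /= => H; apply: (mulfI (lt0r_neq0 pi0)).
move: H; rewrite mulr0.
move: (derive1 (derive1 poisson) z) (derive1 poisson z) (poisson z) => A B C <-.
by rewrite muln1; ring.
Qed.

Lemma poisson_integral : \int[mu]_z poisson z = 1.
Proof.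
have even : poisson =1 poisson \o -%R by move=> z; rewrite /poisson /cauchyq /= sqrrN.
rewrite /Rintegral (ge0_symfun_integralT poisson_ge0 poisson_cont even).
have -> : (\int[mu]_(x in [set x : R | (0 <= x)%R]) (poisson x)%:E = (pi^-1)%:E * (pi / 2)%:E)%E.
  rewrite -integral0y_oneDsqr.
  have -> : [set x : R | 0 <= x] = `[0, +oo[%classic.
    by apply/seteqP; split => x /=; rewrite in_itv /= andbT.
  rewrite -ge0_integralZl//.
  - by apply: eq_integral => x _; rewrite -EFinM /poisson /cauchyq expr1n.
  - apply/measurable_EFinP; apply: measurable_funTS.
    by apply: continuous_measurable_fun; exact: continuous_oneDsqrV.
  - by rewrite lee_fin invr_ge0 ltW.
rewrite -!EFinM /=; have := pi0; move: (pi : R) => q q0; field.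
by rewrite gt_eqF.
Qed.

Lemma poisson_T0 : T0 poisson.
Proof.
split; [exact: poisson_smooth|exact: poisson_ge0|exact: poisson_integral|].
exists (- 2); first lra.
move=> m; have [C C0 CH] := poisson_bound m; exists C, 0 => z z0.
rewrite (le_trans (CH _ _ (leqnn m)))// ler_wpM2l//.
rewrite (_ : -2 - m%:R = - (m.+2)%:R); last by rewrite -(addn2 m) natrD; ring.
rewrite powRN powR_mulrn// -exprVn lerXn2r ?nnegrE ?invr_ge0 ?addr_ge0//.
by rewrite lef_pV2 ?posrE ?ltr_pwDl// lerDr.
Qed.

Lemma poisson_T1 : T1 poisson.
Proof.
split; first exact: poisson_T0.
move=> z; have d0 := cauchyq_den_gt0 z ltr01.
have := cauchyq_rec 0 z ltr01; rewrite muln0 mul0r addr0 mulr1 => rec.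
have -> : derive1 poisson z = pi^-1 * derive1n 1 (cauchyq 1) z.
  exact: (congr1 (fun f => f z) (derive1n_scal pi^-1 1 (cauchyq_smooth ltr01))).
rewrite mulrCA pmulr_rle0 ?invr_gt0//.
rewrite -(pmulr_rle0 _ d0) mulrCA.
have -> : (1 ^+ 2 + z ^+ 2) * derive1n 1 (cauchyq 1) z = - (2 * (z * cauchyq 1 z)).
  by apply/eqP; rewrite -subr_eq0 opprK; apply/eqP.
rewrite mulrN oppr_le0 mulrCA mulr_ge0// mulrA -expr2 mulr_ge0 ?sqr_ge0//.
by rewrite /cauchyq invr_ge0 ltW.
Qed.

(** Where [1 - plateau] lives one has [|u| >= 1], hence [(1 + |u|)^2 <= 4 u^2], and [cauchyq_bound]
    applies with [K = 4] for all heights at once. *)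
Lemma cauchyq_far_symbol (N : nat) : exists2 B, 0 <= B & forall tau, 0 < tau ->
  symbol N (-1) B (fun u => cauchyq tau u * (1 - plateau u)).
Proof.
have [|C C0 CH] := @cauchyq_bound 4 N; first lra.
have [A A0 AH] := symbol_1plateau R N.
have pls : smooth (fun u : R => 1 - plateau u) := @smooth_1plateau R.
exists (2 ^+ N * C * A) => [|tau t0]; first by rewrite !mulr_ge0.
apply/symbolN1P => m u mN.
have qs := cauchyq_smooth t0.
have r0 : 0 < 1 + `|u| by rewrite ltr_pwDl.
have ri0 : 0 <= (1 + `|u|)^-1 by rewrite invr_ge0 ltW.
have [u1|u1] := ltP `|u| 1.
  have u10 : 0 < 1 - `|u| by rewrite subr_gt0.
  rewrite (derive1n_near_cst (c := 0) m u10 (smooth_mul qs pls)).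
    have -> : (if m is 0%N then 0 else 0) = 0 :> R by case: (m).
    by rewrite normr0 mulr_ge0 ?exprn_ge0// !mulr_ge0.
  move=> y yu; rewrite plateau_eq1 ?subrr ?mulr0//.
  have := lerB_dist y u; lra.
have j1 : jet_bound N (C * (1 + `|u|)^-1) (1 + `|u|)^-1 (cauchyq tau) u.
  move=> i iN; rewrite (le_trans (CH _ _ (1 + `|u|) t0 r0 _ _ i iN)) ?lerDr//.
    have e1 : `|u| ^+ 2 = u ^+ 2 by rewrite real_normK ?num_real.
    have := sqr_ge0 tau; rewrite -e1 => ?.
    have : (1 + `|u|) ^+ 2 <= (2 * `|u|) ^+ 2 by rewrite lerXn2r ?nnegrE ?mulr_ge0//; lra.
    rewrite exprMn; lra.
  rewrite -mulrA -exprS ler_wpM2l// [leLHS]exprS ler_piMl ?exprn_ge0//.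
  by rewrite invf_le1 ?ltr_pwDl// lerDl.
have j2 : jet_bound N A (1 + `|u|)^-1 (fun u => 1 - plateau u) u.
  have := AH 1 (lexx 1) u; rewrite powRr0 mulr1.
  by rewrite (_ : (fun z => 1 - plateau (z / 1)) = fun z => 1 - plateau z)// funeqE => z; rewrite divr1.
have := jet_bound_mul qs pls ri0 j1 j2 mN => /le_trans; apply.
by rewrite exprS le_eqVlt; apply/orP; left; apply/eqP; ring.
Qed.

End PoissonKernel.

(** * Local positivity of a distribution, and removal of isolated points *)

Section Positivity.
Variable R : realType.
Implicit Types (f k phi psi theta : R -> R) (a b c d e p r s t u x y z rho : R).
Implicit Types (w W : schwartz_distribution R).
Notation mu := (@lebesgue_measure R).

Definition pos_on w c d := forall psi, test_function psi -> (forall y, 0 <= psi y) ->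
  (forall y, ~~ (c < y < d) -> psi y = 0) -> 0 <= w psi.

Definition pos_near w x := exists2 rho, 0 < rho & pos_on w (x - rho) (x + rho).

Lemma pos_on_sub w c d c' d' : c <= c' -> d' <= d -> pos_on w c d -> pos_on w c' d'.
Proof.
move=> cc dd H psi tpsi psi0 psiE; apply: H => // y ycd; apply: psiE.
by apply: contra ycd => /andP[cy yd]; rewrite (le_lt_trans cc cy) (lt_le_trans yd dd).
Qed.

Lemma pos_on_overlap w c s1 s d : s1 < s -> pos_on w c s -> pos_on w s1 d -> pos_on w c d.
Proof.
move=> ss H1 H2 psi tpsi psi0 psiE.
have ss0 : 0 < s - s1 by rewrite subr_gt0.
pose eta y := sstep ((y - s1) / (s - s1)).
have es : smooth eta := smooth_dilate (p := s1) (t := s - s1) (@sstep_smooth R).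
have t2 : test_function (fun y => eta y * psi y) := test_mulr es tpsi.
have E : psi = fun y => (psi y - eta y * psi y) + eta y * psi y.
  by apply/funext => y; rewrite subrK.
rewrite E (dist_add w (test_sub tpsi t2) t2) addr_ge0//.
  apply: H1; first exact (test_sub tpsi t2).
    move=> y; rewrite -[X in X - _]mul1r -mulrBl mulr_ge0// subr_ge0; exact: sstep_le1.
  move=> y; have [cy|cy] := ltP c y; last first.
    by move=> _; rewrite psiE ?mulr0 ?subr0//; apply/negP => /andP[]; rewrite ltNge cy.
  rewrite -leNgt => sy; rewrite /eta sstep_eq1 ?mul1r ?subrr//.
  by rewrite ler_pdivlMr// mul1r lerB.
apply: H2; first exact t2.
  move=> y; rewrite mulr_ge0//; exact: sstep_ge0.
move=> y; have [yd|yd] := ltP y d; last first.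
  by move=> _; rewrite psiE ?mulr0//; apply/negP => /andP[_]; rewrite ltNge yd.
rewrite andbT -leNgt => ys; rewrite /eta sstep_eq0 ?mul0r//.
by rewrite ler_pdivrMr// mul0r subr_le0.
Qed.

Lemma pos_on_trivial w c d : d <= c -> pos_on w c d.
Proof.
move=> dc psi tpsi _ psiE; rewrite (_ : psi = fun=> 0) ?dist0//.
by apply/funext => y; apply: psiE; apply/negP => /andP[cy yd]; move: (lt_trans cy yd); rewrite ltNge dc.
Qed.

(** Continuous induction on the right end: positivity near the supremum of the admissible ends is
    joined on by a partition of unity and carries them further. *)
Lemma pos_on_glue w c d : (forall x, c <= x <= d -> pos_near w x) -> pos_on w c d.
Proof.
move=> H; have [dc|cd] := leP d c; first exact: pos_on_trivial.
pose S := [set s | c <= s <= d /\ pos_on w c s].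
have Sc : S c by split; [rewrite lexx ltW|exact: pos_on_trivial].
have supS : has_sup S by split; [exists c|exists d => s [/andP[]]].
have cs : c <= sup S by exact: ub_le_sup supS.2 _ Sc.
have sd : sup S <= d by apply: ge_sup supS.1 _ => s [/andP[]].
have [|rho rho0 Hrho] := H (sup S); first by rewrite cs sd.
have [s Ss sS] := sup_adherent rho0 supS.
have Hs := pos_on_overlap sS Ss.2 Hrho.
have S' : S (Num.min (sup S + rho / 2) d).
  split.
    rewrite le_min (ltW cd) ge_min lexx orbT !andbT; have := rho0; lra.
  apply: (pos_on_sub (lexx c) _ Hs); rewrite ge_min; apply/orP; left; have := rho0; lra.
have := ub_le_sup supS.2 S'; rewrite ge_min => /orP[|dS]; first by have := rho0; lra.
by apply: (pos_on_sub (lexx c) _ Hs); have := rho0; lra.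
Qed.

Lemma pos_everywhere w psi : (forall x, pos_near w x) -> test_function psi ->
  (forall y, 0 <= psi y) -> 0 <= w psi.
Proof.
move=> H tpsi psi0; have [_ [M M0 psiM]] := (test_functionP psi).1 tpsi.
apply: (@pos_on_glue w (- (M + 1)) (M + 1)) => // y; rewrite -ltr_norml -leNgt => My.
by apply: psiM; apply: lt_le_trans My; lra.
Qed.

(** The pairing is minus an average of [W] against [phi'], which tends to [- l] times the integral
    of [phi'], that is, to 0. The derivative of a Lojasiewicz distribution thus carries nothing at a
    single point. *)
Lemma derivative_vanishes w W p l phi : is_derivative_of w W -> has_point_value W p l ->
  test_function phi -> w (fun y => phi ((y - p) / r)) @[r --> 0^'+] --> 0.
Proof.
move=> wW Wl tphi; have tphi' := test_derive1 tphi.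
have [phis [M M0 phiM]] := (test_functionP phi).1 tphi.
have := point_value_right Wl tphi'.
rewrite (integral_test tphi' (fun x => smooth_is_derive0 x phis) (M := M + 1)); last 2 first.
- lra.
- by move=> x xM; apply: (derive1n_ball_supported 1 phis phiM); apply: lt_trans xM; lra.
have MM : M < M + 1 by lra.
rewrite !phiM ?normrN ?ger0_norm//; try lra.
rewrite subrr mulr0 => /right_limP H; apply/right_limP => e e0.
have [r r0 rH] := H e e0; exists r; first exact: r0.
move=> t t0 tr; have tn0 : t != 0 by rewrite gt_eqF.
have := rH t t0 tr; rewrite rescaled_pos// !subr0.
rewrite (wW _ (test_dilate p tn0 tphi)) normrN.
have E := dist_scal W t^-1 (test_dilate p tn0 tphi').
by rewrite -/(derive1 _) (derive1_dilate p t phis) E.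
Qed.

Lemma derivative_tame w W p l : is_derivative_of w W -> has_point_value W p l -> tame 0 w p.
Proof.
move=> wW Wl; apply: tameP => phi tphi.
have /right_limP/(_ 1 ltr01)[r r0 rH] := derivative_vanishes wW Wl tphi.
by exists 1, r; split=> // t t0 tr; have := rH t t0 tr; rewrite subr0 expr0 mulr1.
Qed.

(** The value itself is [O(e)] by the mean value inequality, and every derivative brings a factor
    [e] by the chain rule. *)
Lemma difference_dilate_bound psi p (N : nat) : test_function psi -> exists2 K, 0 <= K &
  forall e, 0 < e -> e <= 1 ->
  norm_bound N (K * e) (fun z => (psi (p + e * z) - psi p) * plateau z).
Proof.
move=> tpsi; have psis := test_smooth tpsi.
have [B psiB] := test_norm_bound N.+1 tpsi; have B0 := norm_bound_ge0 psiB.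
have [A plA] := test_norm_bound N (plateau_test R); have A0 := norm_bound_ge0 plA.
exists (2 ^+ N * (2 * B) * A) => [|e e0 e1]; first by rewrite !mulr_ge0.
have fE : (fun z => psi (p + e * z) - psi p) = fun z => psi (e * z + p) - psi p.
  by apply/funext => z; rewrite (addrC p).
have as_ : smooth (fun z => psi (e * z + p)) := smooth_affine (c := e) (p := p) psis.
have fs : smooth (fun z => psi (p + e * z) - psi p).
  by rewrite fE; exact (smooth_sub as_ (smooth_cst (c := psi p))).
move=> k z kN.
have [z2|z2] := leP `|z| 2; last first.
  rewrite (derive1n_ball_supported k (smooth_mul fs (@plateau_smooth R)) (M := 2))//; last first.
    by move=> x x2; rewrite plateau_eq0 ?mulr0// ltW.
  by rewrite normr0 !mulr_ge0// ltW.
have j1 : jet_bound N (2 * B * e) 1 (fun z => psi (p + e * z) - psi p) z.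
  move=> [|i] iN; rewrite expr1n mulr1.
    rewrite /=.
    have b1 x : `|derive1 psi x| <= B by exact: (psiB 1%N).
    have := mvt_norm_le (a := p) (b := p + e * z) (fun x _ => smooth_is_derive0 x psis) (fun x _ => b1 x).
    move=> /le_trans; apply; rewrite addrC addKr normrM (gtr0_norm e0).
    rewrite (mulrC 2) -!mulrA ler_wpM2l// mulrC ler_wpM2r// ltW//.
  rewrite fE (derive1n_sub i.+1 as_ (smooth_cst (c := psi p))) (derive1n_cst (psi p)) subr0.
  rewrite (derive1n_affine e p i.+1 psis) normrM normrX (gtr0_norm e0) exprS.
  have ei : e ^+ i <= 1 by rewrite exprn_ile1// ltW.
  have bi : `|derive1n i.+1 psi (e * z + p)| <= B by apply: psiB; rewrite ltnW.
  rewrite mulrAC -[leRHS]mulrC; rewrite -mulrA ler_wpM2l ?(ltW e0)// .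
  rewrite (le_trans (ler_pM _ _ bi ei)) ?exprn_ge0 ?(ltW e0)// mulr1; lra.
have j2 : jet_bound N A 1 (@plateau R) z by move=> i iN; rewrite expr1n mulr1; exact: plA.
have := jet_bound_mul fs (@plateau_smooth R) ler01 j1 j2 kN.
rewrite expr1n mulr1 => /le_trans; apply; rewrite le_eqVlt; apply/orP; left; apply/eqP; ring.
Qed.

(** A nonnegative [psi] is split by a plateau of width [e] at [p]. The inner part tends to 0:
    [psi p] times the plateau by [derivative_vanishes], the rest by [difference_dilate_bound] and
    tameness of exponent 0. The outer part lives where [w] is positive. *)
Lemma pos_near_isolated w W p l rho : is_derivative_of w W -> has_point_value W p l -> 0 < rho ->
  (forall x, x != p -> `|x - p| < rho -> pos_near w x) -> pos_near w p.
Proof.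
move=> wW Wl rho0 H; exists (rho / 2); first lra.
move=> psi tpsi psi0 psiE; have psis := test_smooth tpsi.
have pls := @plateau_smooth R.
have lim0 : w (fun y => psi y * plateau ((y - p) / e)) @[e --> 0^'+] --> 0.
  have [N [C [C0 CH]]] := derivative_tame wW Wl 2.
  have [K K0 KH] := difference_dilate_bound p N tpsi.
  have /right_limP lim1 := derivative_vanishes wW Wl (plateau_test R).
  apply/right_limP => e e0.
  have Q0 : 0 < 2 * (`|psi p| + 1) by rewrite mulr_gt0// ltr_wpDl.
  have P0 : 0 < 2 * (C * K + 1) by rewrite mulr_gt0// ltr_wpDl// mulr_ge0.
  have [r r0 rH] := lim1 (e / (2 * (`|psi p| + 1))) (divr_gt0 e0 Q0).
  exists (Num.min r (Num.min 1 (e / (2 * (C * K + 1))))).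
    by rewrite !lt_min r0 ltr01 divr_gt0.
  move=> t t0; rewrite !lt_min ltr_pdivlMr// => /and3P[tr /ltW t1 te].
  have tn0 : t != 0 by rewrite gt_eqF.
  have := rH t t0 tr; rewrite !subr0 ler_pdivlMr// => h1.
  pose phi z := (psi (p + t * z) - psi p) * plateau z.
  have phis : test_function phi.
    apply/test_functionP; split; last first.
      by exists 2 => // x x2; rewrite /phi plateau_eq0 ?mulr0// ltW.
    have -> : phi = fun z => (psi (t * z + p) - psi p) * plateau z.
      by apply/funext => z; rewrite /phi (addrC p).
    exact (smooth_mul (smooth_sub (smooth_affine (c := t) (p := p) psis) (smooth_cst (c := psi p))) pls).
  have phi2 : ball_supported 2 phi by move=> x x2; rewrite /phi plateau_eq0 ?mulr0// ltW.
  have := CH t phi _ t0 t1 phis phi2 (KH t t0 t1); rewrite expr0 mulr1 => h2.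
  have -> : (fun y => psi y * plateau ((y - p) / t)) =
      fun y => psi p * plateau ((y - p) / t) + phi ((y - p) / t).
    apply/funext => y; rewrite /phi -[t * _]mulrC divfK// [p + _]addrC subrK.
    ring.
  rewrite (dist_lin w _ (test_dilate p tn0 (plateau_test R)) (test_dilate p tn0 phis)).
  rewrite (le_trans (ler_normD _ _))// normrM.
  have : `|psi p| * `|w (fun y => plateau ((y - p) / t))| * 2 <= e.
    rewrite (le_trans _ h1)// mulrC mulrA mulrC ler_wpM2l// ler_wpM2l//; lra.
  have : C * (K * t) * 2 <= e by have := ltW t0; lra.
  lra.
(* The remainder is nonnegative and vanishes within [e] of [p]. The step at [p] cuts it into a left
   and a right half, each inside an interval that avoids [p]. *)
have ge e : 0 < e -> w (fun y => psi y * plateau ((y - p) / e)) <= w psi.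
  move=> e0.
  have pe : smooth (fun y => plateau ((y - p) / e)) := smooth_dilate (p := p) (t := e) pls.
  have se : smooth (fun y => sstep ((y - p) / e)) := smooth_dilate (p := p) (t := e) (@sstep_smooth R).
  have t1 : test_function (fun y => psi y * plateau ((y - p) / e)) := test_mul tpsi pe.
  have t2 : test_function (fun y => psi y - psi y * plateau ((y - p) / e)) := test_sub tpsi t1.
  have t3 : test_function (fun y => sstep ((y - p) / e) * (psi y - psi y * plateau ((y - p) / e))) :=
    test_mulr se t2.
  have n2 y : 0 <= psi y - psi y * plateau ((y - p) / e).
    by rewrite subr_ge0 ler_piMr// plateau_le1.
  have z2 y : `|y - p| <= e -> psi y - psi y * plateau ((y - p) / e) = 0.
    by move=> ye; rewrite plateau_eq1 ?mulr1 ?subrr// normrM normfV (gtr0_norm e0) ler_pdivrMr// mul1r.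
  have zo y : ~~ (p - rho / 2 < y < p + rho / 2) -> psi y - psi y * plateau ((y - p) / e) = 0.
    by move=> /psiE ->; rewrite mul0r subr0.
  have p3 : 0 <= w (fun y => sstep ((y - p) / e) * (psi y - psi y * plateau ((y - p) / e))).
    have : pos_on w (p + e) (p + rho / 2).
      apply: pos_on_glue => x /andP[x1 x2]; apply: H; first by rewrite gt_eqF//; lra.
      by rewrite ger0_norm; lra.
    apply=> //.
      by move=> y; rewrite mulr_ge0//; exact: sstep_ge0.
    move=> y ny; have [ye|ye] := leP y p.
      by rewrite sstep_eq0 ?mul0r// ler_pdivrMr// mul0r subr_le0.
    have [ye'|ye'] := leP y (p + e); first by rewrite z2 ?mulr0// ger0_norm; lra.
    rewrite zo ?mulr0//; apply: contra ny => /andP[_ ->]; rewrite andbT; lra.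
  have p4 : 0 <= w (fun y => (psi y - psi y * plateau ((y - p) / e)) -
      sstep ((y - p) / e) * (psi y - psi y * plateau ((y - p) / e))).
    have : pos_on w (p - rho / 2) (p - e).
      apply: pos_on_glue => x /andP[x1 x2]; apply: H; first by rewrite lt_eqF//; lra.
      by rewrite ler0_norm; lra.
    apply; first exact (test_sub t2 t3).
      by move=> y; rewrite -[X in X - _]mul1r -mulrBl mulr_ge0// subr_ge0; exact: sstep_le1.
    move=> y ny; have [ye|ye] := leP (p + e) y.
      by rewrite sstep_eq1 ?mul1r ?subrr// ler_pdivlMr// mul1r; lra.
    have [ye'|ye'] := leP (p - e) y; first by rewrite z2 ?mulr0 ?subrr// ler_norml; apply/andP; split; lra.
    rewrite zo ?mulr0 ?subrr//; apply: contra ny => /andP[-> _]; lra.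
  move: p4; rewrite (dist_sub w t2 t3) (dist_sub w tpsi t1); lra.
have /right_limP H0 := lim0.
rewrite leNgt; apply/negP => neg.
have [|r r0 rH] := H0 (- w psi / 2); first lra.
have r20 : 0 < r / 2 by lra.
have := rH (r / 2) r20; rewrite subr0 => /(_ _)/ler_normlP h.
have [|_ _] := h _; first lra.
have := ge _ r20; have [|] := h _; first lra.
lra.
Qed.

End Positivity.

(** * The Poisson extension near a boundary point, inside and outside a cone *)

Section Corner.
Variable R : realType.
Implicit Types (f k phi psi theta : R -> R) (a b c d e p r s t u x y z rho : R).
Implicit Types (w W : schwartz_distribution R).

(** [theta] makes the kernel a test function; when it is 1 near the support of [w], this is the
    harmonic extension of [w] to the upper half-plane. *)
Definition poisson_ext w theta x t := t^-1 * w (fun y => theta y * poisson ((y - x) / t)).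

(** In the cone [|x - p| <= t] the kernels centred at [x] are bounded shifts of those at [p], so
    tameness of exponent 0 bounds the horizontal derivative by a multiple of [t^-2]. *)
Lemma poisson_ext_vertical w theta p : tame 0 w p -> test_function theta ->
  exists2 C, 0 <= C & forall x t, 0 < t -> t <= 1 -> `|x - p| <= t ->
  `|poisson_ext w theta x t - poisson_ext w theta p t| <= C * `|x - p| / t ^+ 2.
Proof.
move=> tw tth; have [|N [C [C0 CH]]] := tame_symbol tw tth (a := -1); first lra.
have [B PB] := @poisson_symbol R N.+1; have B0 := symbol_ge0 PB.
have ps := @poisson_smooth R; have ps' := smooth_derive1 ps.
pose D := C * (5 ^+ N.+1 * B).
exists D => [|x t t0 t1 xt]; first by rewrite !mulr_ge0.
have tn0 : t != 0 by rewrite gt_eqF.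
pose F x := w (fun y => theta y * poisson ((y - x) / t)).
pose F' x := - t^-1 * w (fun y => theta y * derive1 (@poisson R) ((y - x) / t)).
have dF (v : R) : is_derive v 1 F (F' v) := dist_derive_shift w v t0 tth ps.
have bF v : Num.min p x <= v <= Num.max p x -> `|F' v| <= t^-1 * D.
  move=> vx; have vt : `|v - p| <= t.
    move: vx xt; rewrite ler_norml; case: (leP p x) => px; rewrite ?(min_idPl _) /= => /andP[? ?] /andP[? ?];
    rewrite ler_norml; apply/andP; split; lra.
  rewrite normrM normrN normfV (gtr0_norm t0) ler_wpM2l ?invr_ge0 ?(ltW t0)//.
  have s4 : `|(v - p) / t| <= 4.
    rewrite normrM normfV (gtr0_norm t0) ler_pdivrMr//; lra.
  have := CH t _ _ t0 t1 _ (symbol_shift ps' s4 (symbol_derive1 PB)); rewrite expr0 mulr1.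
  have -> : (fun y => theta y * derive1 (@poisson R) ((y - p) / t - (v - p) / t)) =
      fun y => theta y * derive1 (@poisson R) ((y - v) / t).
    by apply/funext => y; rewrite -mulrBl opprB addrA subrK.
  apply.
  have := smooth_affine (c := 1) (p := - ((v - p) / t)) ps'.
  by under eq_fun do rewrite mul1r.
have := mvt_norm_le (fun v _ => dF v) bF.
rewrite /poisson_ext -mulrBr normrM normfV (gtr0_norm t0) -/(F x) -/(F p) => h.
rewrite (le_trans (ler_wpM2l _ h)) ?invr_ge0 ?(ltW t0)//.
by rewrite le_eqVlt; apply/orP; left; apply/eqP; field.
Qed.

(** The part of the kernel within [d / 2] of [x] contributes a nonnegative amount. Seen from [p] at
    scale [d / 4], the rest is [(t / d)^2] times a symbol bounded uniformly in the height; with the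
    outer factor [t^-1] this leaves [O(t / d^2)]. *)
Lemma poisson_ext_side w theta p : tame 0 w p -> test_function theta -> (forall y, 0 <= theta y) ->
  exists2 C, 0 <= C & forall x t d, 0 < t -> d = `|x - p| -> 0 < d -> d <= 1 ->
  pos_on w (x - d / 2) (x + d / 2) -> - (C * t / d ^+ 2) <= poisson_ext w theta x t.
Proof.
move=> tw tth th0; have [|N [C [C0 CH]]] := tame_symbol tw tth (a := -1); first lra.
have [B B0 QB] := @cauchyq_far_symbol R N.
have pi0 : 0 < (pi : R) := pi_gt0 R.
have ps := @poisson_smooth R; have pls := @plateau_smooth R.
pose D := C * (5 ^+ N.+1 * (pi^-1 * B)).
have D0 : 0 <= D by rewrite !mulr_ge0// invr_ge0 ltW.
exists (16 * D) => [|x t d t0 dE d0 d1 pos]; first by rewrite mulr_ge0.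
have tn0 : t != 0 by rewrite gt_eqF.
have dn0 : d != 0 by rewrite gt_eqF.
(* The plateau at scale [r] reaches to [2 r = d / 2], the radius of positivity; [tau] is the height
   in this scale, and [tau^2] produces the constant 16. *)
pose r := d / 4; have r0 : 0 < r by rewrite divr_gt0.
have rn0 : r != 0 by rewrite gt_eqF.
have r1 : r <= 1 by rewrite /r; lra.
pose tau := t / r; have tau0 : 0 < tau by rewrite divr_gt0.
pose s := (x - p) / r; have s4 : `|s| <= 4.
  by rewrite /s normrM normfV (gtr0_norm r0) -dE ler_pdivrMr// /r mulrC divfK.
have p1 : smooth (fun y => poisson ((y - x) / t)) := smooth_dilate (p := x) (t := t) ps.
have p2 : smooth (fun y => plateau ((y - x) / r)) := smooth_dilate (p := x) (t := r) pls.
have p3 := test_mul tth p1.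
have t1 : test_function (fun y => theta y * poisson ((y - x) / t) * plateau ((y - x) / r)) := test_mul p3 p2.
have t2 := test_sub p3 t1.
have E : (fun y => theta y * poisson ((y - x) / t)) = fun y =>
    theta y * poisson ((y - x) / t) * plateau ((y - x) / r) +
    (theta y * poisson ((y - x) / t) - theta y * poisson ((y - x) / t) * plateau ((y - x) / r)).
  by apply/funext => y; rewrite addrCA subrr addr0.
have ge1 : 0 <= w (fun y => theta y * poisson ((y - x) / t) * plateau ((y - x) / r)).
  apply: pos; first exact t1.
    move=> y; have h0 := mulr_ge0 (th0 y) (poisson_ge0 ((y - x) / t)).
    exact (mulr_ge0 h0 (plateau_ge0 ((y - x) / r))).
  move=> y ny; rewrite plateau_eq0 ?mulr0//.
  rewrite normrM normfV (gtr0_norm r0) ler_pdivlMr// /r.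
  rewrite leNgt; apply: contra ny; rewrite ltr_norml => /andP[? ?]; apply/andP; split; lra.
have [k [ks kB kE]] : exists k, [/\ smooth k, symbol N (-1) (5 ^+ N.+1 * (pi^-1 * tau ^+ 2 * B)) k &
    forall y, theta y * k ((y - p) / r) =
    theta y * poisson ((y - x) / t) - theta y * poisson ((y - x) / t) * plateau ((y - x) / r)].
  pose q u := (pi^-1 * tau ^+ 2) * (cauchyq tau u * (1 - plateau u)).
  have qs0 : smooth (fun u : R => cauchyq tau u * (1 - plateau u)) :=
    smooth_mul (cauchyq_smooth tau0) (@smooth_1plateau R).
  have qs : smooth q := smooth_scal (c := pi^-1 * tau ^+ 2) qs0.
  have qB : symbol N (-1) (pi^-1 * tau ^+ 2 * B) q.
    move=> z m mN; rewrite (derive1n_scal (pi^-1 * tau ^+ 2) m qs0) normrM.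
    have q0 : 0 <= pi^-1 * tau ^+ 2 by apply: mulr_ge0; [rewrite invr_ge0 ltW|exact: sqr_ge0].
    rewrite (ger0_norm q0) -2!(mulrA (pi^-1 * _)) (ler_wpM2l q0)//.
    exact: (QB tau tau0 z).
  exists (fun z => q (z - s)); split.
  - have := smooth_affine (c := 1) (p := - s) qs.
    by under eq_fun do rewrite mul1r.
  - exact: symbol_shift.
  - move=> y.
    have -> : (y - p) / r - s = (y - x) / r by rewrite /s -mulrBl opprB addrA subrK.
    rewrite -mulrA -mulrBr; congr (_ * _).
    rewrite -[X in _ = X - _]mulr1 -mulrBr /q mulrA; congr (_ * _).
    rewrite /poisson -mulrA; congr (_ * _).
    rewrite /cauchyq expr1n /tau; field.
    rewrite tn0 rn0 /=.
    have sq : 0 < t ^+ 2 + (y - x) ^+ 2 by exact: cauchyq_den_gt0.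
    by rewrite andbT; exact: lt0r_neq0.
have ge2 : `|w (fun y => theta y * poisson ((y - x) / t) -
    theta y * poisson ((y - x) / t) * plateau ((y - x) / r))| <= D * tau ^+ 2.
  have := CH r k _ r0 r1 ks kB; rewrite expr0 mulr1.
  rewrite (funext kE) => /le_trans; apply; rewrite /D le_eqVlt; apply/orP; left; apply/eqP; ring.
rewrite /poisson_ext E (dist_add w t1 t2) mulrDr.
move: ge1 ge2; set A := w _; set A' := w _ => ge1 ge2.
have : 0 <= t^-1 * A by rewrite mulr_ge0 ?invr_ge0 ?(ltW t0).
have : - (t^-1 * (D * tau ^+ 2)) <= t^-1 * A'.
  rewrite -mulrN ler_wpM2l ?invr_ge0 ?(ltW t0)//.
  by move: ge2; rewrite ler_norml => /andP[].
have -> : t^-1 * (D * tau ^+ 2) = 16 * D * t / d ^+ 2 by rewrite /tau /r; field; rewrite tn0 dn0.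
lra.
Qed.

End Corner.

(** * A minimum principle on rectangles *)

Section MinimumPrinciple.
Variable R : realType.
Implicit Types (f : R -> R) (a b c d e p r s t u x y z : R) (v : R -> R -> R).

(** If [f2] were negative, [f'] would lie below the line of slope [f2 / 2] to the right of [x0], and
    comparison with a parabola would give a smaller value of [f] there. *)
Lemma second_derivative_min f (f' : R -> R) x0 (f2 : R) r : 0 < r ->
  (forall x, `|x - x0| < r -> is_derive x 1 f (f' x)) -> is_derive x0 1 f' f2 ->
  (forall x, `|x - x0| < r -> f x0 <= f x) -> 0 <= f2.
Proof.
move=> r0 df df' fmin; rewrite leNgt; apply/negP => f20.
have f'0 : f' x0 = 0.
  have x0r : x0 \in `](x0 - r), (x0 + r)[%R by rewrite in_itv /=; apply/andP; split; lra.
  have inr x : x \in `](x0 - r), (x0 + r)[%R -> `|x - x0| < r.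
    by rewrite in_itv /= ltr_norml => /andP[? ?]; apply/andP; split; lra.
  have H : is_derive x0 1 f 0.
    apply: (@derive1_at_min _ f (x0 - r) (x0 + r)) => //; first lra.
    - by move=> x /inr xr; have [] := df x xr.
    - by move=> x /inr; exact: fmin.
  have dx0 := df x0; rewrite subrr normr0 in dx0.
  exact: is_derive_uniq (dx0 r0) H.
have e0 : 0 < - f2 / 2 by lra.
have [s s0 sH] := (is_derive_epsP _ _ _).1 df' _ e0.
pose h := Num.min r s / 2.
have ms0 : 0 < Num.min r s by rewrite lt_min r0.
have mr : Num.min r s <= r by rewrite ge_min lexx.
have ms : Num.min r s <= s by rewrite ge_min lexx orbT.
have h0 : 0 < h by rewrite divr_gt0.
have hr : h < r by rewrite /h; lra.
have hs : h < s by rewrite /h; lra.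
have H x : x0 <= x <= x0 + h -> 0 <= - f' x + f2 / 2 * (x - x0).
  move=> /andP[x1 x2]; have xs : `|x - x0| < s by rewrite ger0_norm; lra.
  have := sH _ xs; rewrite (_ : x0 + (x - x0) = x) ?f'0 ?subr0 ?(ger0_norm (x := x - x0)); try ring; try lra.
  rewrite ler_norml => /andP[_]; lra.
have xh : x0 <= x0 + h by lra.
have D x : x0 <= x <= x0 + h ->
    is_derive x 1 (fun y => - f y + f2 / 4 * (y - x0) ^+ 2) (- f' x + f2 / 2 * (x - x0)).
  move=> /andP[x1 x2]; have xr : `|x - x0| < r by rewrite ger0_norm; lra.
  have D1 := is_derive_pow 2 (is_derive_sub (is_derive_var x) (is_derive_cstl x x0)).
  have := is_derive_add (is_derive_opp (df x xr)) (is_derive_scal (f2 / 4) D1).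
  by rewrite expr1 (_ : f2 / 4 * _ = f2 / 2 * (x - x0)) //; field.
have := le_of_derive_ge0 xh D H.
rewrite subrr expr0n /= mulr0 addr0 (_ : x0 + h - x0 = h); last ring.
have hh : 0 < h ^+ 2 by rewrite exprn_gt0.
have : f x0 <= f (x0 + h) by apply: fmin; rewrite addrC addKr ger0_norm ?(ltW h0).
have : f2 / 4 * h ^+ 2 < 0 by rewrite pmulr_llt0//; lra.
lra.
Qed.

(** Composition with [clamp] extends a function on the rectangle continuously to the plane, which is
    the form in which compactness is applied. *)
Definition clamp a b x := Num.max a (Num.min b x).

Lemma clamp_in a b x : a <= b -> a <= clamp a b x <= b.
Proof. by move=> ab; rewrite /clamp le_max lexx /= ge_max ab ge_min lexx. Qed.

Lemma clamp_id a b x : a <= x <= b -> clamp a b x = x.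
Proof. by move=> /andP[ax xb]; rewrite /clamp (min_idPr xb) (max_idPr ax). Qed.

Lemma clamp_lipschitz a b x y : a <= b -> `|clamp a b x - clamp a b y| <= `|x - y|.
Proof.
move=> ab; rewrite /clamp; have := ler_norm (x - y); have := ler_norm (y - x); rewrite distrC.
have := normr_ge0 (x - y).
by case: (leP b x) => bx; case: (leP b y) => by_; rewrite ?(max_idPr ab);
  [|case: (leP a y)|case: (leP a x)|case: (leP a x); case: (leP a y)] => *;
  rewrite ler_norml; apply/andP; split; lra.
Qed.

Lemma box_minimum v a b t1 t2 L : a <= b -> t1 <= t2 ->
  (forall x y t s, a <= x <= b -> a <= y <= b -> t1 <= t <= t2 -> t1 <= s <= t2 ->
    `|v x t - v y s| <= L * (`|x - y| + `|t - s|)) ->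
  exists x0 t0, [/\ a <= x0 <= b, t1 <= t0 <= t2 &
    forall x t, a <= x <= b -> t1 <= t <= t2 -> v x0 t0 <= v x t].
Proof.
move=> ab t12 vL.
pose f (q : R * R) := v (clamp a b q.1) (clamp t1 t2 q.2).
have vL' (q q' : R * R) : `|f q - f q'| <= (`|L| + 1) * (`|q.1 - q'.1| + `|q.2 - q'.2|).
  rewrite (le_trans (vL _ _ _ _ (clamp_in _ ab) (clamp_in _ ab) (clamp_in _ t12) (clamp_in _ t12)))//.
  have LL : L <= `|L| + 1 by have := ler_norm L; lra.
  rewrite (le_trans (ler_wpM2r _ LL)) ?addr_ge0// ler_wpM2l ?addr_ge0//.
  by apply: lerD; exact: clamp_lipschitz.
have cf : continuous f.
  move=> q; apply/cvgrPdist_le => e e0.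
  have c1 : fst q' @[q' --> q] --> q.1 by exact: cvg_fst.
  have c2 : snd q' @[q' --> q] --> q.2 by exact: cvg_snd.
  have k0 : 0 < e / (`|L| + 1) / 2 by rewrite !divr_gt0// ltr_wpDl.
  near=> q'; rewrite (le_trans (vL' _ _))// -ler_pdivlMl; last by rewrite ltr_wpDl.
  rewrite mulrC (splitr (e / _)) lerD//.
    near: q'; move/cvgrPdist_le: c1; exact.
  near: q'; move/cvgrPdist_le: c2; exact.
have [|||[x0 t0]] := @compact_EVT_min _ R f (`[a, b] `*` `[t1, t2]).
- by exists (a, t1); split; rewrite /= in_itv /= lexx.
- by apply: compact_setX; exact: segment_compact.
- exact: continuous_subspaceT.
rewrite inE => -[/= x0ab t0ab] fmin.
rewrite !in_itv /= in x0ab t0ab.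
exists x0, t0; split=> // x t xab tab.
have := fmin (x, t); rewrite /f /= !clamp_id//; apply.
by rewrite inE; split; rewrite /= in_itv.
Unshelve. all: by end_near. Qed.

(** A negative minimum would be interior, where both second derivatives are nonnegative. The
    Laplacian is taken strictly negative so that this is already a contradiction; callers perturb a
    harmonic function to get there. *)
Lemma minimum_principle v vx vt vxx vtt a b t1 t2 L : a < b -> t1 < t2 ->
  (forall x t, t1 <= t <= t2 -> [/\ is_derive x 1 (v^~ t) (vx x t),
    is_derive x 1 (vx^~ t) (vxx x t), is_derive t 1 (v x) (vt x t) &
    is_derive t 1 (vt x) (vtt x t)]) ->
  (forall x t, t1 <= t <= t2 -> `|vx x t| <= L /\ `|vt x t| <= L) ->
  (forall x t, t1 < t < t2 -> vxx x t + vtt x t < 0) ->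
  (forall x, a <= x <= b -> 0 <= v x t1 /\ 0 <= v x t2) ->
  (forall t, t1 <= t <= t2 -> 0 <= v a t /\ 0 <= v b t) ->
  forall x t, a <= x <= b -> t1 <= t <= t2 -> 0 <= v x t.
Proof.
move=> ab t12 dv bv lap hor ver x t xab tab.
have lip x1 x2 s1 s2 : a <= x1 <= b -> a <= x2 <= b -> t1 <= s1 <= t2 -> t1 <= s2 <= t2 ->
    `|v x1 s1 - v x2 s2| <= L * (`|x1 - x2| + `|s1 - s2|).
  move=> _ _ s1t s2t.
  have -> : v x1 s1 - v x2 s2 = (v x1 s1 - v x2 s1) + (v x2 s1 - v x2 s2) by ring.
  rewrite (le_trans (ler_normD _ _))// mulrDr lerD//.
    apply: (mvt_norm_le (f := v^~ s1) (f' := vx^~ s1)) => y _; first by have [] := dv y s1 s1t.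
    by have [] := bv y s1 s1t.
  apply: (mvt_norm_le (f := v x2) (f' := vt x2)) => y yt.
    have yt' : t1 <= y <= t2.
      by move: yt s1t s2t; case: (leP s2 s1) => ? /andP[? ?] /andP[? ?] /andP[? ?]; apply/andP; split; lra.
    by have [] := dv x2 y yt'.
  have yt' : t1 <= y <= t2.
    by move: yt s1t s2t; case: (leP s2 s1) => ? /andP[? ?] /andP[? ?] /andP[? ?]; apply/andP; split; lra.
  by have [] := bv x2 y yt'.
have [x0 [t0 [x0ab t0ab vmin]]] := box_minimum (ltW ab) (ltW t12) lip.
apply: (le_trans _ (vmin x t xab tab)); rewrite leNgt; apply/negP => neg.
move: x0ab t0ab (x0ab) (t0ab) => /andP[x0a x0b] /andP[t0a t0b] x0ab t0ab.
have xa : a < x0.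
  by rewrite lt_neqAle x0a andbT; apply/eqP => E; have [] := ver t0 t0ab; rewrite E leNgt neg.
have xb : x0 < b.
  by rewrite lt_neqAle x0b andbT; apply/eqP => E; have [_] := ver t0 t0ab; rewrite -E leNgt neg.
have ta : t1 < t0.
  by rewrite lt_neqAle t0a andbT; apply/eqP => E; have [] := hor x0 x0ab; rewrite E leNgt neg.
have tb : t0 < t2.
  by rewrite lt_neqAle t0b andbT; apply/eqP => E; have [_] := hor x0 x0ab; rewrite -E leNgt neg.
have [_ dxx _ dtt] := dv x0 t0 t0ab.
have rx : 0 < Num.min (x0 - a) (b - x0) by rewrite lt_min !subr_gt0 xa.
have rt : 0 < Num.min (t0 - t1) (t2 - t0) by rewrite lt_min !subr_gt0 ta.
have h1 : 0 <= vxx x0 t0.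
  apply: (second_derivative_min (f := v^~ t0) rx _ dxx) => y; first by have [] := dv y t0 t0ab.
  rewrite lt_min !ltr_norml => /andP[/andP[? ?] /andP[? ?]]; apply: vmin => //.
  by apply/andP; split; lra.
have h2 : 0 <= vtt x0 t0.
  apply: (second_derivative_min (f := v x0) rt _ dtt) => y;
    rewrite lt_min !ltr_norml => /andP[/andP[? ?] /andP[? ?]];
    have yt : t1 <= y <= t2 by apply/andP; split; lra.
    by have [] := dv x0 y yt.
  exact: vmin.
have : t1 < t0 < t2 by rewrite ta.
move=> /(lap x0); lra.
Qed.

End MinimumPrinciple.

(** * Harmonicity of the Poisson extension *)

Section Harmonic.
Variable R : realType.
Implicit Types (f k phi psi theta : R -> R) (a b c d e p r s t u x y z rho tau : R).
Implicit Types (w W : schwartz_distribution R).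

(** The kernel decays one power faster than a symbol of order -1, which pays for the factor [z] in
    [euler]. *)
Lemma poisson_euler_norm_bound (N : nat) : exists B, norm_bound N B (fun z : R => poisson z + euler (@poisson R) z).
Proof.
have [C C0 CH] := @poisson_bound R N.+1.
have ps := @poisson_smooth R.
exists (N.+2%:R * C) => k z kN.
rewrite (derive1n_add k ps (euler_smooth ps)) (derive1n_euler k z ps).
have z0 : 0 < 1 + `|z| by rewrite ltr_pwDl.
have i0 : 0 <= (1 + `|z|)^-1 by rewrite invr_ge0 ltW.
have i1 : (1 + `|z|)^-1 <= 1 by rewrite invf_le1 ?ltr_pwDl// lerDl.
have b1 : `|derive1n k (@poisson R) z| <= C.
  by apply: (le_trans (CH k z (leqW kN))); apply: ler_piMr; [exact: C0|apply: exprn_ile1].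
have b2 : `|z * derive1n k.+1 (@poisson R) z| <= C.
  rewrite normrM (le_trans (ler_wpM2l (normr_ge0 z) (CH k.+1 z kN)))//.
  rewrite exprSr (_ : _ * (C * _) = C * ((1 + `|z|)^-1 ^+ k.+2 * (`|z| * (1 + `|z|)^-1))); last ring.
  apply: ler_piMr; first exact: C0.
  apply: mulr_ile1; [exact: exprn_ge0|exact: mulr_ge0|exact: exprn_ile1|].
  by rewrite ler_pdivrMr// mul1r lerDr.
move: b1 b2; move: (derive1n k _ z) (z * _) => A B b1 b2.
rewrite (_ : A + (k%:R * A + B) = k.+1%:R * A + B); last by rewrite -[in RHS]natr1; ring.
rewrite (le_trans (ler_normD _ _))// -[N.+2%:R]natr1 mulrDl mul1r lerD//.
by rewrite normrM normr_nat; apply: ler_pM => //; rewrite ler_nat.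
Qed.

(* ux, ut, uxx, utt are the partial derivatives of the Poisson extension; each is again w paired
   with a dilated kernel, which gives the bounds. *)
Lemma poisson_ext_harmonic w theta : test_function theta ->
  exists ux ut uxx utt : R -> R -> R,
  [/\ forall x t, 0 < t -> [/\ is_derive x 1 ((poisson_ext w theta)^~ t) (ux x t),
        is_derive x 1 (ux^~ t) (uxx x t), is_derive t 1 (poisson_ext w theta x) (ut x t) &
        is_derive t 1 (ut x) (utt x t)],
      forall x t, 0 < t -> uxx x t + utt x t = 0 &
      forall tau, 0 < tau -> exists L, forall x t, tau <= t -> t <= 1 ->
        `|ux x t| <= L /\ `|ut x t| <= L].
Proof.
move=> tth; have ps := @poisson_smooth R.
pose Q z := poisson z + euler (@poisson R) z.
have ps1 := smooth_derive1 ps; have ps2 := smooth_derive1 ps1.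
have Qs : smooth Q := smooth_add ps (euler_smooth ps).
pose F k x t := w (fun y => theta y * k ((y - x) / t)).
have dFx k x t : 0 < t -> smooth k -> is_derive x 1 (F k ^~ t) (- t^-1 * F (derive1 k) x t).
  by move=> t0 ks; exact (dist_derive_shift w x t0 tth ks).
have dFt k x t : 0 < t -> smooth k -> is_derive t 1 (F k x) (- t^-1 * F (euler k) x t).
  by move=> t0 ks; exact (dist_derive_dilate w x t0 tth ks).
have Ft k x t : smooth k -> test_function (fun y => theta y * k ((y - x) / t)).
  by move=> ks; exact (test_mul tth (smooth_dilate (p := x) (t := t) ks)).
have FQ x t : F Q x t = F (@poisson R) x t + F (euler (@poisson R)) x t.
  rewrite /F -(dist_add w (Ft _ x t ps) (Ft _ x t (euler_smooth ps))).
  by congr (w _); apply/funext => y; rewrite mulrDr.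
exists (fun x t => - t^-1 ^+ 2 * F (derive1 (@poisson R)) x t), (fun x t => - t^-1 ^+ 2 * F Q x t),
  (fun x t => t^-1 ^+ 3 * F (derive1 (derive1 (@poisson R))) x t),
  (fun x t => t^-1 ^+ 3 * (2 * F Q x t + F (euler Q) x t)).
split.
- move=> x t t0; have tn0 : t != 0 by rewrite gt_eqF.
  have dti : is_derive t 1 (fun t => t^-1) (- t^-1 ^+ 2).
    by have := is_derive_recip tn0 (is_derive_var t); rewrite mulN1r -exprVn.
  split.
  + have := is_derive_scal t^-1 (dFx _ x t t0 ps).
    by rewrite mulrA mulrN -expr2.
  + have := is_derive_scal (- t^-1 ^+ 2) (dFx _ x t t0 ps1).
    by rewrite mulrA mulrNN -exprSr.
  + have := is_derive_mul dti (dFt _ x t t0 ps).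
    by rewrite (_ : _ + _ = - t^-1 ^+ 2 * F Q x t)// FQ; ring.
  + have d2 : is_derive t 1 (fun t => - t^-1 ^+ 2) (2 * t^-1 ^+ 3).
      have := is_derive_opp (is_derive_pow 2 dti).
      by rewrite expr1 mulrN opprK (_ : 2 * t^-1 * _ = 2 * t^-1 ^+ 3) // [in RHS]exprS mulrA.
    have := is_derive_mul d2 (dFt _ x t t0 Qs).
    rewrite (_ : _ + _ = t^-1 ^+ 3 * (2 * F Q x t + F (euler Q) x t))//; ring.
- move=> x t t0; rewrite -mulrDr (_ : _ + _ = 0) ?mulr0//.
  have eQs := euler_smooth Qs.
  have E2 := dist_lin w 2 (Ft _ x t Qs) (Ft _ x t eQs).
  have t2 := test_lin 2 (Ft _ x t Qs) (Ft _ x t eQs).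
  rewrite /F -E2 -(dist_add w (Ft _ x t ps2) t2) -[RHS](dist0 w); congr (w _); apply/funext => y.
  rewrite (mulrCA 2) -!mulrDr.
  have := poisson_harmonic ((y - x) / t); rewrite -addrA => ->; exact: mulr0.
- move=> tau tau0; have [_ [M M0 thM]] := (test_functionP theta).1 tth.
  have ths := test_smooth tth.
  have [N [C [C0 CH]]] := dist_bound w M.
  have [A thA] := test_norm_bound N tth; have A0 := norm_bound_ge0 thA.
  have bd k B : smooth k -> norm_bound N B k -> forall x t, tau <= t -> t <= 1 ->
      `|- t^-1 ^+ 2 * F k x t| <= tau^-1 ^+ 2 * (C * (2 ^+ N * A * (tau^-1 ^+ N * B))).
    move=> ks kB x t taut t1; have t0 : 0 < t := lt_le_trans tau0 taut.
    have B0 := norm_bound_ge0 kB.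
    have ti : t^-1 <= tau^-1 by rewrite lef_pV2.
    have ti0 : 0 <= t^-1 by rewrite invr_ge0 ltW.
    have taui0 : 0 <= tau^-1 by rewrite invr_ge0 ltW.
    rewrite normrM normrN ler_pM//.
      by rewrite ger0_norm ?exprn_ge0// lerXn2r.
    apply: CH; first exact: Ft.
      by move=> y yM; rewrite thM ?mul0r.
    apply: (norm_bound_mul ths (smooth_dilate (p := x) (t := t) ks) thA).
    apply: norm_bound_le (norm_bound_dilate x t0 t1 ks kB).
    by apply: (ler_wpM2r B0); apply: lerXn2r.
  have [B1 PB1] := @poisson_symbol R N.+1.
  have P1 : norm_bound N B1 (derive1 (@poisson R)).
    by apply: (symbol_norm_bound (a := -1)); [lra|exact: symbol_derive1].
  have [B2 PB2] := poisson_euler_norm_bound N.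
  exists (Num.max (tau^-1 ^+ 2 * (C * (2 ^+ N * A * (tau^-1 ^+ N * B1))))
    (tau^-1 ^+ 2 * (C * (2 ^+ N * A * (tau^-1 ^+ N * B2))))) => x t taut t1.
  rewrite !le_max; split; apply/orP; [left|right]; exact: bd.
Qed.

End Harmonic.

(** * Lower bounds over the gaps, with dipoles at the corners *)

Section Slab.
Variable R : realType.
Implicit Types (f k phi psi theta : R -> R) (a b c d e p r s t u x y z rho tau : R).
Implicit Types (w W : schwartz_distribution R).

(** The added term is [- c] times the derivative of the Dirac mass at [p]. *)
Lemma dist_add_dipole w p c : exists w' : schwartz_distribution R,
  forall psi, test_function psi -> w' psi = w psi + c * derive1 psi p :> R.
Proof.
have lin (c' : R) phi psi : test_function phi -> test_function psi ->
    w (fun x => c' * phi x + psi x) + c * derive1 (fun x => c' * phi x + psi x) p =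
    c' * (w phi + c * derive1 phi p) + (w psi + c * derive1 psi p).
  move=> tphi tpsi; rewrite (dist_lin w c' tphi tpsi).
  have -> : derive1 (fun x => c' * phi x + psi x) p = c' * derive1 phi p + derive1 psi p.
    exact: (congr1 (fun f => f p) (derive1n_lin c' 1 (test_smooth tphi) (test_smooth tpsi))).
  ring.
have cont (M : R) : exists (N : nat) (C : R), forall phi, test_function phi ->
    (forall x, M < `|x| -> phi x = 0) -> forall B : R,
    (forall (k : nat) x, (k <= N)%N -> `|derive1n k phi x| <= B) ->
    `|w phi + c * derive1 phi p| <= C * B.
  have [N [C [C0 CH]]] := dist_bound w M.
  exists (N + 1)%N, (C + `|c|) => phi tphi phiM B phiB.
  rewrite (le_trans (ler_normD _ _))// mulrDl lerD//.
    by apply: CH => // k x kN; apply: phiB; rewrite (leq_trans kN)// leq_addr.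
  by rewrite normrM ler_wpM2l//; apply: (phiB 1%N); rewrite leq_addl.
by exists (SchwartzDistribution lin cont).
Qed.

(** Up to a constant, the horizontal derivative of the Poisson kernel at height [t] and offset [d]
    from the pole. It is harmonic, odd in [d], and of size [t^-2] where [d] and [t] are
    comparable. *)
Definition dipole_ext d t := d * t / (t ^+ 2 + d ^+ 2) ^+ 2.

Lemma dipole_ext_ge0 d t : 0 <= d -> 0 <= t -> 0 <= dipole_ext d t.
Proof. by move=> d0 t0; rewrite /dipole_ext; apply: divr_ge0; [exact: mulr_ge0|exact: sqr_ge0]. Qed.

Lemma dipole_ext_ge d t m : 0 <= d -> 0 < t -> d <= m -> t <= m ->
  d * t / (4 * m ^+ 4) <= dipole_ext d t.
Proof.
move=> d0 t0 dm tm; rewrite /dipole_ext ler_wpM2l ?mulr_ge0 ?(ltW t0)//.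
have m0 : 0 < m := lt_le_trans t0 tm.
have D0 : 0 < t ^+ 2 + d ^+ 2 by rewrite ltr_pwDl ?exprn_gt0// sqr_ge0.
rewrite lef_pV2 ?posrE ?exprn_gt0 ?mulr_gt0 ?exprn_gt0//.
have -> : 4 * m ^+ 4 = (2 * m ^+ 2) ^+ 2 by ring.
rewrite lerXn2r ?nnegrE ?mulr_ge0 ?exprn_ge0 ?(ltW D0) ?(ltW m0)//.
have h1 : t ^+ 2 <= m ^+ 2 by rewrite lerXn2r ?nnegrE ?(ltW t0) ?(ltW m0).
have h2 : d ^+ 2 <= m ^+ 2 by rewrite lerXn2r ?nnegrE ?(ltW m0).
lra.
Qed.

Lemma poisson_ext_dipole w w' theta p c x t e0 : test_function theta -> 0 < e0 ->
  (forall y, `|y - p| < e0 -> theta y = 1) -> 0 < t ->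
  (forall psi, test_function psi -> w' psi = w psi + c * derive1 psi p :> R) ->
  poisson_ext w' theta x t = poisson_ext w theta x t + 2 * c / pi * dipole_ext (x - p) t.
Proof.
move=> tth e00 th1 t0 wE; have ps := @poisson_smooth R.
have tn0 : t != 0 by rewrite gt_eqF.
have pn0 : (pi : R) != 0 by rewrite gt_eqF// pi_gt0.
have pds : smooth (fun y => poisson ((y - x) / t)) := smooth_dilate (p := x) (t := t) ps.
rewrite /poisson_ext (wE _ (test_mul tth pds)) mulrDr; congr (_ + _).
have -> : derive1 (fun y => theta y * poisson ((y - x) / t)) p = t^-1 * derive1 (@poisson R) ((p - x) / t).
  have := derive1n_near 1 (x := p) e00 (test_smooth (test_mul tth pds)) pds.
  move=> /(_ _)/= ->; first by rewrite (derive1_dilate x t ps).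
  by move=> y /th1 ->; rewrite mul1r.
have : is_derive ((p - x) / t) 1 (@poisson R) (pi^-1 * (- (2 * ((p - x) / t)) / (1 + ((p - x) / t) ^+ 2) ^+ 2)).
  apply: is_derive_scal; rewrite /cauchyq.
  have d1 (v : R) : is_derive v 1 (fun u => 1 ^+ 2 + u ^+ 2) (2 * v).
    have := is_derive_add (is_derive_cstl v (1 ^+ 2)) (is_derive_pow 2 (is_derive_var v)).
    by rewrite add0r mulr1 expr1.
  have := is_derive_recip _ (d1 ((p - x) / t)); rewrite !expr1n; apply.
  by rewrite gt_eqF// -[X in X + _](expr1n _ 2) cauchyq_den_gt0.
move=> /(is_derive_uniq (smooth_is_derive0 _ ps)) ->.
have D0 : t ^+ 2 + (x - p) ^+ 2 != 0 by rewrite gt_eqF// cauchyq_den_gt0.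
have D1 : t ^+ 2 + (p - x) ^+ 2 != 0 by rewrite gt_eqF// cauchyq_den_gt0.
move: pn0 D0 D1; rewrite /dipole_ext; move: (pi : R) => q q0 D0 D1; field.
by rewrite tn0 q0 D0.
Qed.

(** Three regions at height [tau]. In the cone [d <= tau] the error [d / tau^2] against the vertical
    line is beaten by the dipole, which exceeds it by a factor of order [e / tau]. For
    [tau < d <= d1] the side error [tau / d^2] is beaten by a factor of order [e / d]. Beyond [d1]
    the side error is below [C] as soon as [tau] is small. *)
Lemma poisson_ext_corner w theta p C t0 e : tame 0 w p -> test_function theta ->
  (forall y, 0 <= theta y) -> 0 < C -> 0 < t0 -> t0 <= 1 -> 0 < e ->
  (forall t, 0 < t -> t <= t0 -> - C <= poisson_ext w theta p t) ->
  exists2 tau0, 0 < tau0 & forall x tau d, 0 < tau -> tau <= tau0 -> d = `|x - p| -> d <= 1 ->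
    (0 < d -> pos_on w (x - d / 2) (x + d / 2)) ->
    - C <= poisson_ext w theta x tau + e * dipole_ext d tau.
Proof.
move=> tw tth th0 C0 t00 t01 e0 vert.
have [C1 C10 H1] := poisson_ext_vertical tw tth.
have [C2' C20' H2] := poisson_ext_side tw tth th0.
pose C2 := C2' + 1; have C20 : 0 < C2 by rewrite ltr_wpDl.
have C1p : 0 < 4 * (C1 + 1) by rewrite mulr_gt0// ltr_wpDl.
have C2p : 0 < 4 * C2 by rewrite mulr_gt0.
pose d1 := e / (4 * C2); have d10 : 0 < d1 by rewrite divr_gt0.
exists (Num.min t0 (Num.min (e / (4 * (C1 + 1))) (C * d1 ^+ 2 / C2))).
  by rewrite !lt_min t00 !divr_gt0// mulr_gt0// exprn_gt0.
move=> x tau d tau0; rewrite !le_min => /and3P[tt0 tte ttC] dE d1' pos.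
have d0 : 0 <= d by rewrite dE.
have tau1 : tau <= 1 := le_trans tt0 t01.
have [dt|td] := leP d tau.
  have h := H1 x tau tau0 tau1; rewrite -dE in h; have {h} := h dt.
  rewrite ler_norml => /andP[h _].
  have hb := dipole_ext_ge d0 tau0 dt (lexx tau).
  have hv := vert tau tau0 tt0.
  have : C1 * d / tau ^+ 2 <= e * (d * tau / (4 * tau ^+ 4)).
    have -> : e * (d * tau / (4 * tau ^+ 4)) = (e / (4 * tau)) * (d / tau ^+ 2).
      by field; rewrite gt_eqF.
    rewrite -mulrA ler_wpM2r ?divr_ge0 ?sqr_ge0//.
    rewrite ler_pdivlMr ?mulr_gt0//.
    move: tte; rewrite ler_pdivlMr//; have := ltW tau0; lra.
  have : e * (d * tau / (4 * tau ^+ 4)) <= e * dipole_ext d tau by rewrite ler_wpM2l ?(ltW e0).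
  lra.
have d0' : 0 < d := lt_trans tau0 td.
have h := H2 x tau d tau0 dE d0' d1' (pos d0').
have td2 : 0 <= tau / d ^+ 2 by rewrite divr_ge0 ?sqr_ge0// ltW.
have h' : C2' * tau / d ^+ 2 <= C2 * (tau / d ^+ 2).
  by rewrite -mulrA ler_wpM2r// lerDl.
have hb : 0 <= e * dipole_ext d tau by rewrite mulr_ge0 ?(ltW e0)// dipole_ext_ge0// ltW.
have [dd|dd] := leP d d1.
  have hb' := dipole_ext_ge d0 tau0 (lexx d) (ltW td).
  have : C2 * (tau / d ^+ 2) <= e * (d * tau / (4 * d ^+ 4)).
    have -> : e * (d * tau / (4 * d ^+ 4)) = (e / (4 * d)) * (tau / d ^+ 2).
      by field; rewrite gt_eqF.
    rewrite ler_wpM2r// ler_pdivlMr ?mulr_gt0//.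
    by move: dd; rewrite /d1 ler_pdivlMr//; lra.
  have : e * (d * tau / (4 * d ^+ 4)) <= e * dipole_ext d tau by rewrite ler_wpM2l ?(ltW e0).
  lra.
have : C2 * (tau / d ^+ 2) <= C.
  rewrite mulrA ler_pdivrMr ?exprn_gt0//.
  move: ttC; rewrite ler_pdivlMr// mulrC => /le_trans; apply.
  rewrite ler_wpM2l ?(ltW C0)// lerXn2r ?nnegrE ?(ltW d0') ?(ltW d10)// ltW//.
lra.
Qed.

Lemma poisson_ext_slab w theta p q C t0 e0 : tame 0 w p -> tame 0 w q -> test_function theta ->
  (forall y, 0 <= theta y) -> 0 < e0 ->
  (forall y, p - e0 < y < q + e0 -> theta y = 1) -> p < q -> q <= p + 1 ->
  0 < C -> 0 < t0 -> t0 <= 1 ->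
  (forall t, 0 < t -> t <= t0 -> - C <= poisson_ext w theta p t /\ - C <= poisson_ext w theta q t) ->
  (forall x, p <= x <= q -> - C <= poisson_ext w theta x t0) ->
  (forall x, p < x < q -> pos_near w x) ->
  forall x t, p <= x <= q -> 0 < t -> t <= t0 -> - C <= poisson_ext w theta x t.
Proof.
move=> twp twq tth th0 e00 th1 pq q1 C0 t00 t01 vert top pos x t xpq tpos tt0.
(* The correction is [e] times a quantity that depends only on the point [(x, t)], so [e] may tend
   to 0 with the point fixed. The summand 1 leaves room for the quadratic term of the
   perturbation. *)
suff key e : 0 < e -> 0 <= poisson_ext w theta x t + C +
    e * (dipole_ext (x - p) t + dipole_ext (q - x) t + 1).
  rewrite -subr_ge0 opprK; set A := _ + C in key *; rewrite leNgt; apply/negP => A0.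
  set K := _ + _ + 1 in key.
  have K0 : 0 < K.
    by move: xpq => /andP[? ?]; rewrite ltr_wpDl// addr_ge0// dipole_ext_ge0 ?(ltW tpos)// subr_ge0.
  have := key (- A / (2 * K)); rewrite divr_gt0 ?mulr_gt0 ?oppr_gt0// => /(_ isT).
  rewrite (_ : - A / (2 * K) * K = - A / 2); first lra.
  by field; rewrite gt_eqF.
move=> e0'.
have [tE|tlt] : t = t0 \/ t < t0 by move: tt0; rewrite le_eqVlt => /predU1P[]; [left|right].
  have := top x xpq; rewrite -tE => h.
  have : 0 <= e * (dipole_ext (x - p) t + dipole_ext (q - x) t + 1).
    move: xpq => /andP[? ?].
    by rewrite mulr_ge0 ?(ltW e0')// !addr_ge0// dipole_ext_ge0 ?(ltW tpos)// subr_ge0.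
  lra.
have [tp tp0 Hp] := poisson_ext_corner twp tth th0 C0 t00 t01 e0' (fun t h1 h2 => (vert t h1 h2).1).
have [tq tq0 Hq] := poisson_ext_corner twq tth th0 C0 t00 t01 e0' (fun t h1 h2 => (vert t h1 h2).2).
(* The bottom of the rectangle: low enough for both corner estimates and not above the given
   point. *)
pose tau := Num.min t (Num.min tp tq).
have tau0 : 0 < tau by rewrite !lt_min tpos tp0.
have taut : tau <= t by rewrite ge_min lexx.
have taup : tau <= tp by rewrite !ge_min lexx !orbT.
have tauq : tau <= tq by rewrite !ge_min lexx !orbT.
have pi0 : 0 < (pi : R) := pi_gt0 R.
(* The dipoles are added to [w] itself, so the corrected function is again a Poisson extension and
   inherits harmonicity and derivative bounds. The coefficients turn [2 c / pi] into [e] and [- e];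
   the sign at [q] makes that dipole positive to the left of [q]. *)
have [w1 w1E] := dist_add_dipole w p (e * pi / 2).
have [w2 w2E] := dist_add_dipole w1 q (- (e * pi / 2)).
have thp y : `|y - p| < e0 -> theta y = 1.
  by rewrite ltr_norml => /andP[? ?]; apply: th1; apply/andP; split; lra.
have thq y : `|y - q| < e0 -> theta y = 1.
  by rewrite ltr_norml => /andP[? ?]; apply: th1; apply/andP; split; lra.
have ext2 y s : 0 < s -> poisson_ext w2 theta y s = poisson_ext w theta y s +
    e * (dipole_ext (y - p) s + dipole_ext (q - y) s).
  move=> s0; rewrite (poisson_ext_dipole _ tth e00 thq s0 w2E).
  rewrite (poisson_ext_dipole _ tth e00 thp s0 w1E) -addrA; congr (_ + _).
  have -> : 2 * - (e * pi / 2) / pi = - e by move: pi0; move: (pi : R) => P P0; field; rewrite gt_eqF.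
  have -> : 2 * (e * pi / 2) / pi = e by move: pi0; move: (pi : R) => P P0; field; rewrite gt_eqF.
  rewrite mulrDr mulNr -mulrN; congr (_ + e * _).
  by rewrite /dipole_ext -(opprB q y) sqrrN !mulNr opprK.
have [ux [ut [uxx [utt [dd lap bd]]]]] := poisson_ext_harmonic w2 tth.
have [L LH] := bd tau tau0.
(* The term in [s ^+ 2] makes the Laplacian [- 2 e], hence strictly negative, and [1 - s ^+ 2] is
   nonnegative because the heights are at most 1. *)
pose v y s := poisson_ext w2 theta y s + C + e * (1 - s ^+ 2).
suff vge : forall y s, p <= y <= q -> tau <= s <= t0 -> 0 <= v y s.
  have := vge x t xpq; rewrite taut tt0 => /(_ isT); rewrite /v ext2//.
  have : 0 <= e * t ^+ 2 by rewrite mulr_ge0 ?sqr_ge0// ltW.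
  lra.
have tau_t0 : tau < t0 := le_lt_trans taut tlt.
have wge s y : p <= y <= q -> 0 < s -> s <= t0 -> - C <= poisson_ext w2 theta y s -> 0 <= v y s.
  move=> ypq s0 st0 h; rewrite /v.
  have : 0 <= e * (1 - s ^+ 2).
    by rewrite mulr_ge0 ?(ltW e0')// subr_ge0 exprn_ile1 ?(ltW s0)// (le_trans st0).
  lra.
have dge y s : p <= y <= q -> 0 < s -> 0 <= e * dipole_ext (y - p) s /\ 0 <= e * dipole_ext (q - y) s.
  move=> /andP[? ?] s0; split; apply: (mulr_ge0 (ltW e0')); apply: dipole_ext_ge0; rewrite ?subr_ge0//;
    exact: ltW.
apply: (@minimum_principle _ v ux (fun y s => ut y s - e * (2 * s)) uxx (fun y s => utt y s - e * 2)
  p q tau t0 (`|L| + e * 2)) => //.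
- move=> y s /andP[s1 s2]; have s0 : 0 < s := lt_le_trans tau0 s1.
  have [h1 h2 h3 h4] := dd y s s0.
  have ds : is_derive s 1 (fun s => e * (1 - s ^+ 2)) (- (e * (2 * s))).
    have := is_derive_scal e (is_derive_sub (is_derive_cstl s 1) (is_derive_pow 2 (is_derive_var s))).
    by rewrite sub0r mulrN mulr1 expr1.
  have ds2 : is_derive s 1 (fun s => e * (2 * s)) (e * 2).
    by have := is_derive_scal e (is_derive_scal 2 (is_derive_var s)); rewrite mulr1.
  split.
  + have := is_derive_add (is_derive_add h1 (is_derive_cstl y C)) (is_derive_cstl y (e * (1 - s ^+ 2))).
    by rewrite !addr0.
  + exact: h2.
  + by have := is_derive_add (is_derive_add h3 (is_derive_cstl s C)) ds; rewrite addr0.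
  + exact (is_derive_sub h4 ds2).
- move=> y s /andP[s1 s2]; have s0 : 0 < s := lt_le_trans tau0 s1.
  have s11 : s <= 1 := le_trans s2 t01.
  have [h1 h2] := LH y s s1 s11; have LL := ler_norm L.
  have e20 : 0 <= e * 2 by rewrite mulr_ge0// ltW.
  have es : 0 <= e * (2 * s) by rewrite !mulr_ge0// ltW.
  have es2 : e * (2 * s) <= e * 2 by rewrite ler_wpM2l ?(ltW e0')//; clear -s11; lra.
  split; first by clear -h1 LL e20; lra.
  by rewrite (le_trans (ler_normB _ _))// (ger0_norm es); clear -h2 LL es2; lra.
- move=> y s /andP[s1 s2]; have s0 : 0 < s := lt_trans tau0 s1.
  have := lap y s s0; have : 0 < e * 2 by rewrite mulr_gt0.
  lra.
- move=> y ypq; split; last first.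
    apply: (wge) => //; rewrite ext2//.
    have [] := dge y t0 ypq t00; have := top y ypq; clear; lra.
  apply: wge => //; first exact: ltW.
  rewrite ext2// mulrDr.
  have [g1 g2] := dge y tau ypq tau0.
  have /andP[y1 y2] := ypq.
  (* On the bottom edge the corner estimate is taken at the nearer endpoint: half the distance to it
     is a radius that stays inside the gap, where [w] is positive. *)
  have [ym|ym] := leP (y - p) (q - y).
    have dE : y - p = `|y - p| by rewrite ger0_norm// subr_ge0.
    have := Hp y tau (y - p) tau0 taup dE.
    have -> : y - p <= 1 by clear -y2 q1; lra.
    move=> /(_ isT) H; suff : - C <= poisson_ext w theta y tau + e * dipole_ext (y - p) tau.
      by clear -g2; lra.
    apply: H => d0; apply: pos_on_glue => z /andP[z1 z2]; apply: pos.
    by clear -z1 z2 ym d0; apply/andP; split; lra.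
  have dE : q - y = `|y - q| by rewrite distrC ger0_norm// subr_ge0.
  have := Hq y tau (q - y) tau0 tauq dE.
  have -> : q - y <= 1 by clear -y1 q1; lra.
  move=> /(_ isT) H; suff : - C <= poisson_ext w theta y tau + e * dipole_ext (q - y) tau.
    by clear -g1; lra.
  apply: H => d0; apply: pos_on_glue => z /andP[z1 z2]; apply: pos.
  by clear -z1 z2 ym d0; apply/andP; split; lra.
- move=> s /andP[s1 s2]; have s0 : 0 < s := lt_le_trans tau0 s1.
  have pp : p <= p <= q by rewrite lexx ltW.
  have qq : p <= q <= q by rewrite lexx andbT ltW.
  have [vp vq] := vert s s0 s2.
  split; apply: wge => //; rewrite ext2// mulrDr.
    by have [] := dge p s pp s0; clear -vp; lra.
  by have [] := dge q s qq s0; clear -vq; lra.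
Qed.

End Slab.

(** * Convolution with the Poisson kernel *)

Section Smoothing.
Variable R : realType.
Implicit Types (f k phi psi theta : R -> R) (a b c d e p r s t u x y z A B M : R).
Implicit Types (w W : schwartz_distribution R).
Notation mu := (@lebesgue_measure R).

(** The convolution integral stopped at [s]. As a function of [s] it has an explicit derivative,
    which reduces exchanges of integrals and pairings to comparing derivatives in [s]; beyond the
    support of [psi] it is the full convolution. *)
Definition partial_conv k t psi s y := prim (fun x => psi x * k ((y - x) / t)) s.

Definition bounded_jets k := forall N : nat, exists B, norm_bound N B k.

Lemma bounded_jets_derive1 k : bounded_jets k -> bounded_jets (derive1 k).
Proof.
move=> kb N; have [B kB] := kb N.+1; exists B => n x nN.
rewrite (_ : derive1n n _ = derive1n n.+1 k); last first.
  by rewrite -[derive1 k]/(derive1n 1 k) derive1nD addn1.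
exact: kB.
Qed.

Lemma bounded_jets_derive1n k n : bounded_jets k -> bounded_jets (derive1n n k).
Proof. by move=> kb; elim: n => [|n IH] //; exact: bounded_jets_derive1. Qed.

Lemma conv_integrand_test k t psi y : smooth k -> test_function psi ->
  test_function (fun x => psi x * k ((y - x) / t)).
Proof.
move=> ks tpsi; have := test_mul tpsi (smooth_dilate (p := y) (t := - t) ks).
by under eq_fun do rewrite invrN mulrN -mulNr opprB.
Qed.

Lemma partial_conv_derive k t psi s y : smooth k -> test_function psi ->
  is_derive s 1 (fun s => partial_conv k t psi s y) (psi s * k ((y - s) / t)).
Proof. by move=> ks tpsi; exact (prim_derive s (conv_integrand_test t y ks tpsi)). Qed.

Lemma partial_conv_eq0 k t psi s y M : ball_supported M psi -> s < - M ->
  partial_conv k t psi s y = 0.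
Proof. by move=> psiM; apply: prim_eq0 => x /psiM ->; rewrite mul0r. Qed.

(** The remainder in [h], as a function of [s], vanishes to the left of the support and has a
    derivative of size [h^2]; the mean value inequality integrates this. *)
Lemma partial_conv_derive_arg k t psi s y : 0 < t -> smooth k -> bounded_jets k ->
  test_function psi ->
  is_derive y 1 (partial_conv k t psi s) (t^-1 * partial_conv (derive1 k) t psi s y).
Proof.
move=> t0 ks kb tpsi; have tn0 : t != 0 by rewrite gt_eqF.
have [psis [M M0 psiM]] := (test_functionP psi).1 tpsi.
have [A psiA] := test_norm_bound 0 tpsi; have A0 := norm_bound_ge0 psiA.
have [B kB] := kb 2%N; have B0 := norm_bound_ge0 kB.
have ks1 := smooth_derive1 ks.
pose K := A * (t^-1 * (B * t^-1)) * (`|s| + M + 1).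
have ti0 : 0 <= t^-1 by rewrite invr_ge0 ltW.
have K0 : 0 <= K by rewrite !mulr_ge0// !addr_ge0// ltW.
apply/is_derive_epsP => e e0.
exists (e / (K + 1)); first by rewrite divr_gt0// ltr_wpDl.
move=> h; rewrite ltr_pdivlMr ?ltr_wpDl// => hK.
pose G s := partial_conv k t psi s (y + h) - partial_conv k t psi s y -
  h * (t^-1 * partial_conv (derive1 k) t psi s y).
pose g x := k ((y + h - x) / t) - k ((y - x) / t) - h * (t^-1 * derive1 k ((y - x) / t)).
have dG (v : R) : is_derive v 1 G (psi v * g v).
  have d3 := is_derive_scal h (is_derive_scal t^-1 (partial_conv_derive t v y ks1 tpsi)).
  have := is_derive_sub (is_derive_sub (partial_conv_derive t v (y + h) ks tpsi)
    (partial_conv_derive t v y ks tpsi)) d3.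
  by rewrite (_ : _ - _ = psi v * g v)// /g; ring.
have gb x : `|g x| <= t^-1 * (B * t^-1) * (`|h| * `|h|).
  pose l := (y - x) / t.
  pose F n := k (t^-1 * n + l) - derive1 k l * (t^-1 * n).
  have dF (n : R) : is_derive n 1 F (t^-1 * (derive1 k (t^-1 * n + l) - derive1 k l)).
    have d1 := is_derive_affine t^-1 l n.
    have d2 := is_derive_chain (g := fun n => t^-1 * n + l) (smooth_is_derive0 (t^-1 * n + l) ks) d1.
    have := is_derive_sub d2 (is_derive_scal (derive1 k l) (is_derive_scal t^-1 (is_derive_var n))).
    by rewrite mulr1 (_ : _ - _ = t^-1 * (derive1 k (t^-1 * n + l) - derive1 k l))//; ring.
  have bF (n : R) : Num.min 0 h <= n <= Num.max 0 h ->
      `|t^-1 * (derive1 k (t^-1 * n + l) - derive1 k l)| <= t^-1 * (B * t^-1) * `|h|.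
    move=> nh; rewrite normrM (ger0_norm ti0) -!mulrA ler_wpM2l//.
    have b2 v : `|derive1 (derive1 k) v| <= B by exact: (kB 2%N).
    have := mvt_norm_le (a := l) (b := t^-1 * n + l) (fun v _ => smooth_is_derive0 v ks1) (fun v _ => b2 v).
    move=> /le_trans; apply; rewrite addrK normrM (ger0_norm ti0) !ler_wpM2l//.
    move: nh; case: (leP 0 h) => hh /andP[? ?]; [rewrite !ger0_norm|rewrite !ler0_norm]; lra.
  have := mvt_norm_le (fun v _ => dF v) bF.
  rewrite subr0 mulrA /F !mulr0 subr0 add0r.
  rewrite (_ : g x = k (t^-1 * h + l) - derive1 k l * (t^-1 * h) - k l); first by rewrite [X in _ -> _ <= X]mulrA.
  rewrite /g (_ : (y + h - x) / t = t^-1 * h + l); last by rewrite /l; field.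
  by rewrite -/l; ring.
have gb' x : `|psi x * g x| <= A * (t^-1 * (B * t^-1)) * (`|h| * `|h|).
  by rewrite normrM -[leRHS]mulrA ler_pM//; exact: (psiA 0%N).
have := mvt_norm_le (a := - (M + 1)) (b := s) (fun v _ => dG v) (fun v _ => gb' v).
have MM : - (M + 1) < - M by lra.
rewrite {2}/G !(partial_conv_eq0 _ _ _ psiM MM) !mulr0 !subr0 => /le_trans; apply.
have : `|s - - (M + 1)| <= `|s| + M + 1.
  by rewrite opprK addrA (le_trans (ler_normD _ _))// lerD ?normr1// (le_trans (ler_normD _ _))// lerD// ger0_norm// ltW.
move=> sM; rewrite (le_trans (ler_wpM2l _ sM))//; first by rewrite !mulr_ge0.
rewrite (_ : _ * (_ * _) * _ = K * `|h| * `|h|); last by rewrite /K; ring.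
rewrite ler_wpM2r//; have := normr_ge0 h; lra.
Qed.

Lemma partial_conv_jet k t psi s n : 0 < t -> smooth k -> bounded_jets k -> test_function psi ->
  smooth (partial_conv k t psi s) /\ derive1n n (partial_conv k t psi s) =
    fun y => t^-1 ^+ n * partial_conv (derive1n n k) t psi s y.
Proof.
move=> t0 ks kb tpsi.
have [] := @smooth_jet R (fun n y => t^-1 ^+ n * partial_conv (derive1n n k) t psi s y).
  move=> {}n x.
  have := is_derive_scal (t^-1 ^+ n) (partial_conv_derive_arg s x t0
    (smooth_derive1n (n := n) ks) (bounded_jets_derive1n n kb) tpsi).
  by rewrite mulrA -exprSr.
have -> : (fun y => t^-1 ^+ 0 * partial_conv (derive1n 0 k) t psi s y) = partial_conv k t psi s.
  by apply/funext => y; rewrite expr0 mul1r.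
by move=> h1 h2; split=> //; exact: h2.
Qed.

(** The differential form of applying [w] under the integral sign. *)
Lemma dist_partial_conv_derive w theta k t psi s : test_function theta -> 0 < t -> smooth k ->
  bounded_jets k -> test_function psi ->
  is_derive s 1 (fun s => w (fun y => theta y * partial_conv k t psi s y))
    (psi s * w (fun y => theta y * k ((y - s) / t))).
Proof.
move=> tth t0 ks kb tpsi.
have kd (v : R) := smooth_dilate (p := v) (t := t) ks.
have := @dist_derive_param R w theta (partial_conv k t psi) (fun s y => psi s * k ((y - s) / t)) s 1
  ltr01 tth.
have -> : w (fun y => theta y * (psi s * k ((y - s) / t))) =
    psi s * w (fun y => theta y * k ((y - s) / t)).
  by rewrite -(dist_scal w _ (test_mul tth (kd s))); congr (w _); apply/funext => y; rewrite mulrCA.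
apply.
- by move=> v _; have [] := partial_conv_jet v 0 t0 ks kb tpsi.
- by move=> v _; exact (smooth_scal (c := psi v) (kd v)).
- move=> n v y _; rewrite (derive1n_scal (psi v) n (kd v)) (derive1n_dilate v t n ks).
  have -> : (fun s => derive1n n (partial_conv k t psi s) y) =
      fun s => t^-1 ^+ n * partial_conv (derive1n n k) t psi s y.
    by apply/funext => v'; have [_ ->] := partial_conv_jet v' n t0 ks kb tpsi.
  have := is_derive_scal (t^-1 ^+ n) (partial_conv_derive t v y (smooth_derive1n (n := n) ks) tpsi).
  by rewrite mulrCA.
- move=> n M; have [A psiA] := test_norm_bound 1 tpsi; have A0 := norm_bound_ge0 psiA.
  have [B kB] := kb n.+1; have B0 := norm_bound_ge0 kB.
  have ti0 : 0 <= t^-1 by rewrite invr_ge0 ltW.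
  have psis := test_smooth tpsi.
  exists (A * (t^-1 ^+ n * B) + A * (t^-1 ^+ n * (B * t^-1))) => v y _ _.
  rewrite !(derive1n_scal _ n (kd _)) !(derive1n_dilate _ t n ks).
  set k1 := derive1n n k.
  have lp : `|psi v - psi s| <= A * `|v - s|.
    by apply: (mvt_norm_le (fun x _ => smooth_is_derive0 x psis)) => x _; exact: (psiA 1%N).
  have lk : `|k1 ((y - v) / t) - k1 ((y - s) / t)| <= B * t^-1 * `|v - s|.
    have := mvt_norm_le (a := (y - s) / t) (b := (y - v) / t)
      (fun x _ => smooth_is_derive n x ks) (fun x _ => kB n.+1 x (leqnn _)).
    move=> /le_trans; apply; rewrite -mulrA ler_wpM2l// -mulrBl normrM (ger0_norm ti0) mulrC ler_wpM2l//.
    by rewrite (_ : y - v - (y - s) = s - v) 1?distrC//; ring.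
  rewrite (_ : _ - _ = (psi v - psi s) * (t^-1 ^+ n * k1 ((y - v) / t)) +
     psi s * (t^-1 ^+ n * (k1 ((y - v) / t) - k1 ((y - s) / t)))); last ring.
  rewrite (le_trans (ler_normD _ _))// [leRHS]mulrDl lerD// !normrM (ger0_norm (exprn_ge0 n ti0)).
    rewrite [leRHS]mulrAC ler_pM ?mulr_ge0 ?exprn_ge0// ler_wpM2l ?exprn_ge0//.
    exact: kB.
  rewrite -[leRHS]mulrA ler_pM ?mulr_ge0 ?exprn_ge0//; first exact: (psiA 0%N).
  by rewrite -mulrA ler_wpM2l ?exprn_ge0.
Qed.

Lemma partial_conv_parts k t psi s y M : 0 < t -> smooth k -> test_function psi ->
  0 < M -> ball_supported M psi -> M < s ->
  t^-1 * partial_conv (derive1 k) t psi s y = partial_conv k t (derive1 psi) s y.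
Proof.
move=> t0 ks tpsi M0 psiM Ms; have psis := test_smooth tpsi.
pose D v := partial_conv k t (derive1 psi) v y - t^-1 * partial_conv (derive1 k) t psi v y -
  psi v * k ((y - v) / t).
have dD (v : R) : is_derive v 1 D 0.
  have d1 := partial_conv_derive t v y ks (test_derive1 tpsi).
  have d2 := is_derive_scal t^-1 (partial_conv_derive t v y (smooth_derive1 ks) tpsi).
  have d3 : is_derive v 1 (fun v => (y - v) / t) (- t^-1).
    have := is_derive_affine (- t^-1) (y / t) v.
    by rewrite (_ : (fun v => _) = fun v => (y - v) / t)// funeqE => x; ring.
  have d4 := is_derive_mul (smooth_is_derive0 v psis)
    (is_derive_chain (g := fun v => (y - v) / t) (smooth_is_derive0 _ ks) d3).
  have := is_derive_sub (is_derive_sub d1 d2) d4.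
  by rewrite (_ : _ - _ = 0)//; ring.
have := derive_zero_cst s (- (M + 1)) dD.
have MM : - (M + 1) < - M by lra.
have psi'M : ball_supported M (derive1 psi) := derive1n_ball_supported 1 psis psiM.
rewrite /D (partial_conv_eq0 _ _ _ psi'M MM) (partial_conv_eq0 _ _ _ psiM MM).
have n1 : M < `|- (M + 1)| by rewrite normrN ger0_norm; lra.
have n2 : M < `|s| by rewrite ger0_norm; lra.
rewrite (psiM _ n1) (psiM _ n2).
by rewrite !mul0r mulr0 !subr0 => /eqP; rewrite subr_eq0 => /eqP ->.
Qed.

(** Moving the derivatives from the kernel to [psi] removes the factors [t^-1], so estimates of the
    convolution hold for every order uniformly in [t]. *)
Lemma conv_jet k t psi s n M : 0 < t -> smooth k -> bounded_jets k -> test_function psi ->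
  0 < M -> ball_supported M psi -> M < s ->
  derive1n n (partial_conv k t psi s) = partial_conv k t (derive1n n psi) s.
Proof.
move=> t0 ks kb tpsi M0 psiM Ms; elim: n psi tpsi psiM => [//|n IH] psi tpsi psiM.
rewrite -addn1 -!derive1nD.
have -> : derive1n 1 (partial_conv k t psi s) = partial_conv k t (derive1n 1 psi) s.
  have [_ ->] := partial_conv_jet s 1 t0 ks kb tpsi.
  by apply/funext => y; rewrite expr1; exact: (partial_conv_parts _ t0 ks tpsi M0 psiM Ms).
apply: IH; first exact: test_derive1.
exact: derive1n_ball_supported 1 (test_smooth tpsi) psiM.
Qed.

Definition atan_cdf z : R := pi^-1 * atan z.

Let pi0 : 0 < (pi : R) := pi_gt0 R.

Lemma atan_cdf_derive z : is_derive z 1 atan_cdf (poisson z).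
Proof.
rewrite /poisson /cauchyq expr1n; apply: is_derive_scal; exact: is_derive1_atan.
Qed.

Lemma atan_cdf_bound z : `|atan_cdf z| <= 1 / 2.
Proof.
rewrite /atan_cdf normrM gtr0_norm ?invr_gt0// ler_pdivrMl// mul1r ler_norml.
by rewrite (ltW (atan_gtNpi2 z)) (ltW (atan_ltpi2 z)).
Qed.

Lemma atan_cdf_limit e : 0 < e -> exists2 r, 0 < r & forall z, r <= z ->
  `|atan_cdf z - 1 / 2| <= e /\ `|atan_cdf (- z) + 1 / 2| <= e.
Proof.
move=> e0; have e1 : 0 < pi * e by rewrite mulr_gt0.
have /cvgrPdist_le/(_ _ e1)[r [_ rH]] := @cvgy_atan R.
exists (`|r| + 1) => [|z rz]; first by rewrite ltr_wpDl.
have := rH z; rewrite distrC => /(_ _) h.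
have {h}/ler_normlP h : `|atan z - pi / 2| <= pi * e by apply: h; have := ler_norm r; lra.
have E : pi^-1 * (atan z - pi / 2) = atan_cdf z - 1 / 2.
  by rewrite /atan_cdf; move: pi0 (atan z); move: (pi : R) => q q0 A; field; rewrite gt_eqF.
have b : `|atan_cdf z - 1 / 2| <= e.
  by rewrite -E normrM gtr0_norm ?invr_gt0// ler_pdivrMl//; apply/ler_normlP.
split=> //; rewrite /atan_cdf atanN mulrN -/(atan_cdf z) addrC distrC; exact: b.
Qed.

Lemma poisson_bounded_jets : bounded_jets (@poisson R).
Proof.
move=> N; have [B PB] := @poisson_symbol R N; exists B.
by apply: (symbol_norm_bound (a := -1)) PB; lra.
Qed.

(* Integration by parts against the primitive of the Poisson kernel, which is close to 1/2 on the
   left of y - r t and to -1/2 on the right of y + r t. *)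
Lemma poisson_conv_approx A M e : 0 <= A -> 0 < M -> 0 < e -> exists2 t0, 0 < t0 &
  forall t psi y, 0 < t -> t <= t0 -> test_function psi -> ball_supported M psi ->
  norm_bound 1 A psi -> `|y| <= M -> `|t^-1 * partial_conv (@poisson R) t psi (M + 2) y - psi y| <= e.
Proof.
move=> A0 M0 e0.
pose e1 := e / (8 * (A + 1) * (M + 2)).
have A1 : 0 < A + 1 by rewrite ltr_wpDl.
have M2 : 0 < M + 2 by lra.
have e10 : 0 < e1 by rewrite divr_gt0// !mulr_gt0.
have [r r0 rH] := atan_cdf_limit e10.
exists (Num.min (1 / r) (e / (8 * (A + 1) * r))); first by rewrite lt_min !divr_gt0// !mulr_gt0.
move=> t psi y t0; rewrite le_min !ler_pdivlMr ?mulr_gt0// => /andP[tr te] tpsi psiM psiA yM.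
have psis := test_smooth tpsi; have ps := @poisson_smooth R.
pose d := r * t; have d0 : 0 < d by rewrite mulr_gt0.
have d1 : d <= 1 by rewrite /d mulrC.
have dA : A * d * 8 <= e.
  rewrite (le_trans _ te)// (_ : t * _ = A * d * 8 + d * 8); last by rewrite /d; ring.
  by have := d0; lra.
(* The derivative of [E] is [psi'] times the primitive of the kernel. From 0 on the far left, [E]
   rises to about [psi (y - d) / 2], hardly changes up to [y + d], and then gains about
   [psi (y + d) / 2]; the total is close to [psi y]. *)
pose E s := t^-1 * partial_conv (@poisson R) t psi s y + psi s * atan_cdf ((y - s) / t).
have psi1 v : `|derive1 psi v| <= A by exact: (psiA 1%N).
have dE (v : R) : is_derive v 1 E (derive1 psi v * atan_cdf ((y - v) / t)).
  have d3 : is_derive v 1 (fun v => (y - v) / t) (- t^-1).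
    have := is_derive_affine (- t^-1) (y / t) v.
    by rewrite (_ : (fun v => _) = fun v => (y - v) / t)// funeqE => x; ring.
  have d4 := is_derive_mul (smooth_is_derive0 v psis)
    (is_derive_chain (g := fun v => (y - v) / t) (atan_cdf_derive _) d3).
  have := is_derive_add (is_derive_scal t^-1 (partial_conv_derive t v y ps tpsi)) d4.
  by rewrite (_ : _ + _ = derive1 psi v * atan_cdf ((y - v) / t))//; ring.
have /ler_normlP[y1 y2] := yM.
have Ee : A * e1 * (2 * (M + 2)) * 4 <= e.
  rewrite (_ : _ * 4 = A * (e1 * (8 * (M + 2)))); last ring.
  have -> : e1 * (8 * (M + 2)) = e / (A + 1) by rewrite /e1; field; rewrite !gt_eqF.
  rewrite mulrA ler_pdivrMr// mulrC ler_wpM2l ?(ltW e0)//; lra.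
have L : `|(E (y - d) - psi (y - d) / 2) - (E (- (M + 2)) - psi (- (M + 2)) / 2)| <=
    A * e1 * `|y - d - - (M + 2)|.
  apply: (mvt_norm_le (f := fun s => E s - psi s / 2) (f' := fun v => derive1 psi v * (atan_cdf ((y - v) / t) - 1 / 2))).
    move=> v _; have := is_derive_sub (dE v) (is_derive_mul (smooth_is_derive0 v psis) (is_derive_cstl v 2^-1)).
    by rewrite mulr0 addr0 mulrBr mul1r.
  move=> v; rewrite (min_idPl _) ?(max_idPr _); try by clear -M0 y1 y2 d0 d1; lra.
  move=> /andP[_ vd]; rewrite normrM ler_pM//.
  have [] // := rH ((y - v) / t) _.
  by rewrite ler_pdivlMr//; rewrite -/d; lra.
have C : `|E (y + d) - E (y - d)| <= A * (1 / 2) * `|y + d - (y - d)|.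
  apply: (mvt_norm_le (fun v _ => dE v)) => v _.
  by rewrite normrM ler_pM//; exact: atan_cdf_bound.
have Q : `|(E (M + 2) + psi (M + 2) / 2) - (E (y + d) + psi (y + d) / 2)| <=
    A * e1 * `|M + 2 - (y + d)|.
  apply: (mvt_norm_le (f := fun s => E s + psi s / 2) (f' := fun v => derive1 psi v * (atan_cdf ((y - v) / t) + 1 / 2))).
    move=> v _; have := is_derive_add (dE v) (is_derive_mul (smooth_is_derive0 v psis) (is_derive_cstl v 2^-1)).
    by rewrite mulr0 addr0 mulrDr mul1r.
  move=> v; rewrite (min_idPl _) ?(max_idPr _); try by clear -M0 y1 y2 d0 d1; lra.
  move=> /andP[vd _]; rewrite normrM ler_pM//.
  have [] // := rH (- ((y - v) / t)) _; last by rewrite opprK.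
  by rewrite -mulNr ler_pdivlMr// -/d; lra.
have pl : `|psi (y - d) - psi y| <= A * d.
  have := mvt_norm_le (a := y) (b := y - d) (fun x _ => smooth_is_derive0 x psis) (fun x _ => psi1 x).
  by rewrite (_ : y - d - y = - d) ?normrN ?(ger0_norm (ltW d0))//; ring.
have pr : `|psi (y + d) - psi y| <= A * d.
  have := mvt_norm_le (a := y) (b := y + d) (fun x _ => smooth_is_derive0 x psis) (fun x _ => psi1 x).
  by rewrite (_ : y + d - y = d) ?(ger0_norm (ltW d0))//; ring.
have MM : M < `|M + 2| by clear -M0; rewrite ger0_norm; lra.
have psiM2 : psi (M + 2) = 0 := psiM _ MM.
have psiN2 : psi (- (M + 2)) = 0 by apply: psiM; rewrite normrN.
have EM : E (M + 2) = t^-1 * partial_conv (@poisson R) t psi (M + 2) y.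
  by rewrite /E psiM2 mul0r addr0.
have EN : E (- (M + 2)) = 0.
  rewrite /E psiN2 mul0r addr0 (partial_conv_eq0 _ _ _ psiM) ?mulr0//; clear -M0; lra.
rewrite -EM; move: L C Q pl pr; rewrite EN psiM2 psiN2 !mul0r !subr0 addr0.
have -> : y + d - (y - d) = 2 * d by ring.
have l1 : `|y - d - - (M + 2)| <= 2 * (M + 2).
  by clear -M0 y1 y2 d0 d1; rewrite ler_norml; apply/andP; split; lra.
have l2 : `|M + 2 - (y + d)| <= 2 * (M + 2).
  by clear -M0 y1 y2 d0 d1; rewrite ler_norml; apply/andP; split; lra.
have ae0 : 0 <= A * e1 by rewrite mulr_ge0// ltW.
have {}l1 := ler_wpM2l ae0 l1; have {}l2 := ler_wpM2l ae0 l2.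
rewrite (ger0_norm (x := 2 * d)); last by lra.
move=> /le_trans/(_ l1) + + /le_trans/(_ l2); move: Ee dA; clear.
rewrite !ler_norml => ? ? /andP[? ?] /andP[? ?] /andP[? ?] /andP[? ?] /andP[? ?].
apply/andP; split; lra.
Qed.

Lemma dist_local_bound w theta M : test_function theta -> ball_supported M theta ->
  exists (N : nat) C, 0 <= C /\ forall f B, smooth f -> 0 <= B ->
    (forall (k : nat) x, (k <= N)%N -> `|x| <= M -> `|derive1n k f x| <= B) ->
    `|w (fun y => theta y * f y)| <= C * B.
Proof.
move=> tth thM; have ths := test_smooth tth.
have [N [C [C0 CH]]] := dist_bound w M.
have [A thA] := test_norm_bound N tth; have A0 := norm_bound_ge0 thA.
exists N, (C * (2 ^+ N * A)); split=> [|f B fs B0 fB]; first by rewrite !mulr_ge0.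
have bM : ball_supported M (fun y => theta y * f y) by move=> x xM; rewrite thM ?mul0r.
rewrite -mulrA; apply: (CH _ _ (test_mul tth fs) bM).
move=> k x kN; have [xM|xM] := leP `|x| M; last first.
  by rewrite (derive1n_ball_supported k (smooth_mul ths fs) bM)// normr0 !mulr_ge0.
have j1 : jet_bound N A 1 theta x by move=> i iN; rewrite expr1n mulr1; exact: thA.
have j2 : jet_bound N B 1 f x by move=> i iN; rewrite expr1n mulr1; exact: fB.
by have := jet_bound_mul ths fs ler01 j1 j2 kN; rewrite expr1n mulr1.
Qed.

(** The derivatives of the convolution are convolutions of the derivatives of [psi], so
    [poisson_conv_approx] gives convergence in each seminorm, to which [w] is continuous. *)
Lemma poisson_conv_limit w theta psi M : test_function theta -> test_function psi -> 0 < M ->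
  ball_supported M theta -> ball_supported M psi ->
  t^-1 * w (fun y => theta y * partial_conv (@poisson R) t psi (M + 2) y) @[t --> 0^'+] -->
  w (fun y => theta y * psi y).
Proof.
move=> tth tpsi M0 thM psiM; have psis := test_smooth tpsi; have ps := @poisson_smooth R.
have [N [C [C0 CH]]] := dist_local_bound w tth thM.
have [A psiA] := test_norm_bound N.+1 tpsi; have A0 := norm_bound_ge0 psiA.
apply/right_limP => e e0.
have e1 : 0 < e / (C + 1) by rewrite divr_gt0// ltr_wpDl.
have [t0 t00 H] := poisson_conv_approx A0 M0 e1.
exists t0; first exact: t00.
move=> t tpos /ltW tt0.
have [Is _] := partial_conv_jet (M + 2) 0 tpos ps poisson_bounded_jets tpsi.
have tIs : smooth (fun y => t^-1 * partial_conv (@poisson R) t psi (M + 2) y) := smooth_scal (c := t^-1) Is.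
have fs := smooth_sub tIs psis.
have -> : t^-1 * w (fun y => theta y * partial_conv (@poisson R) t psi (M + 2) y) -
    w (fun y => theta y * psi y) =
    w (fun y => theta y * (t^-1 * partial_conv (@poisson R) t psi (M + 2) y - psi y)).
  rewrite -(dist_scal w _ (test_mul tth Is)) -(dist_sub w (test_scal t^-1 (test_mul tth Is)) (test_mul tth psis)).
  by congr (w _); apply/funext => y; ring.
have MM : M < M + 2 by lra.
rewrite (le_trans (CH _ (e / (C + 1)) fs (ltW e1) _))//.
  move=> k x kN xM; rewrite (derive1n_sub k tIs psis) (derive1n_scal t^-1 k Is).
  rewrite (conv_jet k tpos ps poisson_bounded_jets tpsi M0 psiM MM).
  have tk : test_function (derive1n k psi) by elim: (k) => [//|n IH]; exact: test_derive1.
  apply: (H t _ x tpos tt0 tk (derive1n_ball_supported k psis psiM) _ xM).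
  move=> i v i1; rewrite derive1nD; apply: psiA.
  by rewrite -add1n leq_add.
rewrite mulrA ler_pdivrMr ?ltr_wpDl// mulrC ler_wpM2l ?(ltW e0)//; lra.
Qed.

End Smoothing.

(** * From boundary behaviour of the extension to positivity of the distribution *)

Section BoundaryValues.
Variable R : realType.
Implicit Types (f k phi psi theta : R -> R) (a b c d e p r s t u x y z A B M : R).
Implicit Types (w W : schwartz_distribution R).
Notation mu := (@lebesgue_measure R).

Lemma poisson_ext_continuous w theta t : test_function theta -> 0 < t ->
  continuous ((poisson_ext w theta)^~ t).
Proof.
move=> tth t0 x; have [ux [ut [uxx [utt [H _ _]]]]] := poisson_ext_harmonic w tth.
have [h _ _ _] := H x t t0; exact: is_derive_continuous h.
Qed.

(** Both sides come from one function of the upper limit [s], which vanishes to the left of the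
    support and has the integrand as derivative. *)
Lemma poisson_ext_integral w theta psi M t : test_function theta -> test_function psi ->
  0 < M -> ball_supported M psi -> 0 < t ->
  \int[mu]_(x in `[(- (M + 2)), (M + 2)]) (psi x * poisson_ext w theta x t) =
  t^-1 * w (fun y => theta y * partial_conv (@poisson R) t psi (M + 2) y).
Proof.
move=> tth tpsi M0 psiM t0.
pose F s := t^-1 * w (fun y => theta y * partial_conv (@poisson R) t psi s y).
have dF (s : R) : is_derive s 1 F (psi s * poisson_ext w theta s t).
  have := is_derive_scal t^-1 (dist_partial_conv_derive w s tth t0 (@poisson_smooth R)
    (@poisson_bounded_jets R) tpsi).
  by rewrite mulrCA.
rewrite (@integral_itv_derive _ _ F) //.
- rewrite {2}/F (_ : (fun y => _) = fun=> 0) ?dist0 ?mulr0 ?subr0//.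
  apply/funext => y; rewrite (partial_conv_eq0 _ _ _ psiM) ?mulr0//; lra.
- lra.
- move=> x; apply: cvgM; last exact: poisson_ext_continuous.
  exact (test_continuous tpsi (x := x)).
Qed.

Lemma pos_on_of_boundary w theta e1 e2 C t0 (Z : set R) : test_function theta ->
  (forall y, e1 < y < e2 -> theta y = 1) -> 0 < C -> 0 < t0 ->
  (forall x t, e1 <= x <= e2 -> 0 < t -> t <= t0 -> - C <= poisson_ext w theta x t) ->
  mu.-negligible Z ->
  (forall x, e1 < x < e2 -> ~ Z x -> forall e, 0 < e -> exists2 r, 0 < r &
    forall t, 0 < t -> t < r -> - e <= poisson_ext w theta x t) ->
  pos_on w e1 e2.
Proof.
move=> tth th1 C0 t00 lbd nZ bv psi tpsi psi0 psiE.
have [_ [M1 M10 psiM1]] := (test_functionP psi).1 tpsi.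
have [_ [M2 M20 thM2]] := (test_functionP theta).1 tth.
pose M := Num.max M1 M2; have M0 : 0 < M by rewrite lt_max M10.
have psiM : ball_supported M psi by apply: ball_supported_le psiM1; rewrite le_max lexx.
have thM : ball_supported M theta by apply: ball_supported_le thM2; rewrite le_max lexx orbT.
have E : (fun y => theta y * psi y) = psi.
  apply/funext => y; have [/th1 ->|/psiE ->] := boolP (e1 < y < e2); first exact: mul1r.
  by rewrite mulr0.
have := poisson_conv_limit (w := w) tth tpsi M0 thM psiM; rewrite E => /right_limP lim.
pose D : set R := `[(- (M + 2)), (M + 2)].
have mD : measurable D by exact: measurable_itv.
pose tn (n : nat) := t0 / n.+1%:R.
have tn0 n : 0 < tn n by rewrite divr_gt0.
have tn_le n : tn n <= t0 by rewrite ler_pdivrMr// ler_peMr ?(ltW t00)// ler1n.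
(* The extension is bounded only from below, so dominated convergence is applied to its negative
   part: it is dominated by [C psi] and tends to 0 almost everywhere. The integrals against the
   extension itself are no smaller and tend to [w psi]. *)
pose f (n : nat) x := psi x * Num.min 0 (poisson_ext w theta x (tn n)).
have hc n : continuous (fun x => poisson_ext w theta x (tn n)) by exact: poisson_ext_continuous.
have fc n : continuous (f n).
  move=> x; apply: cvgM; first exact (test_continuous tpsi (x := x)).
  by apply: (@continuous_min _ _ (fun=> 0) _ x); [exact: cvg_cst|exact: hc].
have phc n : continuous (fun x => psi x * poisson_ext w theta x (tn n)).
  by move=> x; apply: cvgM; [exact (test_continuous tpsi (x := x))|exact: hc].
have ci g : continuous g -> mu.-integrable D (EFin \o g).
  move=> cg; apply: continuous_compact_integrable; first exact: segment_compact.
  exact: continuous_subspaceT.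
have fb n x : `|f n x| <= C * psi x.
  rewrite normrM (ger0_norm (psi0 x)) mulrC.
  have [/andP[x1 x2]|/psiE ->] := boolP (e1 < x < e2); last by rewrite !mulr0.
  rewrite ler_wpM2r// ler0_norm ?ge_min ?lexx// lerNl le_min oppr_le0 (ltW C0) /=.
  by apply: lbd => //; rewrite !ltW.
have f0 x : ~ Z x -> (fun n => (f n x)%:E) @ \oo --> 0%E.
  move=> nZx; apply: cvg_EFin; first by apply: nearW.
  have [xe|/psiE p0] := boolP (e1 < x < e2); last first.
    rewrite (_ : (fun n => _) = fun=> 0); first exact: cvg_cst.
    by apply/funext => n; rewrite /f p0 mul0r.
  apply/cvgrPdist_le => e e0.
  have e'0 : 0 < e / (psi x + 1) by rewrite divr_gt0// ltr_wpDl.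
  have [r r0 rH] := bv x xe nZx _ e'0.
  exists (Num.bound (t0 / r)) => // n /= nr.
  have tr : tn n < r.
    rewrite /tn ltr_pdivrMr// mulrC -ltr_pdivrMr//.
    have tr0 : 0 <= t0 / r by rewrite divr_ge0 ?ltW.
    by rewrite (lt_le_trans (archi_boundP tr0))// ler_nat (leq_trans nr).
  have := rH (tn n) (tn0 n) tr; rewrite /f; set h := poisson_ext _ _ _ _ => hge.
  rewrite sub0r normrN normrM (ger0_norm (psi0 x)).
  have : `|Num.min 0 h| <= e / (psi x + 1).
    by rewrite ler0_norm ?ge_min ?lexx// lerNl le_min oppr_le0 (ltW e'0).
  move=> /(ler_wpM2l (psi0 x))/le_trans; apply.
  rewrite mulrCA ler_piMr ?(ltW e0)// ler_pdivrMr ?ltr_wpDl// mul1r; lra.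
have [] := @dominated_convergence _ _ R mu D mD (fun n x => (f n x)%:E) (fun=> 0%E)
  (fun x => (C * psi x)%:E).
- move=> n; apply/measurable_EFinP; apply: measurable_funTS.
  by apply: continuous_measurable_fun; exact: fc.
- exact: measurable_cst.
- have [N [mN N0 ZN]] := nZ; exists N; split=> // x /= nx; apply: ZN.
  by apply: contrapT => nZx; apply: nx => _; exact: f0.
- apply: ci => x; apply: cvgM; [exact: cvg_cst|exact (test_continuous tpsi (x := x))].
- by apply: aeW => x n _; rewrite /= lee_fin.
move=> _ _; rewrite integral0 => /fine_cvgP[_ /cvgrPdist_le cv].
rewrite leNgt; apply/negP => neg.
have e0 : 0 < - w psi / 4 by lra.
have [n0 _ Hn] := cv _ e0.
have [r r0 rH] := lim _ e0.
pose n := maxn n0 (Num.bound (t0 / r)).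
have tr : tn n < r.
  rewrite /tn ltr_pdivrMr// mulrC -ltr_pdivrMr//.
  have tr0 : 0 <= t0 / r by rewrite divr_ge0 ?ltW.
  by rewrite (lt_le_trans (archi_boundP tr0))// ler_nat (leq_trans (leq_maxr n0 _)).
have := rH (tn n) (tn0 n) tr; rewrite -(poisson_ext_integral w tth tpsi M0 psiM (tn0 n)).
have := Hn n (leq_maxl _ _).
have if1 : mu.-integrable D (EFin \o f n) := ci _ (fc n).
have if2 : mu.-integrable D (EFin \o (fun x => psi x * poisson_ext w theta x (tn n))) := ci _ (phc n).
have AB : \int[mu]_(x in D) f n x <= \int[mu]_(x in D) (psi x * poisson_ext w theta x (tn n)).
  apply: le_Rintegral; [exact: mD|exact: if1|exact: if2|].
  by move=> x _; rewrite ler_wpM2l// ge_min lexx orbT.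
move: AB; rewrite /Rintegral; set A := fine _; set B := fine _ => AB.
rewrite /= sub0r normrN => hA hB.
have {}hA : `|A| <= - w psi / 4 by exact: hA.
have {}hB : `|B - w psi| <= - w psi / 4 by exact: hB.
move: hA hB; rewrite !ler_norml => /andP[? ?] /andP[? ?]; lra.
Qed.

End BoundaryValues.

(** * The category argument on the set where positivity fails *)

Section Category.
Variable R : realType.
Implicit Types (f psi theta : R -> R) (a b c d e p r s t u x y z rho : R).
Implicit Types (w W : schwartz_distribution R) (E F S Z : set R).
Notation mu := (@lebesgue_measure R).

Lemma pos_near_open w x : pos_near w x -> exists2 rho, 0 < rho & forall y, `|y - x| < rho -> pos_near w y.
Proof.
move=> [rho rho0 H]; exists rho => // y; rewrite ltr_norml => /andP[y1 y2].
exists (Num.min (y - x + rho) (x + rho - y)); first by rewrite lt_min; apply/andP; split; lra.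
have m1 : Num.min (y - x + rho) (x + rho - y) <= y - x + rho by rewrite ge_min lexx.
have m2 : Num.min (y - x + rho) (x + rho - y) <= x + rho - y by rewrite ge_min lexx orbT.
apply: pos_on_sub H; lra.
Qed.

Lemma pos_near_outside w a b x : supported_in a b w -> ~~ (a <= x <= b) -> pos_near w x.
Proof.
move=> ws; rewrite negb_and -!ltNge => xab.
have [rho rho0 H] : exists2 rho, 0 < rho & forall y, a - rho < y < b + rho -> ~~ (x - rho < y < x + rho).
  case/orP: xab => h; [exists ((a - x) / 2)|exists ((x - b) / 2)]; try lra;
  move=> y /andP[y1 y2]; apply/negP => /andP[y3 y4]; lra.
exists rho => // psi tpsi _ psiE; rewrite (supported_inP ws tpsi rho0)// => y /H; exact: psiE.
Qed.

Lemma poisson_ext_pos_near w theta x : (forall p, tame 0 w p) -> test_function theta ->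
  (forall y, 0 <= theta y) -> pos_near w x ->
  exists2 C, 0 <= C & forall t, 0 < t -> - (C * t) <= poisson_ext w theta x t.
Proof.
move=> tw tth th0 [rho rho0 H]; pose d := Num.min rho 1.
have d0 : 0 < d by rewrite lt_min rho0 ltr01.
have d1 : d <= 1 by rewrite ge_min lexx orbT.
have dr : d <= rho by rewrite ge_min lexx.
(* The side estimate refers to a base point at distance [d]; [x + d] is taken as one. *)
have [C C0 CH] := poisson_ext_side (tw (x + d)) tth th0.
exists (C / d ^+ 2) => [|t t0]; first by rewrite divr_ge0// sqr_ge0.
rewrite mulrAC; apply: CH => //.
  by rewrite opprD addrA subrr add0r normrN ger0_norm// ltW.
by apply: pos_on_sub H; lra.
Qed.

Lemma closed_gap S e1 e2 x :
  (forall y, ~ S y -> exists2 rho, 0 < rho & forall z, `|z - y| < rho -> ~ S z) ->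
  S e1 -> S e2 -> e1 <= x <= e2 -> ~ S x ->
  exists p q, [/\ S p, S q, e1 <= p < x, x < q <= e2 & forall y, p < y < q -> ~ S y].
Proof.
move=> Sc S1 S2 /andP[x1 x2] nSx.
pose A := [set s | S s /\ s <= x]; pose B := [set s | S s /\ x <= s].
have supA : has_sup A by split; [exists e1|exists x => s []].
have infB : has_inf B by split; [exists e2|exists x => s []].
have pA : S (sup A).
  apply: contrapT => /Sc[rho rho0 H]; have [s [Ss sx] ss] := sup_adherent rho0 supA.
  apply: (H s) => //; rewrite ltr_norml; apply/andP; split; first lra.
  have : s <= sup A by exact: ub_le_sup supA.2 _ _.
  lra.
have qB : S (inf B).
  apply: contrapT => /Sc[rho rho0 H]; have [s [Ss sx] ss] := inf_adherent rho0 infB.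
  apply: (H s) => //; rewrite ltr_norml; apply/andP; split; last lra.
  have : inf B <= s by exact: ge_inf infB.2 _ _.
  lra.
have px : sup A <= x by apply: ge_sup supA.1 _ => s [].
have xq : x <= inf B by apply: lb_le_inf infB.1 _ => s [].
have e1p : e1 <= sup A by exact: ub_le_sup supA.2 _ _.
have qe2 : inf B <= e2 by exact: ge_inf infB.2 _ _.
exists (sup A), (inf B); split=> //.
- by rewrite e1p lt_neqAle px andbT; apply/eqP => H; apply: nSx; rewrite -H.
- by rewrite qe2 andbT lt_neqAle xq andbT; apply/eqP => H; apply: nSx; rewrite H.
- move=> y /andP[py yq] Sy; have [yx|xy] := leP y x.
    have : y <= sup A by exact: ub_le_sup supA.2 _ _.
    by rewrite leNgt py.
  have : inf B <= y by apply: (ge_inf infB.2); split=> //; exact: ltW.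
  by rewrite leNgt yq.
Qed.

(** The vertical bounds over the bad points of a portion, together with bounds at the two ends and
    at the top, extend over every gap by [poisson_ext_slab]; [pos_on_of_boundary] then applies on
    the whole interval. *)
Lemma pos_near_of_portion w theta a b c d (n : nat) x0 Z : (forall p, tame 0 w p) ->
  supported_in a b w -> test_function theta -> (forall y, 0 <= theta y) ->
  (forall y, a - 1 < y < b + 1 -> theta y = 1) -> mu.-negligible Z ->
  (forall x, a <= x <= b -> ~ Z x -> forall e, 0 < e -> exists2 r, 0 < r &
    forall t, 0 < t -> t < r -> - e <= poisson_ext w theta x t) ->
  c < x0 < d ->
  (forall x, ~ pos_near w x -> c < x < d ->
    forall t, 0 < t -> t <= n.+1%:R^-1 -> - n%:R <= poisson_ext w theta x t) ->
  pos_near w x0.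
Proof.
move=> tw ws tth th0 th1 nZ bv /andP[cx xd] Hn.
have [x0ab|/(pos_near_outside ws)//] := boolP (a <= x0 <= b).
move/andP: x0ab => [ax xb].
(* A quarter keeps the closed interval inside []c, d[], makes every gap shorter than 1, and leaves
   it within the region where [theta] is 1 with room to spare. *)
pose dl := Num.min (x0 - c) (Num.min (d - x0) 1) / 4.
have m1 : Num.min (x0 - c) (Num.min (d - x0) 1) <= x0 - c by rewrite ge_min lexx.
have m2 : Num.min (x0 - c) (Num.min (d - x0) 1) <= d - x0 by rewrite !ge_min lexx !orbT.
have m3 : Num.min (x0 - c) (Num.min (d - x0) 1) <= 1 by rewrite !ge_min lexx !orbT.
have m0 : 0 < Num.min (x0 - c) (Num.min (d - x0) 1) by rewrite !lt_min !subr_gt0 cx xd ltr01.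
pose e1 := x0 - dl; pose e2 := x0 + dl.
have dl0 : 0 < dl by rewrite /dl; lra.
have dl1 : dl <= 1 / 4 by rewrite /dl; lra.
have ce1 : c < e1 by rewrite /e1 /dl; lra.
have e2d : e2 < d by rewrite /e2 /dl; lra.
(* The ends [e1] and [e2] may be points of positivity; there the extension is at least [- C t],
   which still gives a bound on the vertical line. *)
have [n0 n00 Hv] : exists2 C, 0 <= C & forall x, ~ pos_near w x \/ x = e1 \/ x = e2 -> e1 <= x <= e2 ->
    forall t, 0 < t -> t <= n.+1%:R^-1 -> - C <= poisson_ext w theta x t.
  have pt x : c < x < d -> exists2 C, 0 <= C &
      forall t, 0 < t -> t <= n.+1%:R^-1 -> - C <= poisson_ext w theta x t.
    move=> xcd; have [px|npx] := pselect (pos_near w x); last first.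
      by exists n%:R => // t; exact: Hn.
    have [C C0 CH] := poisson_ext_pos_near tw tth th0 px.
    exists C => // t t0 tn; rewrite (le_trans _ (CH t t0))// lerN2 ler_piMr//.
    by rewrite (le_trans tn)// invf_le1// ler1n.
  have [|C1 C10 H1] := pt e1; first by rewrite ce1 /e1; lra.
  have [|C2 C20 H2] := pt e2; first by rewrite e2d andbT /e2; lra.
  exists (n%:R + C1 + C2) => [|x hx /andP[x1 x2] t t0 tn]; first by rewrite !addr_ge0.
  have nn0 : 0 <= n%:R :> R by [].
  case: hx => [npx|[->|->]].
  - have := Hn x npx _ t t0 tn; rewrite (lt_le_trans ce1 x1) (le_lt_trans x2 e2d) => /(_ isT); lra.
  - have := H1 t t0 tn; lra.
  - have := H2 t t0 tn; lra.
pose t0 : R := n.+1%:R^-1.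
have t00 : 0 < t0 by rewrite invr_gt0.
have t01 : t0 <= 1 by rewrite invf_le1// ler1n.
(* At the fixed height [t0] the extension is continuous in [x], which bounds it on the top edges of
   all gaps at once. *)
have [B B0 HB] := continuous_bounded_ball (`|x0| + 1) (poisson_ext_continuous tth t00 (w := w)).
have xB x : e1 <= x <= e2 -> `|x| <= `|x0| + 1.
  move=> /andP[x1 x2]; rewrite -[x](subrK x0) addrC (le_trans (ler_normD _ _))// lerD2l ler_norml.
  by apply/andP; split; rewrite /e1 /e2 in x1 x2; lra.
pose C := n0 + B + 1; have C0 : 0 < C by rewrite /C; lra.
have bound x t : e1 <= x <= e2 -> 0 < t -> t <= t0 -> - C <= poisson_ext w theta x t.
  move=> xe tpos tt0.
  (* Adding the two ends to the bad set keeps it closed and places each remaining point of the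
     interval in a gap with both ends in [S]. *)
  pose S := [set s | ~ pos_near w s \/ s = e1 \/ s = e2].
  have vS s : S s -> e1 <= s <= e2 -> forall t, 0 < t -> t <= t0 -> - C <= poisson_ext w theta s t.
    by move=> Ss se t' h1 h2; have := Hv s Ss se t' h1 h2; rewrite /C; lra.
  have [Sx|nSx] := pselect (S x); first exact: vS.
  have Sc y : ~ S y -> exists2 rho, 0 < rho & forall z, `|z - y| < rho -> ~ S z.
    move=> nSy; have py : pos_near w y by apply: contrapT => h; apply: nSy; left.
    have ye1 : y != e1 by apply/eqP => h; apply: nSy; right; left.
    have ye2 : y != e2 by apply/eqP => h; apply: nSy; right; right.
    have [rho rho0 H] := pos_near_open py.
    exists (Num.min rho (Num.min `|e1 - y| `|e2 - y|)).
      by rewrite !lt_min rho0 !normr_gt0 !subr_eq0 ![_ == y]eq_sym ye1 ye2.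
    move=> z; rewrite !lt_min => /and3P[z1 z2 z3] [|[zE|zE]]; first by apply; exact: H.
      by move: z2; rewrite zE ltxx.
    by move: z3; rewrite zE ltxx.
  have S1 : S e1 by right; left.
  have S2 : S e2 by right; right.
  have [p [q [Sp Sq /andP[p1 p2] /andP[q1 q2] gap]]] := closed_gap Sc S1 S2 xe nSx.
  have pe : e1 <= p <= e2 by rewrite p1 /= ltW// (lt_trans p2)// (lt_le_trans q1).
  have qe : e1 <= q <= e2 by rewrite q2 andbT ltW// (le_lt_trans p1)// (lt_trans p2).
  have e40 : 0 < 1 / 4 :> R by lra.
  have thpq y : p - 1 / 4 < y < q + 1 / 4 -> theta y = 1.
    move=> /andP[y1 y2]; apply: th1; rewrite /e1 /e2 in p1 q2.
    by clear -y1 y2 p1 q2 dl1 ax xb; apply/andP; split; lra.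
  have pq : p < q := lt_trans p2 q1.
  have pq1 : q <= p + 1 by rewrite /e1 /e2 in p1 q2; clear -p1 q2 dl1; lra.
  have xpq : p <= x <= q by rewrite !ltW.
  apply: (poisson_ext_slab (tw p) (tw q) tth th0 e40 thpq pq pq1 C0 t00 t01) xpq tpos tt0.
  - by move=> t' h1 h2; split; apply: vS.
  - move=> y /andP[y1 y2]; have := HB y (xB y _); rewrite (le_trans p1 y1) (le_trans y2 q2) => /(_ isT).
    by rewrite ler_norml => /andP[]; rewrite /C -/t0; clear -n00; lra.
  - by move=> y /gap nSy; apply: contrapT => h; apply: nSy; left.
exists dl => //; apply: (pos_on_of_boundary tth _ C0 t00 bound nZ).
  move=> y /andP[y1 y2]; apply: th1; apply/andP; split; rewrite /e1 /e2 in y1 y2; lra.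
move=> x xe nZx e e0.
have [px|npx] := pselect (pos_near w x); last first.
  apply: bv => //; apply/negPn/negP => /(pos_near_outside ws); exact: npx.
have [D D0 DH] := poisson_ext_pos_near tw tth th0 px.
exists (e / (D + 1)); first by rewrite divr_gt0// ltr_wpDl.
move=> t tpos; rewrite ltr_pdivlMr ?ltr_wpDl// => te.
by rewrite (le_trans _ (DH t tpos))// lerN2; lra.
Qed.

Lemma pos_near_of_boundary w W theta a b E Z : is_derivative_of w W -> lojasiewicz_distribution W ->
  supported_in a b w -> test_function theta -> (forall y, 0 <= theta y) ->
  (forall y, a - 1 < y < b + 1 -> theta y = 1) -> countable E -> mu.-negligible Z ->
  (forall x, a <= x <= b -> ~ E x -> exists (N : nat) r, 0 < r /\
    forall t, 0 < t -> t < r -> - N%:R <= poisson_ext w theta x t) ->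
  (forall x, a <= x <= b -> ~ Z x -> forall e, 0 < e -> exists2 r, 0 < r &
    forall t, 0 < t -> t < r -> - e <= poisson_ext w theta x t) ->
  forall x, pos_near w x.
Proof.
move=> wW Wl ws tth th0 th1 cE nZ bE bZ x0; apply: contrapT => Fx0.
have tw p : tame 0 w p by have [l Wp] := Wl p; exact: derivative_tame wW Wp.
have /countable_injP[f fE] := cE.
pose F x := ~ pos_near w x.
(* Pairs are a bad centre and a radius. The [n]-th step shrinks the interval, discards the point of
   [E] numbered [n], and makes the extension drop below [- n] at some height at most [1 / (n + 1)]
   over the entire new interval. *)
pose Q (n : nat) (q q' : R * R) := [/\ F q'.1, 0 < q'.2, q'.2 <= n.+1%:R^-1,
  `|q'.1 - q.1| + q'.2 <= q.2 & forall z, `|z - q'.1| <= q'.2 ->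
    (E z -> f z != n) /\ exists t, [/\ 0 < t, t <= n.+1%:R^-1 & poisson_ext w theta z t < - n%:R]].
have step n q : F q.1 -> 0 < q.2 -> exists q', Q n q q'.
  case: q => x rho /= Fx rho0.
  (* If the centre is the point of [E] to be discarded, another bad point is close by: otherwise the
     centre would be isolated and [pos_near_isolated] would make it good. *)
  have [y [Fy yx yE]] : exists y, [/\ F y, `|y - x| < rho & E y -> f y != n].
    have [[e [Ee fe]]|noe] := pselect (exists e, E e /\ f e = n); last first.
      exists x; split=> //; first by rewrite subrr normr0.
      by move=> Ex; apply/eqP => fx; apply: noe; exists x.
    have [y [Fy yx ye]] : exists y, [/\ F y, `|y - x| < rho & y != e].
      apply: contrapT => H.
      have xe : x = e.
        by apply: contrapT => /eqP xe; apply: H; exists x; rewrite subrr normr0.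
      have [l Wx] := Wl x; apply: Fx; apply: (pos_near_isolated wW Wx rho0) => y yx yr.
      by apply: contrapT => Fy; apply: H; exists y; rewrite -xe.
    exists y; split=> // Ey; apply/eqP => fy; move/eqP: ye; apply.
    by apply: fE; rewrite ?inE// fe.
  have [s s0 sE] : exists2 s, 0 < s & forall z, `|z - y| < s -> E z -> f z != n.
    have [[e [Ee fe]]|noe] := pselect (exists e, E e /\ f e = n); last first.
      by exists 1 => // z _ Ez; apply/eqP => fz; apply: noe; exists z.
    have ey : e != y.
      by apply/eqP => ey; move: Ee fe; rewrite ey => Ey fy; move: (yE Ey); rewrite fy eqxx.
    exists `|e - y|; first by rewrite normr_gt0 subr_eq0.
    move=> z zy Ez; apply/eqP => fz; have ze : z = e by apply: fE; rewrite ?inE// fe.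
    by move: zy; rewrite ze ltxx.
  pose s' := Num.min s (rho - `|y - x|).
  have s'0 : 0 < s' by rewrite lt_min s0 subr_gt0.
  (* Were the extension bounded below by [- n] at low heights over all bad points nearby,
     [pos_near_of_portion] would make [y] good. *)
  have [v [Fv vy [t [t0 tn vt]]]] : exists v, [/\ F v, `|v - y| < s' &
      exists t, [/\ 0 < t, t <= n.+1%:R^-1 & poisson_ext w theta v t < - n%:R]].
    apply: contrapT => H; apply: Fy.
    apply: (@pos_near_of_portion w theta a b (y - s') (y + s') n y Z) => //.
      by apply/andP; split; lra.
    move=> v Fv /andP[v1 v2] t t0 tn; rewrite leNgt; apply/negP => vt; apply: H.
    exists v; split=> //; first by rewrite ltr_norml; apply/andP; split; lra.
    by exists t.
  (* The height [t] is now fixed, and continuity in [x] spreads the strict inequality from [v] to an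
     interval. *)
  have /cvgrPdist_lt cv := poisson_ext_continuous (w := w) (x := v) tth t0.
  have g0 : 0 < - n%:R - poisson_ext w theta v t by rewrite subr_gt0.
  have [r /= r0 rH] := cv _ g0.
  have s'v : 0 < s' - `|v - y| by rewrite subr_gt0.
  exists (v, Num.min n.+1%:R^-1 (Num.min (r / 2) ((s' - `|v - y|) / 2))).
  have k1 : s' <= s by rewrite ge_min lexx.
  have k2 : s' <= rho - `|y - x| by rewrite ge_min lexx orbT.
  split=> //=.
  - by rewrite !lt_min invr_gt0 ltr0n !divr_gt0.
  - by rewrite ge_min lexx.
  - have : Num.min n.+1%:R^-1 (Num.min (r / 2) ((s' - `|v - y|) / 2)) <= (s' - `|v - y|) / 2.
      by rewrite !ge_min lexx !orbT.
    have := ler_distD y v x; lra.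
  - move=> z; rewrite !le_min => /and3P[_ z1 z2]; split.
      by apply: sE; have := ler_distD v z y; lra.
    exists t; split=> //; have := rH z; rewrite /= distrC => /(_ _) h.
    have {}h : `|poisson_ext w theta v t - poisson_ext w theta z t| < - n%:R - poisson_ext w theta v t.
      by apply: h; lra.
    by move: h; rewrite ltr_norml => /andP[? ?]; lra.
have [g gP] : exists g : nat -> R * R -> R * R, forall n q, F q.1 -> 0 < q.2 -> Q n q (g n q).
  have [g gP] : {g : nat * (R * R) -> R * R & forall nq, F nq.2.1 -> 0 < nq.2.2 -> Q nq.1 nq.2 (g nq)}.
    apply: (choice (P := fun nq q' => F nq.2.1 -> 0 < nq.2.2 -> Q nq.1 nq.2 q')) => -[n q] /=.
    have [[Fq q0]|nq] := pselect (F q.1 /\ 0 < q.2); last by exists q => h1 h2; case: nq.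
    by have [q' Hq'] := step n q Fq q0; exists q'.
  by exists (fun n q => g (n, q)) => n q; exact: (gP (n, q)).
pose v := fix v n := if n is m.+1 then g m (v m) else (x0, 1).
have vF n : F (v n).1 /\ 0 < (v n).2.
  elim: n => [|n [h1 h2]]; first by split; [exact: Fx0|exact: ltr01].
  by have [] := gP n (v n) h1 h2.
have vQ n : Q n (v n) (v n.+1) by have [h1 h2] := vF n; exact: gP.
have vnest n m : (n <= m)%N -> `|(v m).1 - (v n).1| + (v m).2 <= (v n).2.
  move=> /subnK <-; elim: (m - n)%N => [|k IH]; first by rewrite subrr normr0 add0r.
  rewrite addSn; have [_ _ _ h _] := vQ (k + n)%N.
  have := ler_distD (v (k + n)%N).1 (v (k + n).+1).1 (v n).1; lra.
have [| |l lv] := @nested_limit R (fun n => (v n).1) (fun n => (v n).2) 0%N.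
- by move=> n; have [_ /ltW] := vF n.
- by move=> n m _ nm; have := vnest n m nm; have [_] := vF m; lra.
have lQ n : (E l -> f l != n) /\ exists t, [/\ 0 < t, t <= n.+1%:R^-1 & poisson_ext w theta l t < - n%:R].
  by have [_ _ _ _] := vQ n; apply; exact: lv.
(* The common point [l] is outside [E] by the choice of the steps and is bad because the bad set is
   closed; yet the extension is below [- n] over it at arbitrarily small heights for every [n],
   against the lower bound off [E]. *)
have nEl : ~ E l by move=> El; have [/(_ El)] := lQ (f l); rewrite eqxx.
have Fl : F l.
  move=> /pos_near_open[rho rho0 H].
  have [n nrho] : exists n : nat, n.+1%:R^-1 < rho.
    exists (Num.bound rho^-1); rewrite -ltf_pV2 ?posrE ?invr_gt0// invrK.
    by rewrite (lt_trans (archi_boundP _)) ?ltr_nat// invr_ge0 ltW.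
  have [Fv _ vn _ _] := vQ n; apply: Fv; apply: H.
  by rewrite distrC (le_lt_trans (lv n.+1 (leq0n _)))// (le_lt_trans vn).
have lab : a <= l <= b by apply/negPn/negP => /(pos_near_outside ws).
have [N [r [r0 rH]]] := bE l lab nEl.
pose n := maxn N (Num.bound r^-1).
have [_ [t [t0 tn]]] := lQ n; rewrite ltNge => /negP; apply.
rewrite (le_trans _ (rH t t0 _)) ?lerN2 ?ler_nat ?leq_maxl//.
rewrite (le_lt_trans tn)// -ltf_pV2 ?posrE ?invr_gt0// invrK.
rewrite (lt_le_trans (archi_boundP _)) ?invr_ge0 ?(ltW r0)// ler_nat.
by rewrite (leq_trans (leq_maxr N _)).
Qed.

End Category.

(** * Comparison of major and minor pairs, and integrability *)

Section Comparison.
Variable R : realType.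
Implicit Types (f k phi psi theta : R -> R) (a b c d e l p r s t u x y z rho : R).
Implicit Types (w W U V : schwartz_distribution R).
Notation mu := (@lebesgue_measure R).

Lemma point_value_sub W U V x l1 l2 :
  (forall psi, test_function psi -> W psi = U psi - V psi :> R) ->
  has_point_value U x l1 -> has_point_value V x l2 -> has_point_value W x (l1 - l2).
Proof.
move=> WE HU HV; apply: has_point_value_right => phi tphi.
have /right_limP h1 := point_value_right HU tphi.
have /right_limP h2 := point_value_right HV tphi.
apply/right_limP => e e0; have e20 : 0 < e / 2 by lra.
have [r1 r10 H1] := h1 _ e20; have [r2 r20 H2] := h2 _ e20.
exists (Num.min r1 r2); first by rewrite lt_min r10.
move=> t t0; rewrite lt_min => /andP[t1 t2].
have tn0 : t != 0 by rewrite gt_eqF.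
have := H1 t t0 t1; have := H2 t t0 t2.
rewrite /rescaled (WE _ (test_dilate x tn0 tphi)) mulrBr mulrBl.
move: (`|t|^-1 * U _) (`|t|^-1 * V _) => A B.
rewrite !ler_norml => /andP[? ?] /andP[? ?]; apply/andP; split; lra.
Qed.

Lemma cutoff_irrelevant a b w theta1 theta2 k : supported_in a b w -> is_cutoff a b theta1 ->
  is_cutoff a b theta2 -> smooth k -> w (fun y => theta1 y * k y) = w (fun y => theta2 y * k y).
Proof.
move=> ws c1 c2 ks.
rewrite -(supported_mul_cutoff ws c2 (test_mul c1.1 ks)).
rewrite -(supported_mul_cutoff ws c1 (test_mul c2.1 ks)).
by congr (w _); apply/funext => y; rewrite mulrCA.
Qed.

(** A smoothed indicator of the interval, [Psi], is a nonnegative test function whose derivative is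
    the difference of two normalized bumps at [a] and [b]. Thus [w Psi] is the difference of
    averages of [W] there, and these tend to the point values. *)
Lemma point_value_mono w W a b l1 l2 : is_derivative_of w W -> a <= b ->
  (forall psi, test_function psi -> (forall y, 0 <= psi y) -> 0 <= w psi) ->
  has_point_value W a l1 -> has_point_value W b l2 -> l1 <= l2.
Proof.
move=> wW ab wpos Wa Wb.
have La := point_value_right Wa (unit_bump_test R).
have Lb := point_value_right Wb (unit_bump_test R).
rewrite unit_bump_integral mulr1 in La; rewrite unit_bump_integral mulr1 in Lb.
move: ab; rewrite le_eqVlt => /predU1P[abE|ab].
  by rewrite abE in La; rewrite (right_lim_uniq La Lb).
rewrite leNgt; apply/negP => l21.
have e0 : 0 < (l1 - l2) / 3 by lra.
have [r1 r10 H1] := (right_limP _ _).1 La _ e0.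
have [r2 r20 H2] := (right_limP _ _).1 Lb _ e0.
pose t := Num.min (Num.min r1 r2) (b - a) / 2.
have m0 : 0 < Num.min (Num.min r1 r2) (b - a) by rewrite !lt_min r10 r20 subr_gt0.
have t0 : 0 < t by rewrite divr_gt0.
have tlt : t < Num.min (Num.min r1 r2) (b - a) by rewrite /t; lra.
move: tlt; rewrite !lt_min => /andP[/andP[t1 t2] tab].
have tn0 : t != 0 by rewrite gt_eqF.
have ss p : smooth (fun y : R => sstep ((y - p) / t)) := smooth_dilate (p := p) (t := t) (@sstep_smooth R).
pose Psi y := sstep ((y - a) / t) - sstep ((y - b) / t).
have Psis : smooth Psi := smooth_sub (ss a) (ss b).
have tPsi : test_function Psi.
  apply/test_functionP; split; first exact: Psis.
  exists (`|a| + `|b| + t); first by rewrite ltr_wpDl// addr_ge0.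
  have := ler_norm a; have := ler_norm b; have := ler_norm (- a); have := ler_norm (- b).
  rewrite !normrN => ? ? ? ? y; rewrite ltr_normr => /orP[yM|yM]; rewrite /Psi.
    by rewrite !sstep_eq1 ?subrr// ler_pdivlMr// mul1r; have := normr_ge0 a; have := normr_ge0 b; lra.
  by rewrite !sstep_eq0 ?subrr// ler_pdivrMr// mul0r; have := normr_ge0 a; have := normr_ge0 b; lra.
have Psi0 y : 0 <= Psi y.
  rewrite /Psi subr_ge0; have [yb|yb] := leP y b.
    by rewrite [leLHS]sstep_eq0 ?sstep_ge0// ler_pdivrMr// mul0r subr_le0.
  by rewrite [leRHS]sstep_eq1 ?sstep_le1// ler_pdivlMr// mul1r; lra.
have dPsi : derive1 Psi = fun y => t^-1 * unit_bump ((y - a) / t) - t^-1 * unit_bump ((y - b) / t).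
  rewrite -[derive1 Psi]/(derive1n 1 Psi) (derive1n_sub 1 (ss a) (ss b)).
  by rewrite /= !(derive1_dilate _ t (@sstep_smooth R)).
have tb p : test_function (fun y => unit_bump ((y - p) / t)) := test_dilate p tn0 (unit_bump_test R).
pose A := rescaled W a t (@unit_bump R); pose B := rescaled W b t (@unit_bump R).
have AE : W (fun y => t^-1 * unit_bump ((y - a) / t)) = A.
  by rewrite /A (rescaled_pos W a (@unit_bump R) t0) (dist_scal W t^-1 (tb a)).
have BE : W (fun y => t^-1 * unit_bump ((y - b) / t)) = B.
  by rewrite /B (rescaled_pos W b (@unit_bump R) t0) (dist_scal W t^-1 (tb b)).
have le : 0 <= - (A - B).
  rewrite -AE -BE -(dist_sub W (test_scal t^-1 (tb a)) (test_scal t^-1 (tb b))) -dPsi.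
  by rewrite -(wW Psi tPsi); exact: wpos.
have hA : `|A - l1| <= (l1 - l2) / 3 := H1 t t0 t1.
have hB : `|B - l2| <= (l1 - l2) / 3 := H2 t t0 t2.
move: l21 le hA hB; clear; rewrite !ler_norml => ? ? /andP[? ?] /andP[? ?]; lra.
Qed.

Lemma major_minor_le a b f (u v : schwartz_distribution R) U V r1 r2 : a <= b ->
  major_pair a b (fun x => (f x)%:E) u U -> minor_pair a b (fun x => (f x)%:E) v V ->
  has_point_value U b r1 -> has_point_value V b r2 -> r2 <= r1.
Proof.
move=> ab [us Ul uU Ua [E1 [Z1 [cE1 nZ1 lo1 fin1]]]] [vs Vl vV Va [E2 [Z2 [cE2 nZ2 up2 fin2]]]] Ub Vb.
have [w wE] := dist_diff_exists u v; have [W WE] := dist_diff_exists U V.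
have wW : is_derivative_of w W.
  move=> phi tphi; rewrite (wE _ tphi) (uU _ tphi) (vV _ tphi) (WE _ (test_derive1 tphi)).
  by rewrite opprB opprK addrC.
have Wl : lojasiewicz_distribution W.
  move=> x; have [l1 h1] := Ul x; have [l2 h2] := Vl x.
  by exists (l1 - l2); exact: point_value_sub h1 h2.
have ws : supported_in a b w by move=> psi tpsi h; rewrite (wE _ tpsi) (us _ tpsi h) (vs _ tpsi h) subrr.
(* The cut-off selected by [eapp] is not known to be nonnegative or to equal 1 up to distance 1, so
   the explicit one replaces it. *)
pose theta := @cutoff_at R a b.
have cth : is_cutoff a b theta := cutoff_at_cutoff a b.
have cth0 := eapp_cutoff a b.
have tth : test_function theta := cutoff_at_test a b.
have ps := @poisson_smooth R.
have extE x t : 0 < t -> poisson_ext w theta x t =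
    rescaled (eapp a b u) x t (@poisson R) - rescaled (eapp a b v) x t (@poisson R).
  move=> t0; have pd : smooth (fun y : R => poisson ((y - x) / t)) := smooth_dilate (p := x) (t := t) ps.
  rewrite /rescaled /eapp (gtr0_norm t0) (cutoff_irrelevant us cth0 cth pd).
  by rewrite (cutoff_irrelevant vs cth0 cth pd) -mulrBr /poisson_ext (wE _ (test_mul tth pd)).
have th0 y : 0 <= theta y by rewrite /theta; exact: cutoff_at_ge0.
have th1 y : a - 1 < y < b + 1 -> theta y = 1.
  by move=> /andP[y1 y2]; apply: cutoff_at_eq1; rewrite !ltW.
suff pos : forall x, pos_near w x.
  have := point_value_mono wW ab (fun psi => pos_everywhere pos) (point_value_sub WE Ua Va)
    (point_value_sub WE Ub Vb).
  by rewrite subrr subr_ge0.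
apply: (@pos_near_of_boundary R w W theta a b (E1 `|` E2) (Z1 `|` Z2)) => //.
- rewrite -bigcup2E; apply: bigcup_countable => // -[|[|i]] _ //=; exact: countable0.
- exact: negligibleU.
- move=> x xab nE.
  have h1 := fin1 x _ xab (fun h => nE (or_introl h)) (@poisson_T1 R).
  have h2 := fin2 x _ xab (fun h => nE (or_intror h)) (@poisson_T1 R).
  (* The lower value may be [+oo], where any real [c1] serves; likewise below for an upper value
     [-oo]. *)
  have [c1 /limf_einf_gt[s1 s10 H1]] : exists c1, (c1%:E < lower_value a b u (@poisson R) x)%E.
    move: h1; case: (lower_value _ _ _ _ _) => [q| |] //= _.
      by exists (q - 1); rewrite lte_fin; lra.
    by exists 0; rewrite ltry.
  have [c2 /limf_esup_lt[s2 s20 H2]] : exists c2, (upper_value a b v (@poisson R) x < c2%:E)%E.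
    move: h2; case: (upper_value _ _ _ _ _) => [q| |] //= _.
      by exists (q + 1); rewrite lte_fin; lra.
    by exists 0; rewrite ltNyr.
  exists (Num.bound `|c2 - c1|), (Num.min s1 s2); split; first by rewrite lt_min s10.
  move=> t t0; rewrite lt_min => /andP[t1 t2]; rewrite (extE x t t0).
  have := H1 t t0 t1; have := H2 t t0 t2.
  have := archi_boundP (normr_ge0 (c2 - c1)); have := ler_norm (c2 - c1).
  move: (_%:R) (rescaled _ _ _ _) (rescaled _ _ _ _) => A B C; lra.
- move=> x xab nZ e e0.
  have h1 := lo1 x _ xab (fun h => nZ (or_introl h)) (@poisson_T0 R).
  have h2 := up2 x _ xab (fun h => nZ (or_intror h)) (@poisson_T0 R).
  have [s1 s10 H1] : exists2 r, 0 < r & forall t, 0 < t -> t < r ->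
      f x - e / 2 <= rescaled (eapp a b u) x t (@poisson R).
    by apply: limf_einf_gt; apply: lt_le_trans h1; rewrite lte_fin; lra.
  have [s2 s20 H2] : exists2 r, 0 < r & forall t, 0 < t -> t < r ->
      rescaled (eapp a b v) x t (@poisson R) <= f x + e / 2.
    by apply: limf_esup_lt; apply: le_lt_trans h2 _; rewrite lte_fin; lra.
  exists (Num.min s1 s2); first by rewrite lt_min s10.
  move=> t t0; rewrite lt_min => /andP[t1 t2]; rewrite (extE x t t0).
  have := H1 t t0 t1; have := H2 t t0 t2; lra.
Qed.

Lemma regulated_dist_integrable f a b : regulated_function f -> a <= b ->
  dist_integrable a b (fun x => (f x)%:E).
Proof.
move=> [g gr gf] ab; have [u [U [maj min]]] := exact_pair gr gf ab.
split; [by exists u, U|by exists u, U|].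
have [_ Ul _ _ _] := maj; have [r Ub] := Ul b.
have minr : minor_values a b (fun x => (f x)%:E) r%:E by exists r => //; exists u, U.
have majr : major_values a b (fun x => (f x)%:E) r%:E by exists r => //; exists u, U.
(* The value [r] of the exact pair belongs to both sets. Comparing it with every other minor and
   major value makes it the greatest of the former and the least of the latter. *)
apply: (@eq_trans _ _ r%:E).
  apply/eqP; rewrite eq_le; apply/andP; split; last exact: ereal_sup_ubound.
  apply: ge_ereal_sup => _ [r2 [v [V [minv Vb]]] <-]; rewrite lee_fin.
  exact: major_minor_le maj minv Ub Vb.
apply/eqP; rewrite eq_le; apply/andP; split; last exact: ereal_inf_lbound.
apply: le_ereal_inf_tmp => _ [r1 [v [V [majv Vb]]] <-]; rewrite lee_fin.
exact: major_minor_le majv min Vb Ub.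
Qed.

End Comparison.

Theorem theorem6p6 (R : realType) :
  (forall G : R -> R, lojasiewicz_function G ->
     forall a b : R, a <= b -> dist_integrable a b (fun x => (G x)%:E)) /\
  (forall f : R -> R, regulated_function f ->
     forall a b : R, a <= b -> dist_integrable a b (fun x => (f x)%:E)).
Proof.
split=> f hf a b ab; apply: regulated_dist_integrable => //.
exact: lojasiewicz_regulated.
Qed.
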